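(* Let $R>0$, $p\in(0,1)\cup(1,+\infty)$ and $\sigma>-1$, and let $B_R\subset\mathbb{R}^2$ be the ball of radius $R$ centred at the origin, with curvature $\kappa=\frac1R$. There exists a unique positive radial solution of the Steklov problem $$\begin{cases}\Delta^2u=|u|^{p-1}u & \text{in }B_R,\\ u=\Delta u-(1-\sigma)\kappa u_n=0 & \text{on }\partial B_R,\end{cases}$$ and it is strictly decreasing in the radial variable.
   Context: Here $u_n$ denotes the outward normal derivative of $u$ on $\partial B_R$, and ''positive'' means $u>0$ in $B_R$. Solutions are understood in the weak sense: $u\in H^2(B_R)\cap H^1_0(B_R)$ with $\int_{B_R}\Delta u\,\Delta\varphi-(1-\sigma)\int_{\partial B_R}\kappa u_n\varphi_n=\int_{B_R}|u|^{p-1}u\,\varphi$ for all $\varphi\in H^2(B_R)\cap H^1_0(B_R)$, i.e. $u$ is a critical point of $J_\sigma(u)=\int_{B_R}\frac{(\Delta u)^2}{2}-\frac{1-\sigma}{2}\int_{\partial B_R}\kappa u_n^2-\int_{B_R}\frac{|u|^{p+1}}{p+1}$ on $H^2(B_R)\cap H^1_0(B_R)$. *)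

(* Defs.v *)
From HB Require Import structures.
From mathcomp Require Import all_boot all_order all_algebra.
From mathcomp Require Import all_classical all_reals all_analysis.
Set Implicit Arguments.
Unset Strict Implicit.
Unset Printing Implicit Defensive.
Import Order.TTheory GRing.Theory Num.Theory.
Import numFieldNormedType.Exports.
Local Open Scope classical_set_scope.
Local Open Scope ring_scope.

Section Plane.
Context {R : realType}.
Implicit Types (f g u v : R * R -> R) (x e : R * R) (B : set (R * R)) (r : R).

(* The library norm on [R * R] is the max norm. *)
Definition enorm x : R := Num.sqrt (x.1 ^+ 2 + x.2 ^+ 2).
Definition disc r : set (R * R) := [set x | enorm x < r].
Definition cdisc r : set (R * R) := [set x | enorm x <= r].

Definition e1 : R * R := (1, 0).
Definition e2 : R * R := (0, 1).

Definition leb1 : {measure set (measurableTypeR R) -> \bar R} :=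
  (@lebesgue_measure R).
Definition leb2 : {measure set (measurableTypeR R * measurableTypeR R) -> \bar R} :=
  (@lebesgue_measure R \x @lebesgue_measure R)%E.

(* [Ck k.+1] demands continuous first partials, hence total differentiability
   and continuity of [f] itself. *)
Fixpoint Ck (k : nat) f : Prop :=
  if k is j.+1 then
    [/\ forall x, derivable f x e1 /\ derivable f x e2,
        Ck j (fun x => 'D_e1 f x) & Ck j (fun x => 'D_e2 f x)]
  else continuous f.
Definition smooth f := forall k, Ck k f.

Definition test_function B f :=
  [/\ smooth f, compact (closure [set x | f x != 0]) &
      closure [set x | f x != 0] `<=` B].

Definition L2 B f : Prop := (f \_ B : measurableTypeR R * measurableTypeR R -> R)
  \in Lfun leb2 2%:E.

Definition L2dist B f g : \bar R :=
  Lnorm leb2 2%:E (EFin \o ((fun x => f x - g x) \_ B)).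

Definition is_weak_deriv B e u g :=
  L2 B g /\
  forall phi, test_function B phi ->
    \int[leb2]_(x in B) (u x * 'D_e phi x) =
    - \int[leb2]_(x in B) (g x * phi x).

(* A chosen representative of the weak derivative, which is unique up to
   null sets; meaningless when there is none. *)
Definition wD B e u : R * R -> R := xget (cst 0) [set g | is_weak_deriv B e u g].

Definition H1 B u :=
  [/\ L2 B u, exists g, is_weak_deriv B e1 u g &
      exists g, is_weak_deriv B e2 u g].

Definition H2 B u := [/\ H1 B u, H1 B (wD B e1 u) & H1 B (wD B e2 u)].

(* H^1(B)-convergence to [u] of a sequence of smooth functions. *)
Definition H1_cvg B (w : nat -> R * R -> R) u :=
  [/\ L2dist B (w n) u @[n --> \oo] --> 0%E,
      L2dist B (fun x => 'D_e1 (w n) x) (wD B e1 u) @[n --> \oo] --> 0%E &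
      L2dist B (fun x => 'D_e2 (w n) x) (wD B e2 u) @[n --> \oo] --> 0%E].

Definition H10 B u :=
  H1 B u /\
  exists2 w : nat -> R * R -> R, forall n, test_function B (w n) & H1_cvg B w u.

Definition wlaplacian B u x : R :=
  wD B e1 (wD B e1 u) x + wD B e2 (wD B e2 u) x.

Definition circle r (t : R) : R * R := (r * cos t, r * sin t).

(* Integral over the boundary of [disc r] with respect to arc length. *)
Definition circle_int r f : R :=
  r * \int[leb1]_(t in `[0, 2 * pi]) f (circle r t).

Definition circle_L2 r f : Prop :=
  ((f \o circle r) \_ `[0, 2 * pi] : measurableTypeR R -> R) \in Lfun leb1 2%:E.

Definition circle_L2dist r f g : \bar R :=
  Lnorm leb1 2%:E
    (EFin \o ((fun t => f (circle r t) - g (circle r t)) \_ `[0, 2 * pi])).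

(* [g] is the trace on the circle of [v] in H^1(disc r): the continuous
   extension to H^1 of the restriction map on functions smooth up to the
   boundary, which are dense. *)
Definition is_trace r v g :=
  circle_L2 r g /\
  exists w : nat -> R * R -> R,
    [/\ forall n, smooth (w n), H1_cvg (disc r) w v &
        circle_L2dist r (w n) g @[n --> \oo] --> 0%E].

(* Chosen representative, unique up to null sets of the circle. *)
Definition trace r v : R * R -> R := xget (cst 0) [set g | is_trace r v g].

(* The outward unit normal at a boundary point [x] is [x / r]. *)
Definition normal_deriv r u x : R :=
  (x.1 / r) * trace r (wD (disc r) e1 u) x +
  (x.2 / r) * trace r (wD (disc r) e2 u) x.

Definition steklov_weak_solution r (kappa sigma p : R) u :=
  let B := disc r in
  [/\ H2 B u, H10 B u &
    forall phi, H2 B phi -> H10 B phi ->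
      \int[leb2]_(x in B) (wlaplacian B u x * wlaplacian B phi x)
      - (1 - sigma) *
        circle_int r (fun x => kappa * normal_deriv r u x * normal_deriv r phi x)
      = \int[leb2]_(x in B) (`|u x| `^ (p - 1) * u x * phi x)].

Definition radial r u :=
  forall x y, cdisc r x -> cdisc r y -> enorm x = enorm y -> u x = u y.

Definition radially_decreasing r u :=
  forall x y, cdisc r x -> cdisc r y -> enorm x < enorm y -> u y < u x.

(* In dimension two every class in H^2(disc r) has exactly one representative
   continuous on the closed disc; pointwise properties refer to it. *)
Definition positive_radial_solution r (kappa sigma p : R) u :=
  [/\ steklov_weak_solution r kappa sigma p u,
      {within cdisc r, continuous u},
      forall x, disc r x -> 0 < u x & radial r u].

End Plane.

(* Main.v *)
From HB Require Import structures.
Require Import Defs.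
From mathcomp Require Import all_boot all_order all_algebra.
From mathcomp Require Import all_classical all_reals all_analysis.
From mathcomp Require Import measurable_realfun ring lra.
Set Implicit Arguments.
Unset Strict Implicit.
Unset Printing Implicit Defensive.
Import Order.TTheory GRing.Theory Num.Theory.
Import numFieldNormedType.Exports.
Local Open Scope classical_set_scope.
Local Open Scope ring_scope.

(** Write [s = |x|^2] and [S = r^2]. For a continuous radial right-hand side [G] the linear
Steklov problem is solved explicitly: with [avg g s] the mean of [g] over [[0, s]] and
[mint g s = 1/4 \int_0^s avg g], the Laplacian of the solution is [V = c + mint G], the
solution itself is [mint V - mint V S], and the condition on the Laplacian reads
[V S = k * avg V S] with [k = (1 - sigma) / 2 < 1]. Testing the equation of a positive radial
weak solution [v] with such explicit functions, and using the symmetry of the form, shows that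
[v] is the linear solution with right-hand side [v^p]; this rests on Green's formula for traces
of [H^1] functions, obtained from the divergence theorem on the disc and from mollification.

What remains is a problem on [[0, S]]. Since [p <> 1], the scaling [m * u (sqrt l * x)] with
[m^(p-1) = l^2] normalises [u 0 = 1], and the radial equation becomes an initial value problem
with the single parameter [b = - Delta u (0) / 4]. Its solutions decrease strictly in [b] while
the boundary condition on the Laplacian becomes harder to meet; hence two profiles have the same
[b], and then coincide. For existence let [b] be the largest parameter for which the condition
on the Laplacian is met at a point where [u >= 0]: at that point [u = 0], since otherwise [b]
could still be increased. *)

(** * Square-integrable functions *)

(** In the variable [s] the radial Laplacian is [4 * (s * u')'], so its inverse is built from means
    over [[0, s]], which stay continuous at the origin for every continuous right-hand side. The
    hypothesis [-1 < sigma] is [k < 1]: it makes the equation for [c] solvable and keeps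
    [mint g - k * avg (mint g)] nonnegative and nondecreasing for [g >= 0], negative [k] included.
    No regularity theory is applied to a weak solution: it is only paired with explicit functions,
    whose chosen weak derivatives and traces are known up to null sets. For [p < 1] the power is not
    Lipschitz at 0. Comparison and existence therefore rest on monotonicity, and uniqueness for a
    given [b] is used only while a solution is positive; the end point is reached by continuity.
    Freezing the power above 1 gives solutions on the whole half-line for every [p]. In terms of
    [g = u^p] the condition on the Laplacian reads [mint g - k * avg (mint g) = 4 * b * (1 - k)]:
    raising [b] lowers [u], hence the left side, and raises the right side. *)

Section SquareIntegrable.
Context {d} {T : measurableType d} {R : realType}.
Variables (mu : {measure set T -> \bar R}) (D : set T).
Hypothesis mD : measurable D.
Implicit Types (f g h : T -> R) (c : R).

Definition sqint f :=
  measurable_fun D f /\ mu.-integrable D (EFin \o (fun x => f x ^+ 2)).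
Definition ip f g : R := \int[mu]_(x in D) (f x * g x).
Definition nrm2 f : R := \int[mu]_(x in D) (f x ^+ 2).

Lemma nrm2_ip f : nrm2 f = ip f f.
Proof. by []. Qed.

Lemma nrm2_ge0 f : 0 <= nrm2 f.
Proof. by apply: Rintegral_ge0 => x _; exact: sqr_ge0. Qed.

Lemma sqint_mul f g : sqint f -> sqint g ->
  mu.-integrable D (EFin \o (fun x => f x * g x)).
Proof.
move=> [mf f2] [mg g2].
apply: (le_integrable mD _ _ (integrableD mD f2 g2)).
  by apply/measurable_EFinP; exact: measurable_funM.
move=> x Dx /=; rewrite lee_fin [X in _ <= X]ger0_norm ?addr_ge0 ?sqr_ge0//.
rewrite normrM -[f x ^+ 2]real_normK ?num_real// -[g x ^+ 2]real_normK ?num_real//.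
by have := sqr_ge0 (`|f x| - `|g x|); have := normr_ge0 (f x);
  have := normr_ge0 (g x); nra.
Qed.

Lemma sqint_sqr f : sqint f -> mu.-integrable D (EFin \o (fun x => f x ^+ 2)).
Proof. by case. Qed.

Lemma sqintD f g : sqint f -> sqint g -> sqint (fun x => f x + g x).
Proof.
move=> hf hg; have fg := sqint_mul hf hg.
move: hf hg => [mf f2] [mg g2]; split; first exact: measurable_funD.
have -> : EFin \o (fun x => (f x + g x) ^+ 2) =
  (EFin \o (fun x => f x ^+ 2)) \+ ((EFin \o (fun x => f x * g x)) \+
   ((EFin \o (fun x => f x * g x)) \+ (EFin \o (fun x => g x ^+ 2)))).
  by apply/funext => x /=; rewrite -!EFinD; congr EFin; ring.
by apply: integrableD => //; apply: integrableD => //; apply: integrableD.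
Qed.

Lemma sqintZ c f : sqint f -> sqint (fun x => c * f x).
Proof.
move=> [mf f2]; split; first exact: measurable_funM.
have -> : EFin \o (fun x => (c * f x) ^+ 2) =
  (fun x => (c ^+ 2)%:E * ((f x) ^+ 2)%:E)%E.
  by apply/funext => x /=; rewrite -EFinM exprMn.
exact: integrableZl.
Qed.

Lemma sqintB f g : sqint f -> sqint g -> sqint (fun x => f x - g x).
Proof.
move=> hf hg; have := sqintD hf (sqintZ (-1) hg).
by congr sqint; apply/funext => x; rewrite mulN1r.
Qed.

Lemma eq_sqint f g : {in D, f =1 g} -> sqint f -> sqint g.
Proof.
move=> fg [mf f2]; split; first exact: eq_measurable_fun mf.
by apply: eq_integrable f2 => // x xD /=; rewrite fg.
Qed.

Lemma eq_nrm2 f g : {in D, f =1 g} -> nrm2 f = nrm2 g.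
Proof. by move=> fg; apply: eq_Rintegral => x xD; rewrite fg. Qed.

Lemma ipC f g : ip f g = ip g f.
Proof. by apply: eq_Rintegral => x _; rewrite mulrC. Qed.

Lemma ipDl f g h : sqint f -> sqint g -> sqint h ->
  ip (fun x => f x + g x) h = ip f h + ip g h.
Proof.
move=> hf hg hh; rewrite /ip -RintegralD//; [|exact: sqint_mul..].
by apply: eq_Rintegral => x _; rewrite mulrDl.
Qed.

Lemma ipZl c f h : sqint f -> sqint h -> ip (fun x => c * f x) h = c * ip f h.
Proof.
move=> hf hh; rewrite /ip -RintegralZl//; last exact: sqint_mul.
by apply: eq_Rintegral => x _; rewrite mulrA.
Qed.

Lemma ipBl f g h : sqint f -> sqint g -> sqint h ->
  ip (fun x => f x - g x) h = ip f h - ip g h.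
Proof.
move=> hf hg hh; rewrite /ip -RintegralB//; [|exact: sqint_mul..].
by apply: eq_Rintegral => x _; rewrite mulrBl.
Qed.

Lemma ipDr f g h : sqint f -> sqint g -> sqint h ->
  ip h (fun x => f x + g x) = ip h f + ip h g.
Proof. by move=> hf hg hh; rewrite ipC ipDl// ipC (ipC g). Qed.

Lemma ipBr f g h : sqint f -> sqint g -> sqint h ->
  ip h (fun x => f x - g x) = ip h f - ip h g.
Proof. by move=> hf hg hh; rewrite ipC ipBl// ipC (ipC g). Qed.

Lemma ipZr c f h : sqint f -> sqint h -> ip h (fun x => c * f x) = c * ip h f.
Proof. by move=> hf hh; rewrite ipC ipZl// ipC. Qed.

(** The polynomial [t -> nrm2 (f + t * g)] is nonnegative; it is evaluated at its minimiser
    [- ip f g / nrm2 g]. *)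
Lemma ip_cauchy_schwarz f g : sqint f -> sqint g -> ip f g ^+ 2 <= nrm2 f * nrm2 g.
Proof.
move=> hf hg.
have q t : 0 <= nrm2 f + 2 * t * ip f g + t ^+ 2 * nrm2 g.
  have htg := sqintZ t hg; have hs := sqintD hf htg.
  have := nrm2_ge0 (fun x => f x + t * g x); rewrite nrm2_ip ipDl// !ipDr//.
  by rewrite !ipZl// !ipZr// (ipC g f) -!nrm2_ip; nra.
have := nrm2_ge0 g; rewrite le_eqVlt => /predU1P[g0|g0].
  move: q; rewrite -g0 mulr0; set a := nrm2 f; set b := ip f g => q.
  have [->|b0] := eqVneq b 0; first by rewrite expr0n.
  (* With [nrm2 g = 0] the polynomial is affine in [t]; at this value it would equal [-1]. *)
  have := q (- (a + 1) / (2 * b)); rewrite mulr0 addr0.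
  have -> : 2 * (- (a + 1) / (2 * b)) * b = - (a + 1) by field; rewrite b0.
  lra.
have := q (- ip f g / nrm2 g).
have -> : nrm2 f + 2 * (- ip f g / nrm2 g) * ip f g +
   (- ip f g / nrm2 g) ^+ 2 * nrm2 g = nrm2 f - ip f g ^+ 2 / nrm2 g.
  by field; rewrite gt_eqF.
by rewrite subr_ge0 ler_pdivrMr.
Qed.

(** Equality almost everywhere is expressed as a vanishing [nrm2] of the difference; this is how one
    representative is exchanged for another inside an integral. *)
Lemma ip_eq_of_nrm2 f g h : sqint f -> sqint g -> sqint h ->
  nrm2 (fun x => f x - g x) = 0 -> ip f h = ip g h.
Proof.
move=> hf hg hh e; apply/eqP; rewrite -subr_eq0 -ipBl// -sqrf_eq0.
rewrite eq_le sqr_ge0 andbT; apply: le_trans (ip_cauchy_schwarz (sqintB hf hg) hh) _.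
by rewrite e mul0r.
Qed.

(** Nonnegativity of [nrm2 (f - g)]. The bound replaces the triangle inequality, so that limits are
    handled with squared norms. *)
Lemma nrm2D_le f g : sqint f -> sqint g ->
  nrm2 (fun x => f x + g x) <= 2 * nrm2 f + 2 * nrm2 g.
Proof.
move=> hf hg; have hs := sqintD hf hg; have hb := sqintB hf hg.
have := nrm2_ge0 (fun x => f x - g x).
rewrite !nrm2_ip (ipDl hf hg hs) (ipBl hf hg hb) !(ipDr hf hg)// !(ipBr hf hg)//.
rewrite (ipC g f) -!nrm2_ip; lra.
Qed.

Lemma nrm2Z c f : sqint f -> nrm2 (fun x => c * f x) = c ^+ 2 * nrm2 f.
Proof. by move=> hf; rewrite !nrm2_ip ipZl ?ipZr//; [rewrite mulrA|exact: sqintZ]. Qed.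

Lemma nrm2_subC f g : nrm2 (fun x => f x - g x) = nrm2 (fun x => g x - f x).
Proof. by apply: eq_Rintegral => x _; rewrite -sqrrN opprB. Qed.

Lemma nrm2_sub_le f g h : sqint f -> sqint g -> sqint h ->
  nrm2 (fun x => f x - g x) <=
  2 * nrm2 (fun x => f x - h x) + 2 * nrm2 (fun x => h x - g x).
Proof.
move=> hf hg hh; apply: le_trans (nrm2D_le (sqintB hf hh) (sqintB hh hg)).
by rewrite le_eqVlt; apply/orP; left; apply/eqP/eq_nrm2 => x _; ring.
Qed.

Definition cvg2 (f_ : nat -> T -> R) f :=
  nrm2 (fun x => f_ n x - f x) @[n --> \oo] --> (0 : R).

Lemma sqr_cvg0 (a : nat -> R) : a n ^+ 2 @[n --> \oo] --> (0 : R) ->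
  a n @[n --> \oo] --> (0 : R).
Proof.
move=> h; apply/norm_cvg0P.
have : Num.sqrt (a n ^+ 2) @[n --> \oo] --> Num.sqrt (0 : R).
  by apply: continuous_cvg => //; exact: sqrt_continuous.
by rewrite sqrtr0; under eq_cvg do rewrite sqrtr_sqr.
Qed.

Lemma cvg2_ip (f_ : nat -> T -> R) f g : (forall n, sqint (f_ n)) -> sqint f -> sqint g ->
  cvg2 f_ f -> ip (f_ n) g @[n --> \oo] --> ip f g.
Proof.
move=> hf_ hf hg c; apply/subr_cvg0; apply: sqr_cvg0.
apply: (@squeeze_cvgr _ _ _ _ (cst 0) (fun n => nrm2 (fun x => f_ n x - f x) * nrm2 g)).
- apply: nearW => n; rewrite sqr_ge0/= -ipBl//.
  by apply: ip_cauchy_schwarz => //; exact: sqintB.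
- exact: cvg_cst.
- by rewrite -[X in _ --> X](mul0r (nrm2 g)); apply: cvgMl.
Qed.

End SquareIntegrable.

(** * Completeness of the space of square-integrable functions *)

Section Complete.
Context {d} {T : measurableType d} {R : realType}.
Variables (mu : {measure set T -> \bar R}) (D : set T).
Hypothesis mD : measurable D.
Implicit Types (f g h : T -> R).

(** The bridge from the [L2] spaces of the definitions, which extend functions by zero to the whole
    space, to integrals over [D]. *)
Lemma Lfun2P f : ((f \_ D : T -> measurableTypeR R) \in Lfun mu 2%:E) <-> sqint mu D f.
Proof.
split=> [h|[mf f2]].
  have := Lfun2_integrable_sqr h; move: h => /andP[/set_mem /= mf _] h2.
  split; first exact/(measurable_restrictT _ mD).
  apply/(integrable_mkcond _ mD); apply: eq_integrable h2 => // x _ /=.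
  by rewrite !patchE; case: ifP => //= _; rewrite expr0n.
apply/andP; split.
  by rewrite inE /=; exact/(measurable_restrictT _ mD).
rewrite inE /= /finite_norm unlock /=; apply: poweR_lty.
have := integrableP _ _ _ f2 => -[_]; apply: le_lt_trans.
rewrite [leRHS]integral_mkcond le_eqVlt; apply/orP; left; apply/eqP.
by apply: eq_integral => x _; rewrite !patchE; case: ifP => _ /=;
  rewrite ?normr0 ?powR_mulrn ?normr_ge0 ?expr0n//= normrX.
Qed.

Lemma Lnorm2E f : sqint mu D f ->
  Lnorm mu 2%:E (EFin \o (f \_ D)) = (Num.sqrt (nrm2 mu D f))%:E.
Proof.
move=> [mf f2]; rewrite unlock /=.
have -> : (\int[mu]_x (`|(f \_ D) x| `^ 2)%:E = (nrm2 mu D f)%:E)%E.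
  rewrite /nrm2 /Rintegral fineK; last exact: integrable_fin_num.
  rewrite [in RHS]integral_mkcond.
  by apply: eq_integral => x _; rewrite !patchE; case: ifP => _ /=;
    rewrite ?normr0 ?powR_mulrn ?normr_ge0 ?expr0n//= real_normK ?num_real.
by rewrite poweR_EFin powR12_sqrt// nrm2_ge0.
Qed.

Lemma Lnorm2_cvgP (f_ : nat -> T -> R) g : (forall n, sqint mu D (f_ n)) ->
  sqint mu D g ->
  (Lnorm mu 2%:E (EFin \o ((fun x => f_ n x - g x) \_ D)) @[n --> \oo] --> 0%E) <->
  cvg2 mu D f_ g.
Proof.
move=> hf hg.
have e n : Lnorm mu 2%:E (EFin \o ((fun x => f_ n x - g x) \_ D)) =
    (Num.sqrt (nrm2 mu D (fun x => f_ n x - g x)))%:E.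
  by apply: Lnorm2E; exact: sqintB.
under eq_cvg do rewrite e.
split => [/fine_cvgP[_] /= c|c].
  have E : (fun n => nrm2 mu D (fun x => f_ n x - g x)) =
     (fun n => Num.sqrt (nrm2 mu D (fun x => f_ n x - g x)) *
               Num.sqrt (nrm2 mu D (fun x => f_ n x - g x))).
    by apply/funext => n; rewrite -expr2 sqr_sqrtr// nrm2_ge0.
  by rewrite /cvg2 E -[X in _ --> X](mulr0 0); apply: cvgM.
apply/fine_cvgP; split; first exact: nearW.
have : Num.sqrt (nrm2 mu D (fun x => f_ n x - g x)) @[n --> \oo] --> Num.sqrt (0 : R).
  by apply: continuous_cvg => //; exact: sqrt_continuous.
by rewrite sqrtr0.
Qed.

(** With the weights [4 ^+ n] the sum of [4 ^+ n * (h n.+1 - h n) ^+ 2] has integral at most the sum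
    of [4^-1 ^+ n]. It is therefore finite almost everywhere, and there the increments are at most a
    constant times [2^-1 ^+ n]. *)
Lemma ae_cvg_of_fast_cauchy (h : nat -> T -> R) : (forall n, sqint mu D (h n)) ->
  (forall n, nrm2 mu D (fun x => h n.+1 x - h n x) <= 16^-1 ^+ n) ->
  {ae mu, forall x, D x -> cvgn (h ^~ x)}.
Proof.
move=> hs hb.
pose w n x : \bar R := (4 ^+ n * (h n.+1 x - h n x) ^+ 2)%:E.
have mw n : measurable_fun D (w n).
  apply/measurable_EFinP; apply: measurable_funM => //.
  by apply: measurable_funX; apply: measurable_funB; exact: (hs _).1.
have w0 n x : D x -> (0 <= w n x)%E.
  by move=> _; rewrite lee_fin mulr_ge0 ?sqr_ge0 ?exprn_ge0.
have iw n : (\int[mu]_(x in D) w n x <= (4^-1 ^+ n)%:E)%E.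
  have hd := sqintB mD (hs n.+1) (hs n).
  have -> : (\int[mu]_(x in D) w n x =
      (nrm2 mu D (fun x => 2 ^+ n * (h n.+1 x - h n x)))%:E)%E.
    rewrite /nrm2 /Rintegral fineK; last first.
      by apply: integrable_fin_num => //; apply: sqint_sqr; exact: sqintZ.
    apply: eq_integral => x _; rewrite /w exprMn; congr (_ * _)%:E.
    by rewrite exprAC; congr (_ ^+ _); ring.
  rewrite nrm2Z// lee_fin; apply: le_trans (ler_wpM2l (sqr_ge0 _) (hb n)) _.
  by rewrite exprAC -exprMn le_eqVlt; apply/orP; left; apply/eqP; congr (_ ^+ _); field.
have isum : (\int[mu]_(x in D) (\sum_(0 <= n <oo) w n x) < +oo)%E.
  rewrite integral_nneseries//; apply: (@le_lt_trans _ _ 2%:E); last exact: ltry.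
  apply: lime_le.
    by apply: is_cvg_ereal_nneg_natsum => n _; apply: integral_ge0 => x Dx; exact: w0.
  apply: nearW => n.
  apply: (@le_trans _ _ (\sum_(0 <= i < n) (4^-1 ^+ i)%:E)%E); first by apply: lee_sum => i _; exact: iw.
  rewrite sumEFin lee_fin.
  suff -> : \sum_(0 <= i < n) 4^-1 ^+ i = 4 / 3 - 4 / 3 * 4^-1 ^+ n :> R.
    by have : 0 <= (4^-1 : R) ^+ n by [exact: exprn_ge0]; lra.
  elim: n => [|n ih]; first by rewrite big_geq// expr0; lra.
  by rewrite big_nat_recr//= ih exprS; field.
have msum : measurable_fun D (fun x => (\sum_(0 <= n <oo) w n x)%E).
  by apply: ge0_emeasurable_sum => // k x Dx _; exact: w0.
have int : mu.-integrable D (fun x => (\sum_(0 <= n <oo) w n x)%E).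
  apply/integrableP; split => //; apply: le_lt_trans isum.
  rewrite le_eqVlt; apply/orP; left; apply/eqP; apply: eq_integral => x /set_mem Dx.
  by rewrite gee0_abs//; apply: nneseries_ge0 => n _ _; exact: w0.
apply: filterS (integrable_ae mD int) => x fin Dx; have {fin} := fin Dx.
set S := (\sum_(0 <= n <oo) w n x)%E => Sfin.
have Sn n : 4 ^+ n * (h n.+1 x - h n x) ^+ 2 <= fine S.
  rewrite -lee_fin fineK//; apply: le_trans (nneseries_lim_ge n.+1 _); last first.
    by move=> k _ _; exact: w0.
  rewrite big_nat_recr//= leeDr//; apply: sume_ge0 => k _; exact: w0.
have S0 : 0 <= fine S by apply: le_trans (Sn 0%N); rewrite expr0 mul1r sqr_ge0.
have dn n : `|h n.+1 x - h n x| <= Num.sqrt (fine S) * 2^-1 ^+ n.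
  rewrite -sqrtr_sqr; have -> : 2^-1 ^+ n = Num.sqrt ((2^-1 ^+ n) ^+ 2) :> R.
    by rewrite sqrtr_sqr ger0_norm// exprn_ge0.
  rewrite -sqrtrM// ler_wsqrtr//.
  have e4 : (2^-1 ^+ n) ^+ 2 = (4 ^+ n)^-1 :> R.
    by rewrite exprAC -exprVn; congr (_ ^+ _); field.
  by rewrite e4 ler_pdivlMr ?exprn_gt0// mulrC Sn.
have : cvgn (series (fun n => h n.+1 x - h n x)).
  apply: normed_cvg.
  apply: (@series_le_cvg _ _ (geometric (Num.sqrt (fine S)) 2^-1)) => //=.
  - by apply: is_cvg_geometric_series; rewrite ger0_norm//; lra.
move=> c; have -> : h ^~ x = (fun n => h 0%N x + series (fun n => h n.+1 x - h n x) n).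
  by apply/funext => n; rewrite seriesEnat/= telescope_sumr// addrC subrK.
by apply: is_cvgD => //; exact: is_cvg_cst.
Qed.

(* The limit is a pointwise limsup, so that on the circle it is the restriction of a function
   on the plane, as a trace has to be. *)
Lemma sqint_complete (f_ : nat -> T -> R) : (forall n, sqint mu D (f_ n)) ->
  (forall e, 0 < e -> exists N, forall m n, (N <= m)%N -> (N <= n)%N ->
    nrm2 mu D (fun x => f_ m x - f_ n x) <= e) ->
  exists K : nat -> nat, let g x := fine (limn_esup (fun n => (f_ (K n) x)%:E)) in
    sqint mu D g /\ cvg2 mu D f_ g.
Proof.
move=> hs hc.
have /choice[N hN] n : exists N, forall m k, (N <= m)%N -> (N <= k)%N ->
    nrm2 mu D (fun x => f_ m x - f_ k x) <= 16^-1 ^+ n.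
  by apply: hc; exact: exprn_gt0.
(* Summing the thresholds makes [K] nondecreasing and at least every [N n]; the summand [n] makes it
   unbounded. *)
pose K n := (\sum_(i < n.+1) N i + n)%N.
have NK n : (N n <= K n)%N by rewrite /K big_ord_recr /= -addnA addnCA leq_addr.
have KS n : (K n <= K n.+1)%N.
  by rewrite /K [in leqRHS]big_ord_recr /= -addnA leq_add2l addnS ltnW// ltnS leq_addl.
have Kn n : (n <= K n)%N by rewrite leq_addl.
pose h n := f_ (K n).
have hh n : sqint mu D (h n) by exact: hs.
have hb n : nrm2 mu D (fun x => h n.+1 x - h n x) <= 16^-1 ^+ n.
  by apply: hN => //; exact: leq_trans (KS n).
have aec := ae_cvg_of_fast_cauchy hh hb.
pose g x := fine (limn_esup (fun n => (h n x)%:E)).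
have gE x : cvgn (h ^~ x) -> h n x @[n --> \oo] --> g x.
  move=> c; have c' : (h n x)%:E @[n --> \oo] --> (limn (h ^~ x))%:E.
    by apply/fine_cvgP; split; [exact: nearW|exact: c].
  rewrite /g is_cvg_limn_esupE; last by apply/cvg_ex; eexists; exact: c'.
  by rewrite (cvg_lim _ c').
have mg : measurable_fun D g.
  apply: measurableT_comp => //.
  by apply: measurable_fun_limn_esup => n; apply/measurable_EFinP; exact: (hh n).1.
(* Fatou's lemma along the subsequence turns the Cauchy bound into a bound on the distance from
   [f_ m] to the limit. *)
have key e m : 0 < e -> (forall k, (m <= k)%N -> nrm2 mu D (fun x => f_ k x - f_ m x) <= e) ->
    (\int[mu]_(x in D) ((g x - f_ m x) ^+ 2)%:E <= e%:E)%E.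
  move=> e0 hm.
  have -> : (\int[mu]_(x in D) ((g x - f_ m x) ^+ 2)%:E =
      \int[mu]_(x in D) limn_einf (fun n => ((h n x - f_ m x) ^+ 2)%:E))%E.
    apply: ae_eq_integral => //.
    - apply/measurable_EFinP; apply: measurable_funX; apply: measurable_funB => //.
      exact: (hs m).1.
    - rewrite /limn_einf; apply: measurableT_comp => //.
      apply: measurable_fun_limn_esup => n; apply: measurableT_comp => //.
      apply/measurable_EFinP; apply: measurable_funX; apply: measurable_funB => //.
        exact: (hh n).1.
      exact: (hs m).1.
    - apply: filterS aec => x c Dx; have {}c := gE _ (c Dx).
      have c2 : ((h n x - f_ m x) ^+ 2)%:E @[n --> \oo] --> ((g x - f_ m x) ^+ 2)%:E.
        apply/fine_cvgP; split; first exact: nearW.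
        have c1 : h n x - f_ m x @[n --> \oo] --> g x - f_ m x.
          by apply: cvgB c _; exact: cvg_cst.
        by rewrite /comp /=; under eq_cvg do rewrite expr2; rewrite expr2; exact: cvgM.
      rewrite is_cvg_limn_einfE; last by apply/cvg_ex; eexists; exact: c2.
      by rewrite (cvg_lim _ c2).
  apply: le_trans (fatou mu mD _ _) _.
  - move=> n; apply/measurable_EFinP; apply: measurable_funX; apply: measurable_funB => //.
      exact: (hh n).1.
    exact: (hs m).1.
  - by move=> n x Dx; rewrite lee_fin sqr_ge0.
  have bd n : (m <= n)%N -> (\int[mu]_(x in D) ((h n x - f_ m x) ^+ 2)%:E <= e%:E)%E.
    move=> mn; have := hm (K n) (leq_trans mn (Kn n)).
    rewrite -lee_fin /nrm2 /Rintegral fineK//.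
    by apply: integrable_fin_num => //; apply: sqint_sqr; exact: sqintB.
  rewrite limn_einf_lim; apply: lime_le; first exact: is_cvg_einfs.
  apply: nearW => n; apply: le_trans (bd (maxn m n) (leq_maxl _ _)).
  by apply: ereal_inf_lbound; exists (maxn m n) => //=; exact: leq_maxr.
have fin m e : (\int[mu]_(x in D) ((g x - f_ m x) ^+ 2)%:E <= e%:E)%E ->
    sqint mu D (fun x => g x - f_ m x).
  move=> hm; have mgf : measurable_fun D (fun x => g x - f_ m x).
    by apply: measurable_funB => //; exact: (hs m).1.
  split => //; apply/integrableP; split.
    by apply/measurable_EFinP; exact: measurable_funX.
  apply: le_lt_trans (le_lt_trans hm (ltry e)).
  rewrite le_eqVlt; apply/orP; left; apply/eqP; apply: eq_integral => x _ /=.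
  by rewrite ger0_norm// sqr_ge0.
have sg : sqint mu D g.
  have [M hM] := hc 1 ltr01.
  have h1 := fin M _ (key 1 M ltr01 (fun k hk => hM k M hk (leqnn M))).
  by apply: (eq_sqint mD _ (sqintD mD h1 (hs M))) => x _; ring.
exists K; split => //; rewrite /cvg2.
apply/cvgrPdist_le => e e0; have [M hM] := hc e e0.
near=> m; rewrite sub0r normrN ger0_norm ?nrm2_ge0// nrm2_subC.
have Mm : (M <= m)%N by near: m; exists M.
rewrite -lee_fin /nrm2 /Rintegral fineK.
  apply: key => // k mk; apply: hM => //; exact: leq_trans mk.
by apply: integrable_fin_num => //; apply: sqint_sqr; exact: sqintB.
Unshelve. all: by end_near. Qed.
End Complete.

(** * Continuity of compositions and algebraic combinations *)

Section ContinuousFunctions.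
Context {R : realType}.

Lemma cont_comp {U V W : topologicalType} (f : U -> V) (g : V -> W) :
  continuous f -> continuous g -> continuous (fun x => g (f x)).
Proof. by move=> cf cg x; exact: continuous_comp (cf x) (cg _). Qed.

Lemma cont_pair {U V W : topologicalType} (f : U -> V) (g : U -> W) :
  continuous f -> continuous g -> continuous (fun x => (f x, g x)).
Proof. by move=> cf cg x; have := cvg_pair (cf x) (cg x); apply. Qed.

Lemma cont_cst {U V : topologicalType} (c : V) : continuous (fun _ : U => c).
Proof. by move=> x; exact: cvg_cst. Qed.

Lemma cont_id {U : topologicalType} : continuous (fun x : U => x).
Proof. by move=> x; exact: cvg_id. Qed.

Context {U : topologicalType}.
Implicit Types f g : U -> R.

Lemma contM f g : continuous f -> continuous g -> continuous (fun x => f x * g x).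
Proof. by move=> cf cg x; apply: cvgM; [exact: cf|exact: cg]. Qed.

Lemma contD f g : continuous f -> continuous g -> continuous (fun x => f x + g x).
Proof. by move=> cf cg x; apply: cvgD; [exact: cf|exact: cg]. Qed.

Lemma contB f g : continuous f -> continuous g -> continuous (fun x => f x - g x).
Proof. by move=> cf cg x; apply: cvgB; [exact: cf|exact: cg]. Qed.

Lemma contN f : continuous f -> continuous (fun x => - f x).
Proof. by move=> cf x; apply: cvgN; exact: cf. Qed.

Lemma contX f n : continuous f -> continuous (fun x => f x ^+ n).
Proof. by move=> cf; have := cont_comp cf (@exprn_continuous R n); apply. Qed.

Lemma contZ c f : continuous f -> continuous (fun x => c * f x).
Proof. by move=> cf; apply: contM => //; exact: cont_cst. Qed.
End ContinuousFunctions.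

(** * Functions on the plane and the divergence theorem on the disc *)

Section PlaneMeasure.
Context {R : realType}.
Notation P := (measurableTypeR R * measurableTypeR R)%type.
Implicit Types (f g : R * R -> R) (r : R).

(** Second countability: an open set is the union of the countably many squares with rational centre
    and radius [1 / (n + 1)] that it contains. This is what makes continuous functions measurable
    for the product sigma-algebra. *)
Lemma open_measurable2 (U : set (R * R)) : open U -> measurable (U : set P).
Proof.
move=> oU.
pose box (a b : rat) (n : nat) : set P :=
  ball (ratr a : R) n.+1%:R^-1 `*` ball (ratr b : R) n.+1%:R^-1.
have mbox a b n : measurable (box a b n).
  by apply: measurableX; exact: measurable_ball.
pose V := \bigcup_n \bigcup_(a in @setT rat) \bigcup_(b in @setT rat)
  (if `[< box a b n `<=` U >] then box a b n else set0).
suff -> : (U : set P) = V.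
  apply: bigcup_measurable => n _; apply: bigcupT_measurable_rat => a.
  by apply: bigcupT_measurable_rat => b; case: ifP.
apply/seteqP; split => [[x y] Uxy|xy [n _ [a _ [b _]]]]; last first.
  by case: ifP => // /asboolP; exact.
have [e /= e0 He] := (nbhs_ballP _ _).1 (open_nbhs_nbhs (conj oU Uxy)).
have [n n2] : exists n : nat, n.+1%:R^-1 < e / 2.
  have := near_infty_natSinv_lt (PosNum (divr_gt0 e0 (ltr0Sn R 1))).
  by move=> [N _ h]; exists N; apply: h => /=.
have bE (u v q : R) : ball u q v <-> `|u - v| < q by [].
have aux (c k z : R) : z - k < c -> c < z + k -> `|c - z| < k.
  by move=> h1 h2; rewrite ltr_norml; apply/andP; split; lra.
have aux2 (c k x0 s : R) : `|c - x0| < k -> `|c - s| < k -> k < e / 2 -> `|x0 - s| < e.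
  rewrite !ltr_norml => /andP[? ?] /andP[? ?] ?.
  by apply/andP; split; lra.
have rat_in (z : R) : exists q : rat, ball (ratr q : R) n.+1%:R^-1 z.
  have n0 : 0 < n.+1%:R^-1 :> R by rewrite invr_gt0.
  have [|q qz] := @rat_in_itvoo R (z - n.+1%:R^-1) (z + n.+1%:R^-1).
    by rewrite ltrD2l; apply: lt_trans n0; rewrite oppr_lt0.
  exists q; move: qz; rewrite in_itv /= => /andP[h1 h2].
  by apply/bE; exact: aux.
have [a ha] := rat_in x; have [b hb] := rat_in y.
exists n => //; exists a => //; exists b => //.
rewrite ifT//; apply/asboolP => -[s t] [/= hs ht]; apply: He; split => /=.
  exact/bE/(aux2 _ _ _ _ (proj1 (bE _ _ _) ha) (proj1 (bE _ _ _) hs) n2).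
exact/bE/(aux2 _ _ _ _ (proj1 (bE _ _ _) hb) (proj1 (bE _ _ _) ht) n2).
Qed.

Lemma continuous_measurable2 f : continuous f -> measurable_fun setT (f : P -> R).
Proof.
move=> cf; apply: (measurability _ (RGenOInfty.measurableE R)).
move=> _ [_ [a ->] <-]; rewrite setTI; apply: open_measurable2.
by apply: open_comp => //; exact: rray_open.
Qed.

Lemma continuous_fst2 : continuous (fun x : R * R => x.1).
Proof. by move=> x; exact: cvg_fst. Qed.

Lemma continuous_snd2 : continuous (fun x : R * R => x.2).
Proof. by move=> x; exact: cvg_snd. Qed.

Definition sqn (x : R * R) : R := x.1 ^+ 2 + x.2 ^+ 2.

Lemma sqn_ge0 x : 0 <= sqn x.
Proof. by rewrite addr_ge0 ?sqr_ge0. Qed.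

Lemma continuous_sqn : continuous sqn.
Proof. by apply: contD; apply: contX; [exact: continuous_fst2|exact: continuous_snd2]. Qed.

Lemma disc_sqn r : 0 < r -> forall x, disc r x <-> sqn x < r ^+ 2.
Proof.
move=> r0 x; rewrite /disc /= /enorm -/(sqn x) -{1}(ger0_norm (ltW r0)) -sqrtr_sqr.
by rewrite ltr_sqrt ?exprn_gt0.
Qed.

Lemma cdisc_sqn r : 0 < r -> forall x, cdisc r x <-> sqn x <= r ^+ 2.
Proof.
move=> r0 x; rewrite /cdisc /= /enorm -/(sqn x) -{1}(ger0_norm (ltW r0)) -sqrtr_sqr.
by rewrite ler_sqrt ?exprn_ge0// ltW.
Qed.

Lemma open_disc r : 0 < r -> open (disc r : set (R * R)).
Proof.
move=> r0; have -> : disc r = sqn @^-1` [set t | t < r ^+ 2].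
  by apply/seteqP; split => x /= => /(disc_sqn r0).
by apply: open_comp; [move=> x _; exact: continuous_sqn|exact: lray_open].
Qed.

Lemma closed_cdisc r : 0 < r -> closed (cdisc r : set (R * R)).
Proof.
move=> r0; have -> : cdisc r = sqn @^-1` [set t | t <= r ^+ 2].
  by apply/seteqP; split => x /= => /(cdisc_sqn r0).
by apply: closed_comp; [move=> x _; exact: continuous_sqn|exact: lray_closed].
Qed.

Lemma measurable_disc r : 0 < r -> measurable (disc r : set P).
Proof. by move=> r0; apply: open_measurable2; exact: open_disc. Qed.

Lemma cdisc_box r : 0 < r ->
  (cdisc r : set (R * R)) `<=` `[- r, r]%classic `*` `[- r, r]%classic.
Proof.
move=> r0 x /(cdisc_sqn r0); rewrite /sqn => h.
have := sqr_ge0 x.1; have := sqr_ge0 x.2 => h1 h2.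
by split; rewrite /= in_itv /= -ler_norml -(ler_pXn2r (_ : (0 < 2)%N)) ?nnegrE ?(ltW r0)//
  real_normK ?num_real//; lra.
Qed.

Lemma compact_cdisc r : 0 < r -> compact (cdisc r : set (R * R)).
Proof.
move=> r0; apply: subclosed_compact (closed_cdisc r0) _ (cdisc_box r0).
by apply: compact_setX; exact: segment_compact.
Qed.

Lemma disc_cdisc r : (disc r : set (R * R)) `<=` cdisc r.
Proof. by move=> x; exact: ltW. Qed.

Lemma leb2_box (a b : R) : (leb2 (`[a, b]%classic `*` `[a, b]%classic) < +oo)%E.
Proof.
have [v ev] : exists v, (@lebesgue_measure R) `[a, b]%classic = v%:E.
  by rewrite lebesgue_measure_itv /=; case: ifP => _; eexists.
have -> : (leb2 (`[a, b] `*` `[a, b]) = v%:E * v%:E)%E.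
  rewrite -ev; exact: (product_measure1E (@lebesgue_measure R) (@lebesgue_measure R)
    (measurable_itv `[a, b]) (measurable_itv `[a, b])).
by rewrite -EFinM ltry.
Qed.

Lemma leb2_disc r : 0 < r -> (leb2 (disc r) < +oo)%E.
Proof.
move=> r0; apply: le_lt_trans (leb2_box (- r) r).
apply: le_measure; rewrite ?inE.
- exact: measurable_disc.
- by apply: measurableX; exact: measurable_itv.
- by move=> x /disc_cdisc; exact: cdisc_box.
Qed.

Lemma cdisc_bounded r f : 0 < r -> continuous f ->
  exists2 M, 0 < M & forall x, cdisc r x -> `|f x| <= M.
Proof.
move=> r0 cf.
have [||c _ hc] := @compact_EVT_max _ R (fun x => `|f x|) (cdisc r) _ (compact_cdisc r0).
- exists (0, 0); apply/(cdisc_sqn r0); rewrite /sqn /= expr0n /= addr0.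
  exact: sqr_ge0.
- apply: continuous_subspaceT => x; apply: continuous_comp; [exact: cf|exact: norm_continuous].
exists (`|f c| + 1); first by rewrite ltr_wpDl.
by move=> x xr; have := hc x (mem_set xr) => /= h; rewrite (le_trans h)// lerDl.
Qed.

Lemma bounded_integrable2 (A : set P) (f : P -> R) M : measurable A ->
  (leb2 A < +oo)%E -> measurable_fun A f -> (forall x, A x -> `|f x| <= M) ->
  leb2.-integrable A (EFin \o f).
Proof.
move=> mA fA mf fM; apply: measurable_bounded_integrable => //.
exists M; split; first exact: num_real.
by move=> k Mk x Ax /=; rewrite (le_trans (fM _ Ax))// ltW.
Qed.

Lemma bounded_sqint2 r (f : P -> R) M : 0 < r -> measurable_fun (disc r : set P) f ->
  (forall x, disc r x -> `|f x| <= M) -> sqint leb2 (disc r) f.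
Proof.
move=> r0 mf fM; split => //; apply: (@bounded_integrable2 _ _ (M ^+ 2)) => //.
- exact: measurable_disc.
- exact: leb2_disc.
- exact: measurable_funX.
- move=> x /fM h; rewrite normrX lerXn2r ?nnegrE//.
  exact: le_trans h.
Qed.

Lemma continuous_integrable2 r f : 0 < r -> continuous f ->
  leb2.-integrable (disc r : set P) (EFin \o f).
Proof.
move=> r0 cf; have [M _ hM] := cdisc_bounded r0 cf.
apply: (@bounded_integrable2 _ _ M).
- exact: measurable_disc.
- exact: leb2_disc.
- by apply: measurable_funS (continuous_measurable2 cf).
- by move=> x /disc_cdisc; exact: hM.
Qed.

Lemma continuous_sqint2 r f : 0 < r -> continuous f -> sqint leb2 (disc r) f.
Proof.
move=> r0 cf; have [M _ hM] := cdisc_bounded r0 cf.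
apply: (@bounded_sqint2 _ _ M) => //.
- by apply: measurable_funS (continuous_measurable2 cf).
- by move=> x /disc_cdisc; exact: hM.
Qed.

Lemma shift_e1 f (a b h : R) : f (h *: e1 + (a, b)) = f (h *: 1 + a, b).
Proof. by rewrite /e1; congr f; congr pair; rewrite /= scaler0 add0r. Qed.

Lemma shift_e2 f (a b h : R) : f (h *: e2 + (a, b)) = f (a, h *: 1 + b).
Proof. by rewrite /e2; congr f; congr pair; rewrite /= scaler0 add0r. Qed.

Lemma derive_e1E f a b : 'D_e1 f (a, b) = 'D_1 (fun t => f (t, b)) a.
Proof. by rewrite /derive; under eq_fun do rewrite /= shift_e1. Qed.

Lemma derive_e2E f a b : 'D_e2 f (a, b) = 'D_1 (fun t => f (a, t)) b.
Proof. by rewrite /derive; under eq_fun do rewrite /= shift_e2. Qed.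

Lemma derivable_e1E f a b : derivable f (a, b) e1 <-> derivable (fun t => f (t, b)) a 1.
Proof. by rewrite /derivable; under eq_fun do rewrite /= shift_e1. Qed.

Lemma derivable_e2E f a b : derivable f (a, b) e2 <-> derivable (fun t => f (a, t)) b 1.
Proof. by rewrite /derivable; under eq_fun do rewrite /= shift_e2. Qed.

(** Integration by parts is done at this regularity, because the explicit radial solutions need not
    be [smooth]. *)
Definition C1 f := [/\ forall x, derivable f x e1 /\ derivable f x e2,
  continuous f, continuous (fun x => 'D_e1 f x) & continuous (fun x => 'D_e2 f x)].

Lemma smooth_C1 f : smooth f -> C1 f.
Proof. by move=> sf; have [a b c] := sf 1%N; exact: (And4 a (sf 0%N) b c). Qed.

Lemma deriveMR f g x e : derivable f x e -> derivable g x e ->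
  'D_e (fun x => f x * g x) x = 'D_e f x * g x + f x * 'D_e g x.
Proof. by move=> df dg; apply: etrans (deriveM df dg) _; rewrite addrC; congr (_ + _); exact: mulrC. Qed.

Lemma eq_continuous2 f g : f =1 g -> continuous f -> continuous g.
Proof. by move=> /funext ->. Qed.

Lemma continuous_deriveM f g e : (forall x, derivable f x e) -> (forall x, derivable g x e) ->
  continuous f -> continuous g -> continuous (fun x => 'D_e f x) ->
  continuous (fun x => 'D_e g x) -> continuous (fun x => 'D_e (fun y => f y * g y) x).
Proof.
move=> df dg cf cg cdf cdg.
have -> : (fun x => 'D_e (fun y => f y * g y) x) = (fun x => 'D_e f x * g x + f x * 'D_e g x).
  by apply/funext => x; exact: deriveMR (df x) (dg x).
by apply: contD; exact: contM.
Qed.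

Lemma continuous_deriveB f g e : (forall x, derivable f x e) -> (forall x, derivable g x e) ->
  continuous (fun x => 'D_e f x) ->
  continuous (fun x => 'D_e g x) -> continuous (fun x => 'D_e (fun y => f y - g y) x).
Proof.
move=> df dg cdf cdg.
have -> : (fun x => 'D_e (fun y => f y - g y) x) = (fun x => 'D_e f x - 'D_e g x).
  by apply/funext => x; exact: deriveB (df x) (dg x).
exact: contB.
Qed.

Lemma C1M f g : C1 f -> C1 g -> C1 (fun x => f x * g x).
Proof.
move=> [df cf cf1 cf2] [dg cg cg1 cg2]; split.
- by move=> x; split; apply: derivableM; [exact: (df x).1|exact: (dg x).1|
    exact: (df x).2|exact: (dg x).2].
- exact: contM.
- exact: (@continuous_deriveM f g e1 (fun x => (df x).1) (fun x => (dg x).1)).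
- exact: (@continuous_deriveM f g e2 (fun x => (df x).2) (fun x => (dg x).2)).
Qed.

Lemma C1B f g : C1 f -> C1 g -> C1 (fun x => f x - g x).
Proof.
move=> [df cf cf1 cf2] [dg cg cg1 cg2]; split.
- by move=> x; split; apply: derivableB; [exact: (df x).1|exact: (dg x).1|
    exact: (df x).2|exact: (dg x).2].
- exact: contB.
- exact: (@continuous_deriveB f g e1 (fun x => (df x).1) (fun x => (dg x).1)).
- exact: (@continuous_deriveB f g e2 (fun x => (df x).2) (fun x => (dg x).2)).
Qed.

Lemma derive_fst x : [/\ 'D_e1 (fun y : R * R => y.1) x = 1, 'D_e2 (fun y : R * R => y.1) x = 0,
  derivable (fun y : R * R => y.1) x e1 & derivable (fun y : R * R => y.1) x e2].
Proof.
case: x => a b; split.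
- by rewrite derive_e1E derive_id.
- by rewrite derive_e2E derive_cst.
- by apply/derivable_e1E; exact: derivable_id.
- by apply/derivable_e2E; exact: derivable_cst.
Qed.

Lemma derive_snd x : [/\ 'D_e1 (fun y : R * R => y.2) x = 0, 'D_e2 (fun y : R * R => y.2) x = 1,
  derivable (fun y : R * R => y.2) x e1 & derivable (fun y : R * R => y.2) x e2].
Proof.
case: x => a b; split.
- by rewrite derive_e1E derive_cst.
- by rewrite derive_e2E derive_id.
- by apply/derivable_e1E; exact: derivable_cst.
- by apply/derivable_e2E; exact: derivable_id.
Qed.

Lemma C1_fst : C1 (fun x : R * R => x.1).
Proof.
split; first by move=> x; have [] := derive_fst x.
- exact: continuous_fst2.
- by apply: (@eq_continuous2 (cst 1)); [move=> x; have [] := derive_fst x|move=> x; exact: cvg_cst].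
- by apply: (@eq_continuous2 (cst 0)); [move=> x; have [] := derive_fst x|move=> x; exact: cvg_cst].
Qed.

Lemma C1_snd : C1 (fun x : R * R => x.2).
Proof.
split; first by move=> x; have [] := derive_snd x.
- exact: continuous_snd2.
- by apply: (@eq_continuous2 (cst 0)); [move=> x; have [] := derive_snd x|move=> x; exact: cvg_cst].
- by apply: (@eq_continuous2 (cst 1)); [move=> x; have [] := derive_snd x|move=> x; exact: cvg_cst].
Qed.
End PlaneMeasure.

(** * Integrals over intervals and their substitutions *)

Section Integral1D.
Context {R : realType}.
Notation mu := (@lebesgue_measure R).
Implicit Types (f g F G : R -> R) (a b c : R).

Lemma continuous_integrable1 f a b : continuous f -> mu.-integrable `[a, b] (EFin \o f).
Proof.
move=> cf; apply: continuous_compact_integrable; first exact: segment_compact.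
exact: continuous_subspaceT.
Qed.

Lemma EFin_Rintegral1 f a b : continuous f ->
  (\int[mu]_(t in `[a, b]) (f t)%:E = (\int[mu]_(t in `[a, b]) f t)%:E)%E.
Proof.
move=> cf; rewrite /Rintegral fineK//; apply: integrable_fin_num => //.
exact: continuous_integrable1.
Qed.

Lemma Rintegral_FTC2 F f a b : a <= b ->
  (forall x, x \in `]a, b[ -> is_derive x 1 F (f x)) -> continuous F -> continuous f ->
  \int[mu]_(t in `[a, b]) f t = F b - F a.
Proof.
rewrite le_eqVlt => /predU1P[-> _ _ _|ab dF cF cf].
  by rewrite set_itv1 Rintegral_set1 subrr.
apply/EFin_inj; rewrite -EFin_Rintegral1// EFinB; apply: continuous_FTC2 => //.
- exact: continuous_subspaceT.
- split; first by move=> x /dF [].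
  + exact/cvg_at_right_filter/cF.
  + exact/cvg_at_left_filter/cF.
- by move=> x xab; have := dF _ xab; rewrite derive1E => -[_ ->].
Qed.

Lemma Rintegral_split f a b c : continuous f -> a <= b -> b <= c ->
  \int[mu]_(t in `[a, c]) f t =
  \int[mu]_(t in `[a, b]) f t + \int[mu]_(t in `[b, c]) f t.
Proof.
move=> cf ab bc; have ic := @continuous_integrable1 f a c cf.
have := @Rintegral_itvB R f (BLeft a) (BRight c) b ic.
rewrite !bnd_simp => /(_ ab bc) h.
rewrite -(Rintegral_itv_obnd_cbnd (r := b)) -?h; first by rewrite addrC subrK.
by apply: integrableS (continuous_integrable1 b c cf) => //; exact: subset_itv_oc_cc.
Qed.

Lemma is_derive_subl c (t : R) : is_derive t 1 (fun t => c - t) (-1).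
Proof. by rewrite -[X in is_derive _ _ _ X]sub0r; apply: is_deriveB. Qed.

Lemma derive1_subl c : ((fun t : R => c - t)^`() = (fun=> -1))%classic.
Proof.
by apply/funext => t; rewrite derive1E; have [_ ->] := is_derive_subl c t.
Qed.

Lemma continuous_subl c : continuous (fun t : R => c - t).
Proof.
by apply: contB; [exact: cont_cst|exact: cont_id].
Qed.

Lemma Rintegral_reflect G a b c : continuous G -> a <= b ->
  \int[mu]_(t in `[a, b]) G (c - t) = \int[mu]_(t in `[c - b, c - a]) G t.
Proof.
move=> cG ab; have cGc : continuous (fun t => G (c - t)).
  exact: cont_comp (@continuous_subl c) cG.
apply/EFin_inj; rewrite -!EFin_Rintegral1//.
rewrite (@integration_by_substitution_decreasing R (fun t => c - t) G a b)//.
- by apply: eq_integral => t _; rewrite derive1_subl; rewrite !fctE opprK mulr1.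
- by move=> x y _ _ xy; rewrite ltrD2l ltrN2.
- by rewrite derive1_subl => x _; exact: cvg_cst.
- by rewrite derive1_subl; exact: is_cvg_cst.
- by rewrite derive1_subl; exact: is_cvg_cst.
- split.
  + by move=> x _; have [] := is_derive_subl c x.
  + exact/cvg_at_right_filter/continuous_subl.
  + exact/cvg_at_left_filter/continuous_subl.
- exact: continuous_subspaceT.
Qed.

Lemma Rintegral_shift G a b c : continuous G -> a <= b ->
  \int[mu]_(t in `[a, b]) G (t + c) = \int[mu]_(t in `[a + c, b + c]) G t.
Proof.
move=> cG ab.
have cG' : continuous (fun t => G (c - t)).
  exact: cont_comp (@continuous_subl c) cG.
have := @Rintegral_reflect (fun t => G (c - t)) a b 0 cG' ab.
rewrite !sub0r => h; transitivity (\int[mu]_(t in `[a, b]) G (c - (0 - t))).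
  by apply: eq_Rintegral => t _; rewrite sub0r opprK addrC.
by rewrite h Rintegral_reflect ?lerN2// !opprK addrC (addrC b).
Qed.

Lemma is_derive_rcos (r t : R) : is_derive t 1 (fun t => r * cos t) (- (r * sin t)).
Proof.
rewrite -mulrN (_ : (fun t => _) = r \*: @cos R)//.
exact: is_deriveZ.
Qed.

Lemma derive1_rcos (r : R) : ((fun t => r * cos t)^`() = (fun t => - (r * sin t)))%classic.
Proof.
by apply/funext => t; rewrite derive1E; have [_ ->] := is_derive_rcos r t.
Qed.

Lemma continuous_rcos (r : R) : continuous (fun t => r * cos t).
Proof.
exact: contZ (@continuous_cos R).
Qed.

Lemma continuous_rsin (r : R) : continuous (fun t => r * sin t).
Proof.
exact: contZ (@continuous_sin R).
Qed.

Lemma Rintegral_cos_subst G (r : R) : 0 < r -> continuous G ->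
  \int[mu]_(t in `[- r, r]) G t =
  \int[mu]_(t in `[0, pi]) (r * (sin t * G (r * cos t))).
Proof.
move=> r0 cG.
have ce : continuous (fun t => r * (sin t * G (r * cos t))).
  apply/contZ/contM; first exact: continuous_sin.
  exact: cont_comp (@continuous_rcos r) cG.
have cN : continuous (fun t => - (r * sin t)).
  exact: contN (@continuous_rsin r).
apply/EFin_inj; rewrite -!EFin_Rintegral1//.
have := @integration_by_substitution_decreasing R (fun t => r * cos t) G 0 pi.
rewrite cos0 cospi mulr1 mulrN1 derive1_rcos => ->.
- by apply: eq_integral => t _; rewrite !fctE opprK; congr EFin; ring.
- exact: pi_ge0.
- by move=> x y x0 y0 xy; rewrite ltr_pM2l// ltr_cos.
- by move=> x _; exact: cN.
- by apply/cvg_ex; eexists; apply: cvg_at_right_filter; exact: cN.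
- by apply/cvg_ex; eexists; apply: cvg_at_left_filter; exact: cN.
- split.
  + by move=> x _; have [] := is_derive_rcos r x.
  + exact/cvg_at_right_filter/continuous_rcos.
  + exact/cvg_at_left_filter/continuous_rcos.
- exact: continuous_subspaceT.
Qed.
End Integral1D.

(** * The divergence theorem on the disc *)

Section Divergence.
Context {R : realType}.
Notation mu := (@lebesgue_measure R).
Notation P := (measurableTypeR R * measurableTypeR R)%type.
Implicit Types (f g F : R * R -> R) (r : R).

(** [Num.sqrt] is 0 on negative numbers, so the chord is degenerate outside [[- r, r]] and the two
    boundary values there cancel. *)
Definition chord r (x : R) : R := Num.sqrt (r ^+ 2 - x ^+ 2).

Lemma continuous_chord r : continuous (chord r).
Proof.
have c : continuous (fun x : R => r ^+ 2 - x ^+ 2).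
  by apply: contB; [exact: cont_cst|exact: exprn_continuous].
exact: cont_comp c (@sqrt_continuous R).
Qed.

Lemma disc_chord r x y : 0 < r -> disc r (x, y) <-> y \in `](- chord r x), (chord r x)[.
Proof.
move=> r0; rewrite disc_sqn// /sqn /= in_itv /= -ltr_norml /chord -(sqrtr_sqr y).
have [h|h] := leP (r ^+ 2 - x ^+ 2) 0.
  rewrite (ler0_sqrtr h) [X in _ <-> is_true X] ltNge sqrtr_ge0 /=; split => // h2.
  by have := sqr_ge0 y; lra.
by rewrite ltr_sqrt// ltrBrDl.
Qed.

Lemma disc_chord2 r x y : 0 < r -> disc r (y, x) <-> y \in `](- chord r x), (chord r x)[.
Proof.
move=> r0; rewrite -disc_chord// !disc_sqn// /sqn /=.
by rewrite addrC.
Qed.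

Lemma Rintegral_open_closed (f : R -> R) (a b : R) : continuous f ->
  \int[mu]_(t in `]a, b[) f t = \int[mu]_(t in `[a, b]) f t.
Proof.
move=> cf; have h := continuous_integrable1 a b cf.
rewrite Rintegral_itv_bndo_bndc; last first.
  by apply: integrableS h => //; exact: subset_itv_oo_cc.
rewrite Rintegral_itv_obnd_cbnd//.
by apply: integrableS h => //; exact: subset_itv_oc_cc.
Qed.

Lemma slice_e2 r F x : 0 < r -> C1 F ->
  \int[mu]_(y in [set y | disc r (x, y)]) 'D_e2 F (x, y) =
  F (x, chord r x) - F (x, - chord r x).
Proof.
move=> r0 [dF cF _ cF2].
have -> : [set y | disc r (x, y)] = `](- chord r x), (chord r x)[%classic.
  by apply/seteqP; split => y /= /(disc_chord _ _ r0).
have pc : continuous (fun y : R => (x, y)).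
  by apply: cont_pair; [exact: cont_cst|exact: cont_id].
have c1 : continuous (fun y => 'D_e2 F (x, y)).
  exact: cont_comp pc cF2.
have c2 : continuous (fun y => F (x, y)).
  exact: cont_comp pc cF.
rewrite Rintegral_open_closed//; apply: (@Rintegral_FTC2 _ (fun y => F (x, y))) => //.
- by rewrite -subr_ge0 opprK addr_ge0 ?sqrtr_ge0.
- move=> y _; rewrite derive_e2E; apply: derivableP.
  by apply/derivable_e2E; exact: (dF _).2.
Qed.

Lemma slice_e1 r F y : 0 < r -> C1 F ->
  \int[mu]_(x in [set x | disc r (x, y)]) 'D_e1 F (x, y) =
  F (chord r y, y) - F (- chord r y, y).
Proof.
move=> r0 [dF cF cF1 _].
have -> : [set x | disc r (x, y)] = `](- chord r y), (chord r y)[%classic.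
  by apply/seteqP; split => x /= /(disc_chord2 _ _ r0).
have pc : continuous (fun x : R => (x, y)).
  by apply: cont_pair; [exact: cont_id|exact: cont_cst].
have c1 : continuous (fun x => 'D_e1 F (x, y)).
  exact: cont_comp pc cF1.
have c2 : continuous (fun x => F (x, y)).
  exact: cont_comp pc cF.
rewrite Rintegral_open_closed//; apply: (@Rintegral_FTC2 _ (fun x => F (x, y))) => //.
- by rewrite -subr_ge0 opprK addr_ge0 ?sqrtr_ge0.
- move=> x _; rewrite derive_e1E; apply: derivableP.
  by apply/derivable_e1E; exact: (dF _).1.
Qed.

Lemma chord_out r x : 0 < r -> x \notin `[- r, r] -> chord r x = 0.
Proof.
move=> r0; rewrite in_itv /= -ler_norml -ltNge => h; rewrite /chord ler0_sqrtr//.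
rewrite subr_le0 -[x ^+ 2]real_normK ?num_real//.
by rewrite ler_pXn2r ?nnegrE ?(ltW r0) ?normr_ge0// ltW.
Qed.

Lemma fubini_disc1 r (h : R * R -> R) : 0 < r -> leb2.-integrable (disc r : set P) (EFin \o h) ->
  (forall x, continuous (fun y => h (x, y))) ->
  (\int[leb2]_(z in disc r) (h z)%:E =
   \int[mu]_x (\int[mu]_(y in [set y | disc r (x, y)]) h (x, y))%:E)%E.
Proof.
move=> r0 ih hc; have mD := measurable_disc r0.
rewrite integral_mkcond.
have ir : leb2.-integrable (setT : set P) ((EFin \o h) \_ (disc r)).
  exact: (proj1 (integrable_mkcond _ mD) ih).
have := @integral12_prod_meas1 _ _ (measurableTypeR R) (measurableTypeR R) R
  (@lebesgue_measure R) (@lebesgue_measure R) _ ir => <-.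
apply: eq_integral => x _.
transitivity (\int[mu]_(y in [set y | disc r (x, y)]) (h (x, y))%:E)%E.
  rewrite [RHS]integral_mkcond; apply: eq_integral => y _.
  rewrite !patchE /=.
  by have -> : ((x, y) \in disc r) = (y \in [set y | disc r (x, y)]) by
    apply/idP/idP => /set_mem h'; exact: mem_set h'.
have -> : [set y | disc r (x, y)] = `](- chord r x), (chord r x)[%classic.
  by apply/seteqP; split => y /= /(disc_chord _ _ r0).
rewrite /Rintegral fineK//; apply: integrable_fin_num => //.
apply: integrableS (continuous_integrable1 (- chord r x) (chord r x) (hc x)) => //.
exact: subset_itv_oo_cc.
Qed.

Lemma fubini_disc2 r (h : R * R -> R) : 0 < r -> leb2.-integrable (disc r : set P) (EFin \o h) ->
  (forall y, continuous (fun x => h (x, y))) ->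
  (\int[leb2]_(z in disc r) (h z)%:E =
   \int[mu]_y (\int[mu]_(x in [set x | disc r (x, y)]) h (x, y))%:E)%E.
Proof.
move=> r0 ih hc; have mD := measurable_disc r0.
rewrite integral_mkcond.
have ir : leb2.-integrable (setT : set P) ((EFin \o h) \_ (disc r)).
  exact: (proj1 (integrable_mkcond _ mD) ih).
have := @integral21_prod_meas1 _ _ (measurableTypeR R) (measurableTypeR R) R
  (@lebesgue_measure R) (@lebesgue_measure R) _ ir => <-.
apply: eq_integral => y _.
transitivity (\int[mu]_(x in [set x | disc r (x, y)]) (h (x, y))%:E)%E.
  rewrite [RHS]integral_mkcond; apply: eq_integral => x _.
  rewrite !patchE /=.
  by have -> : ((x, y) \in disc r) = (x \in [set x | disc r (x, y)]) by
    apply/idP/idP => /set_mem h'; exact: mem_set h'.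
have -> : [set x | disc r (x, y)] = `](- chord r y), (chord r y)[%classic.
  by apply/seteqP; split => x /= /(disc_chord2 _ _ r0).
rewrite /Rintegral fineK//; apply: integrable_fin_num => //.
apply: integrableS (continuous_integrable1 (- chord r y) (chord r y) (hc y)) => //.
exact: subset_itv_oo_cc.
Qed.

Definition graph_flux r F (x : R) : R := F (x, chord r x) - F (x, - chord r x).

Lemma continuous_graph_flux r F : continuous F -> continuous (graph_flux r F).
Proof.
move=> cF; have cc := continuous_chord (r := r).
by apply: contB; apply: cont_comp cF; apply: cont_pair; try exact: cont_id; [|exact: contN].
Qed.

Lemma graph_flux_restrict r F : 0 < r -> continuous F ->
  (\int[mu]_x (graph_flux r F x)%:E =
   (\int[mu]_(x in `[- r, r]) graph_flux r F x)%:E)%E.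
Proof.
move=> r0 cF; rewrite -EFin_Rintegral1; last exact: continuous_graph_flux.
rewrite [RHS]integral_mkcond; apply: eq_integral => x _; rewrite patchE.
case: ifPn => // hx; rewrite /graph_flux chord_out// ?oppr0 ?subrr//.
by move: hx; rewrite mem_setE.
Qed.

Lemma continuous_circle r F : continuous F -> continuous (fun t => F (circle r t)).
Proof.
move=> cF; apply: cont_comp cF; apply: cont_pair; [exact: continuous_rcos|exact: continuous_rsin].
Qed.

(** The upper arc is parametrised by [x = r * cos t] with [t] in [[0, pi]]; the lower arc is brought
    to the same range by the reflection [t -> 2 * pi - t], which changes the sign of [sin]. *)
Lemma graph_flux_circle r F : 0 < r -> continuous F ->
  \int[mu]_(x in `[- r, r]) graph_flux r F x =
  r * \int[mu]_(t in `[0, 2 * pi]) (sin t * F (circle r t)).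
Proof.
move=> r0 cF.
have cc := continuous_circle (r := r) cF.
have cs : continuous (fun t => sin t * F (circle r t)).
  exact: contM (@continuous_sin R) cc.
have crs : continuous (fun t => r * (sin t * F (circle r t))).
  exact: contZ.
have p0 := @pi_ge0 R.
rewrite -RintegralZl//; last exact: continuous_integrable1.
rewrite (@Rintegral_split _ _ 0 pi)//; last lra.
rewrite Rintegral_cos_subst//; last exact: continuous_graph_flux.
pose top t := r * (sin t * F (r * cos t, chord r (r * cos t))).
pose bot t := r * (sin t * F (r * cos t, - chord r (r * cos t))).
have crc := @continuous_rcos R r; have cch := cont_comp crc (@continuous_chord r).
have ct : continuous top.
  apply/contZ/contM; first exact: continuous_sin.
  by apply: cont_comp cF; exact: cont_pair.
have cb : continuous bot.
  apply/contZ/contM; first exact: continuous_sin.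
  by apply: cont_comp cF; apply: cont_pair => //; exact: contN.
have chE t : t \in `[0, pi] -> chord r (r * cos t) = r * sin t.
  move=> t0; rewrite /chord (_ : _ - _ = (r * sin t) ^+ 2); last first.
    by rewrite !exprMn sin2cos2; ring.
  by rewrite sqrtr_sqr ger0_norm// mulr_ge0 ?(ltW r0)// sin_ge0_pi//; move: t0; rewrite in_itv.
transitivity (\int[mu]_(t in `[0, pi]) top t - \int[mu]_(t in `[0, pi]) bot t).
  rewrite -RintegralB//; [|exact: continuous_integrable1..].
  by apply: eq_Rintegral => t _; rewrite /top /bot /graph_flux; ring.
congr (_ + _).
  by apply: eq_Rintegral => t /set_mem /= t0; rewrite /top chE.
rewrite -[LHS]mulN1r -RintegralZl//; last exact: continuous_integrable1.
have := @Rintegral_reflect _ (fun t => r * (sin t * F (circle r t))) 0 pi (2 * pi) crs p0.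
rewrite subr0 (_ : 2 * pi - pi = pi :> R); last ring.
move=> <-; apply: eq_Rintegral => t /set_mem /= t0; rewrite /bot chE// /circle.
rewrite -[2 * pi - t]addrC (_ : 2 * pi = pi *+ 2 :> R); last by rewrite mulr_natl.
by rewrite sinD2pi cosD2pi sinN cosN mulrN; ring.
Qed.

(** Fubini reduces the integral to vertical chords, on each of which the fundamental theorem of
    calculus leaves the two boundary values. *)
Theorem divergence_e2 r F : 0 < r -> C1 F ->
  \int[leb2]_(x in disc r) 'D_e2 F x = circle_int r (fun x => x.2 / r * F x).
Proof.
move=> r0 CF; have [dF cF _ cF2] := CF; rewrite /Rintegral fubini_disc1//.
- transitivity (fine (\int[mu]_x (graph_flux r F x)%:E)).
    by congr fine; apply: eq_integral => x _; rewrite slice_e2.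
  rewrite graph_flux_restrict//= graph_flux_circle//.
  rewrite /circle_int; congr (_ * _); apply: eq_Rintegral => t _.
  have -> // : (circle r t).2 / r = sin t by rewrite /circle /= mulrC mulKf ?gt_eqF.
- exact: (continuous_integrable2 r0 cF2).
- by move=> x; apply: cont_comp cF2; by apply: cont_pair; [exact: cont_cst|exact: cont_id].
Qed.

(** Exchanging the coordinates reduces this to vertical flux. On the circle the exchange is
    [t -> pi / 2 - t]; it maps [[0, 2 * pi]] to an interval ending at [pi / 2], whose negative part
    is moved up by one period. *)
Theorem divergence_e1 r F : 0 < r -> C1 F ->
  \int[leb2]_(x in disc r) 'D_e1 F x = circle_int r (fun x => x.1 / r * F x).
Proof.
move=> r0 CF; have [dF cF cF1 _] := CF; rewrite /Rintegral fubini_disc2//; last 2 first.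
- exact: (continuous_integrable2 r0 cF1).
- by move=> x; apply: cont_comp cF1; by apply: cont_pair; [exact: cont_id|exact: cont_cst].
pose F' := fun x => F (x.2, x.1).
have cF' : continuous F'.
  apply: cont_comp cF; apply: cont_pair; [exact: continuous_snd2|exact: continuous_fst2].
transitivity (fine (\int[mu]_x (graph_flux r F' x)%:E)).
  by congr fine; apply: eq_integral => x _; rewrite slice_e1.
rewrite graph_flux_restrict//= graph_flux_circle//.
rewrite /circle_int; congr (_ * _).
pose H t := cos t * F (circle r t).
have cH : continuous H.
  exact: contM (@continuous_cos R) (continuous_circle cF).
have Hp t : H (t + 2 * pi) = H t.
  rewrite /H /circle (_ : 2 * pi = pi *+ 2 :> R); last by rewrite mulr_natl.
  by rewrite cosD2pi sinD2pi.
have p0 := @pi_ge0 R.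
have := @Rintegral_reflect _ H 0 (2 * pi) (pi / 2) cH.
rewrite subr0 => /(_ ltac:(lra)) h.
transitivity (\int[mu]_(t in `[0, 2 * pi]) H (pi / 2 - t)).
  apply: eq_Rintegral => t _; rewrite /H /circle /F' /=.
  rewrite -[pi / 2 - t]addrC cosDpihalf sinDpihalf sinN opprK cosN//.
rewrite h (@Rintegral_split _ _ _ 0)//; [|lra..].
have := @Rintegral_shift _ H (pi / 2 - 2 * pi) 0 (2 * pi) cH.
rewrite subrK add0r => /(_ ltac:(lra)) h2.
have -> : \int[mu]_(t in `[pi / 2 - 2 * pi, 0]) H t =
    \int[mu]_(t in `[pi / 2 - 2 * pi, 0]) H (t + 2 * pi).
  by apply: eq_Rintegral => t _; rewrite Hp.
rewrite h2 addrC -Rintegral_split//; [|lra..].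
apply: eq_Rintegral => t _; rewrite /H.
by have -> // : (circle r t).1 / r = cos t by rewrite /circle /= mulrC mulKf ?gt_eqF.
Qed.
End Divergence.

(** * Antiderivatives and smooth kernels *)

(* The lower end [- (`|x| + 1)] lies below both [0] and [x], so no interval is reversed. *)
HB.lock Definition prim (R : realType) (f : R -> R) (x : R) : R :=
  \int[@lebesgue_measure R]_(t in `[- (`|x| + 1), x]) f t -
  \int[@lebesgue_measure R]_(t in `[- (`|x| + 1), 0]) f t.

Section RealDerivatives.
Context {R : realType}.
Implicit Types (f g F : R -> R) (a b c x : R).

Lemma is_derive_continuous f f' : (forall x, is_derive x 1 f (f' x)) -> continuous f.
Proof.
move=> df x; apply/differentiable_continuous/derivable1_diffP.
by have [] := df x.
Qed.

Lemma is_deriveDR f g x a b : is_derive x 1 f a -> is_derive x 1 g b ->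
  is_derive x 1 (fun t => f t + g t) (a + b).
Proof. by move=> df dg; have := is_deriveD df dg. Qed.

Lemma is_deriveBR f g x a b : is_derive x 1 f a -> is_derive x 1 g b ->
  is_derive x 1 (fun t => f t - g t) (a - b).
Proof. by move=> df dg; have := is_deriveB df dg. Qed.

Lemma is_deriveMR f g x a b : is_derive x 1 f a -> is_derive x 1 g b ->
  is_derive x 1 (fun t => f t * g t) (a * g x + f x * b).
Proof.
move=> df dg; have := is_deriveM df dg.
by rewrite (_ : f x *: b + g x *: a = a * g x + f x * b)// addrC; congr (_ + _); exact: mulrC.
Qed.

Lemma is_deriveZR c f x a : is_derive x 1 f a -> is_derive x 1 (fun t => c * f t) (c * a).
Proof. by move=> df; have := is_deriveZ c df. Qed.

Lemma is_derive_cstR c x : is_derive x 1 (fun=> c) (0 : R).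
Proof. exact: is_derive_cst. Qed.

Lemma is_derive_idR x : is_derive x 1 (fun t => t) (1 : R).
Proof. exact: is_derive_id. Qed.

Lemma is_derive_compR f g x a b : is_derive (g x) 1 f a -> is_derive x 1 g b ->
  is_derive x 1 (fun t => f (g t)) (a * b).
Proof. by move=> df dg; have := is_derive1_comp df dg. Qed.

Lemma is_derive_affine a b x : is_derive x 1 (fun t => a * t + b) a.
Proof.
have := is_deriveDR (is_deriveZR a (is_derive_idR x)) (is_derive_cstR b x).
by rewrite mulr1 addr0.
Qed.

Lemma is_derive_compaffine f a b x d : is_derive (a * x + b) 1 f d ->
  is_derive x 1 (fun t => f (a * t + b)) (d * a).
Proof. move=> df; exact: (@is_derive_compR f (fun t => a * t + b) x d a df (is_derive_affine a b x)). Qed.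

Lemma derive1_is_derive f f' : (forall x, is_derive x 1 f (f' x)) -> derive1 f = f'.
Proof. by move=> df; apply/funext => x; rewrite derive1E; have [_ ->] := df x. Qed.

Lemma mean_value F f a b : a <= b -> (forall x, is_derive x 1 F (f x)) ->
  exists2 c, a <= c <= b & F b - F a = f c * (b - a).
Proof.
move=> ab dF.
have [|c] := @MVT_segment _ F f a b ab (fun x _ => dF x).
  by apply: continuous_subspaceT; exact: is_derive_continuous dF.
by rewrite in_itv /= => cab ->; exists c.
Qed.

Lemma derive_ge0_le F f a b : a <= b -> (forall x, is_derive x 1 F (f x)) ->
  (forall x, a <= x <= b -> 0 <= f x) -> F a <= F b.
Proof.
move=> ab dF f0; have [c cab e] := mean_value ab dF.
by rewrite -subr_ge0 e mulr_ge0 ?f0// subr_ge0.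
Qed.

Notation mu := (@lebesgue_measure R).

Lemma primE f a x : continuous f -> a <= x -> a <= 0 ->
  prim f x = \int[mu]_(t in `[a, x]) f t - \int[mu]_(t in `[a, 0]) f t.
Proof.
move=> cf ax a0.
have nx : - (`|x| + 1) <= x by have := ler_norm (- x); rewrite normrN; lra.
have n0 : - (`|x| + 1) <= 0 by have := normr_ge0 x; lra.
suff key b c : b <= c -> c <= x -> c <= 0 ->
    \int[mu]_(t in `[b, x]) f t - \int[mu]_(t in `[b, 0]) f t =
    \int[mu]_(t in `[c, x]) f t - \int[mu]_(t in `[c, 0]) f t.
  have [h|/ltW h] := leP a (- (`|x| + 1)); first by rewrite prim.unlock (key a (- (`|x| + 1))).
  by rewrite prim.unlock (key (- (`|x| + 1)) a).
move=> bc cx c0; rewrite (Rintegral_split cf bc cx) (Rintegral_split cf bc c0).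
by rewrite opprD addrACA subrr add0r.
Qed.

Lemma is_derive_prim f x : continuous f -> is_derive x 1 (prim f) (f x).
Proof.
(* A lower end strictly below [x] and not depending on the variable, so that it serves all points
   near [x]. *)
move=> cf; pose a := - (`|x| + 2).
have nx : a + 1 <= x by rewrite /a; have := ler_norm (- x); rewrite normrN; lra.
have n0 : a <= 0 by rewrite /a; have := normr_ge0 x; lra.
pose F y := \int[mu]_(t in `[a, y]) f t.
have ax : a < x by lra.
have xx : x < x + 1 by lra.
have [dF F'] := continuous_FTC1_closed xx (continuous_integrable1 a (x + 1) cf) ax (cf x).
have dF' : is_derive x 1 F (f x) by rewrite -F' derive1E; exact: derivableP.
apply: (@near_eq_is_derive _ _ _ (fun y => F y - \int[mu]_(t in `[a, 0]) f t)).
  near=> y; rewrite (@primE f a)//; apply: ltW; near: y.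
  exact: lt_nbhsr.
by have := is_deriveBR dF' (is_derive_cstR (\int[mu]_(t in `[a, 0]) f t) x); rewrite subr0.
Unshelve. all: by end_near. Qed.

Lemma prim0 f : prim f 0 = 0.
Proof. by rewrite prim.unlock subrr. Qed.

Lemma continuous_prim f : continuous f -> continuous (prim f).
Proof. by move=> cf; exact: is_derive_continuous (fun x => is_derive_prim x cf). Qed.

Lemma Rintegral_prim f a b : continuous f -> a <= b ->
  \int[mu]_(t in `[a, b]) f t = prim f b - prim f a.
Proof.
move=> cf ab; apply: (@Rintegral_FTC2 _ (prim f)) => //.
- by move=> x _; exact: is_derive_prim.
- exact: continuous_prim.
Qed.
End RealDerivatives.

(** * Smooth functions of one variable and bump kernels *)

Section SmoothReal.
Context {R : realType}.
Implicit Types (f g F : R -> R) (a b c x : R) (p : {poly R}).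

Fixpoint Ck1 (k : nat) f : Prop :=
  if k is j.+1 then (forall x, derivable f x 1) /\ Ck1 j (derive1 f) else continuous f.

Lemma Ck1_derive k f f' : (forall x, is_derive x 1 f (f' x)) -> Ck1 k f' -> Ck1 k.+1 f.
Proof. by move=> df h; split; [move=> x; have [] := df x|rewrite (derive1_is_derive df)]. Qed.

Lemma Ck1_is_derive k f : Ck1 k.+1 f -> forall x, is_derive x 1 f (derive1 f x).
Proof. by move=> [df _] x; rewrite derive1E; exact: derivableP. Qed.

Lemma Ck1S k f : Ck1 k.+1 f -> Ck1 k f.
Proof.
elim: k f => [f h|k ih f [df h]]; first exact: is_derive_continuous (Ck1_is_derive h).
by split => //; exact: ih.
Qed.

Lemma Ck1D k f g : Ck1 k f -> Ck1 k g -> Ck1 k (fun x => f x + g x).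
Proof.
elim: k f g => [|k ih] f g hf hg; first exact: contD.
apply: (@Ck1_derive _ _ (fun x => derive1 f x + derive1 g x)).
  by move=> x; apply: is_deriveDR; [exact: Ck1_is_derive hf x|exact: Ck1_is_derive hg x].
by apply: ih; [exact: hf.2|exact: hg.2].
Qed.

Lemma Ck1M k f g : Ck1 k f -> Ck1 k g -> Ck1 k (fun x => f x * g x).
Proof.
elim: k f g => [|k ih] f g hf hg; first exact: contM.
have d x : is_derive x 1 (fun x => f x * g x) (derive1 f x * g x + f x * derive1 g x).
  by apply: is_deriveMR; [exact: Ck1_is_derive hf x|exact: Ck1_is_derive hg x].
apply: (Ck1_derive d).
by apply: Ck1D; apply: ih; [exact: hf.2|exact: Ck1S|exact: Ck1S|exact: hg.2].
Qed.

Lemma Ck1_affine k f a b c : Ck1 k f -> Ck1 k (fun x => c * f (a * x + b)).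
Proof.
elim: k f c => [|k ih] f c hf.
  apply: contZ; apply: cont_comp hf.
  exact: is_derive_continuous (is_derive_affine a b).
apply: (@Ck1_derive _ _ (fun x => (c * a) * derive1 f (a * x + b))).
  move=> x; rewrite -mulrA; apply: is_deriveZR; rewrite mulrC; apply: is_derive_compaffine.
  exact: Ck1_is_derive hf _.
by apply: ih; exact: hf.2.
Qed.

(** The polynomial factor in [1 / x] makes this family closed under differentiation, so that
    smoothness of [exp (- 1 / x)] glued to 0 is a plain induction over all [p] at once. *)
Definition flat p x : R := if 0 < x then p.[x^-1] * expR (- x^-1) else 0.

Lemma poly_exp_bounded p : exists2 C, 0 <= C & forall t, 0 <= t -> `|p.[t] * expR (- t)| <= C.
Proof.
have mon n t : 0 <= t -> t ^+ n * expR (- t) <= n`!%:R :> R.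
  move=> t0; rewrite expRN ler_pdivrMr ?expR_gt0//.
  case: n => [|n]; first by rewrite expr0 fact0 mul1r -expR0 ler_expR.
  have := expR_ge1Dxn n t0; have f0 : 0 < (n.+1)`!%:R :> R by rewrite ltr0n fact_gt0.
  move=> h; rewrite mulrC -ler_pdivrMr//; apply: le_trans h; lra.
exists (\sum_(i < size p) `|p`_i| * (i`!)%:R).
  by apply: sumr_ge0 => i _; rewrite mulr_ge0.
move=> t t0; rewrite horner_coef mulr_suml; apply: le_trans (ler_norm_sum _ _ _) _.
apply: ler_sum => i _; rewrite -mulrA normrM ler_wpM2l//.
by rewrite ger0_norm ?mon// mulr_ge0 ?exprn_ge0// expR_ge0.
Qed.

Lemma is_derive_flat p x : is_derive x 1 (flat p) (flat ('X^2 * (p - p^`())) x).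
Proof.
have [x0|x0|<-] := ltgtP 0 x.
- pose g t : R := p.[t^-1] * expR (- t^-1).
  apply: (@near_eq_is_derive _ _ _ g).
    by near=> y; rewrite /flat ifT//; near: y; exact: lt_nbhsr.
  have dV : is_derive x 1 (fun t : R => t^-1) (- x ^- 2).
    have := @is_deriveV R (fun t => t) x 1 1 (lt0r_neq0 x0) (is_derive_idR x).
    by rewrite /GRing.scale /= mulr1.
  have dE : is_derive x 1 (fun t : R => expR (- t^-1)) (expR (- x^-1) * x ^- 2).
    have dN := is_deriveZR (-1) dV; rewrite mulN1r opprK in dN.
    have := @is_derive_compR R expR (fun t => -1 * t^-1) x _ _ (is_derive_expR (-1 * x^-1)) dN.
    by rewrite mulN1r; congr (is_derive _ _ _ _); apply/funext => t; rewrite mulN1r.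
  have := is_deriveMR (is_derive_compR (is_derive_poly p x^-1) dV) dE.
  rewrite /flat x0 !hornerE /=; congr (is_derive _ _ _ _).
  by rewrite exprVn; ring.
- apply: (@near_eq_is_derive _ _ _ (fun=> 0)).
    by near=> y; rewrite /flat ifF//; apply/negbTE; rewrite -leNgt ltW//; near: y; exact: lt_nbhsl.
  by rewrite /flat ltNge (ltW x0) /=; exact: is_derive_cst.
(* At the origin: the bound on [t^2 p(t) exp (- t)], read at [t = 1 / h], gives
   [|flat p h| <= C * h ^+ 2], hence derivative 0. *)
have [C C0 hC] := poly_exp_bounded ('X^2 * p).
have bd h : `|flat p h| <= C * h ^+ 2.
  rewrite /flat; case: ifPn => h0; last by rewrite normr0 mulr_ge0 ?sqr_ge0.
  have := hC h^-1; rewrite invr_ge0 (ltW h0) => /(_ erefl); rewrite !hornerE.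
  rewrite -mulrA normrM ger0_norm ?exprn_ge0 ?invr_ge0 ?(ltW h0)// exprVn => h2.
  have h3 : `|p.[h^-1] * expR (- h^-1)| <= h ^+ 2 * C by rewrite -ler_pdivrMl ?exprn_gt0.
  by apply: le_trans h3 _; rewrite expr2 mulrC mulrA.
have e0 q : flat q 0 = 0 by rewrite /flat ltxx.
rewrite e0; have key : h^-1 *: (flat p (h *: 1 + 0) - flat p 0) @[h --> 0^'] --> (0 : R).
  apply/cvgrPdist_le => e ep; near=> h.
  have h0 : h != 0 by near: h; exact: nbhs_dnbhs_neq.
  rewrite sub0r normrN e0 subr0 addr0 [h *: 1]mulr1 normrZ normrV ?unitfE//.
  rewrite ler_pdivrMl ?normr_gt0//; apply: le_trans (bd h) _.
  rewrite -real_normK ?num_real// expr2 mulrA mulrC ler_wpM2l//.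
  have : `|h| <= e / (C + 1).
    near: h; apply: dnbhs0_le; rewrite divr_gt0//; lra.
  rewrite ler_pdivlMr; last lra.
  by have := normr_ge0 h; nra.
split; first by apply/cvg_ex; exists 0; exact: key.
exact: (cvg_lim _ key).
Unshelve. all: by end_near. Qed.

Lemma Ck1_flat k p : Ck1 k (flat p).
Proof.
elim: k p => [|k ih] p; first exact: is_derive_continuous (is_derive_flat p).
exact: Ck1_derive (is_derive_flat p) (ih _).
Qed.

Definition kern a f := (forall k, Ck1 k f) /\ forall x, a <= `|x| -> f x = 0.

(** Beyond [a] the function is locally zero; at [|x| = a] the continuous derivative vanishes as a
    limit from outside. *)
Lemma kern_derive a f : kern a f -> kern a (derive1 f).
Proof.
move=> [sf f0]; split; first by move=> k; exact: (sf k.+1).2.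
have c : continuous (derive1 f) by exact: (sf 1%N).2.
have far x : a < `|x| -> derive1 f x = 0.
  move=> ax; rewrite derive1E.
  have e : \near x, (fun=> 0) x = f x.
    near=> y; rewrite f0// ltW//; near: y.
    exact: (cvgr_gt _ (@norm_continuous R R x)).
  by rewrite -(near_eq_derive _ e) derive_cst.
move=> x; rewrite le_eqVlt => /predU1P[ax|]; last exact: far.
have [x0|x0] := leP 0 x.
  have lim1 : derive1 f y @[y --> x^'+] --> derive1 f x by exact/cvg_at_right_filter/c.
  have lim2 : derive1 f y @[y --> x^'+] --> (0 : R).
    apply: cvg_near_cst; near=> y; apply: far; rewrite ax !ger0_norm//.
    by rewrite (le_trans x0)// ltW.
  exact: (cvg_unique _ lim1 lim2).
have lim1 : derive1 f y @[y --> x^'-] --> derive1 f x by exact/cvg_at_left_filter/c.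
have lim2 : derive1 f y @[y --> x^'-] --> (0 : R).
  apply: cvg_near_cst; near=> y; apply: far; have yx : y < x by [].
  by rewrite ax !ltr0_norm ?ltrN2// (lt_trans yx).
exact: (cvg_unique _ lim1 lim2).
Unshelve. all: by end_near. Qed.

Lemma kern_bounded a f : kern a f -> exists2 M, 0 <= M & forall x, `|f x| <= M.
Proof.
move=> [sf f0].
have cf : continuous (fun x => `|f x|).
  by apply: cont_comp (sf 0%N) _; exact: norm_continuous.
have [a0|a0] := ltP a 0.
  by exists 0 => // x; rewrite f0 ?normr0// (le_trans (ltW a0)).
have aa : - a <= a by lra.
have [|c _ hc] := @EVT_max R (fun x => `|f x|) (- a) a aa.
  exact: continuous_subspaceT.
exists `|f c| => // x; have [xa|xa] := leP a `|x|; first by rewrite f0 ?normr0.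
by apply: hc; rewrite in_itv /= -ler_norml ltW.
Qed.

Lemma kern_lipschitz a f : kern a f ->
  exists2 L, 0 <= L & forall x y, `|f x - f y| <= L * `|x - y|.
Proof.
move=> kf; have [L L0 hL] := kern_bounded (kern_derive kf); exists L => //.
have df := Ck1_is_derive (kf.1 1%N).
have key x y : x <= y -> `|f y - f x| <= L * `|y - x|.
  by move=> xy; have [c _ ->] := mean_value xy df; rewrite normrM ler_wpM2r.
move=> x y; have [xy|/ltW yx] := leP x y; last exact: key.
by rewrite distrC (distrC x); exact: key.
Qed.

(** Unit mass is stated through an antiderivative, so that the mass over any interval is read off
    from increments of [K]. *)
Definition mollk e k := [/\ kern e k, forall x, 0 <= k x & exists2 K : R -> R,
  forall x, is_derive x 1 K (k x) & K e - K (- e) = 1].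

Lemma exists_mollk e : 0 < e -> exists k, mollk e k.
Proof.
move=> e0.
(* Positive exactly on []-1, 1[]. The factors 1 and the affine arguments give it the shape required
   by [Ck1_affine]. *)
pose b x : R := (1 * flat 1 (1 * x + 1)) * (1 * flat 1 (-1 * x + 1)).
have sb k : Ck1 k b by apply: Ck1M; apply: Ck1_affine; exact: Ck1_flat.
have flat_ge0 x : 0 <= flat 1 x :> R.
  by rewrite /flat; case: ifP => // _; rewrite hornerE mul1r expR_ge0.
have flat_gt0 x : 0 < x -> 0 < flat 1 x :> R.
  by move=> x0; rewrite /flat x0 hornerE mul1r expR_gt0.
have flat_0 x : x <= 0 -> flat 1 x = 0 :> R by move=> x0; rewrite /flat ltNge x0.
have b_ge0 x : 0 <= b x by rewrite /b !mul1r mulr_ge0.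
have b_0 x : 1 <= `|x| -> b x = 0.
  rewrite /b !mul1r mulN1r ler_normr => /orP[h|h].
    by rewrite (flat_0 (- x + 1)) ?mulr0//; lra.
  by rewrite (flat_0 (x + 1)) ?mul0r//; lra.
have cb : continuous b by exact: (sb 0%N).
have dG x := is_derive_prim x cb.
pose c := prim b 1 - prim b (-1).
have c0 : 0 < c.
  have [|d dab hd] := @mean_value _ (prim b) b 0 (2^-1) _ dG; first lra.
  have : 0 < b d * (2^-1 - 0).
    apply: mulr_gt0; last lra.
    by rewrite /b !mul1r; apply: mulr_gt0; apply: flat_gt0; lra.
  rewrite -hd.
  have h1 := @derive_ge0_le _ (prim b) b (-1) 0 ltac:(lra) dG (fun x _ => b_ge0 x).
  have h2 := @derive_ge0_le _ (prim b) b (2^-1) 1 ltac:(lra) dG (fun x _ => b_ge0 x).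
  move: h1 h2; rewrite /c.
  by move: (prim b 1) (prim b (-1)) (prim b 2^-1) (prim b 0) => A B C D *; lra.
exists (fun x => (e^-1 * c^-1) * b (e^-1 * x + 0)); split.
- split; first by move=> k; exact: Ck1_affine.
  move=> x ex; rewrite b_0 ?mulr0// addr0 normrM ger0_norm ?invr_ge0 ?(ltW e0)//.
  by rewrite ler_pdivlMl ?mulr1.
- by move=> x; rewrite mulr_ge0 ?b_ge0// mulr_ge0 ?invr_ge0 ?(ltW e0) ?(ltW c0).
exists (fun x => c^-1 * prim b (e^-1 * x + 0)).
  move=> x; rewrite [e^-1 * _]mulrC -mulrA; apply: is_deriveZR.
  by rewrite mulrC; apply: is_derive_compaffine.
rewrite !addr0 mulrN mulVf ?gt_eqF// -mulrBr -/c mulVf// gt_eqF//.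
Qed.
End SmoothReal.

(** * Mollification *)

Section Mollifier.
Context {R : realType}.
Notation mu := (@lebesgue_measure R).
Notation P := (measurableTypeR R * measurableTypeR R)%type.
Variables (r : R) (r0 : 0 < r).
Implicit Types (f g : R * R -> R) (k : R -> R) (l e : R) (x y : R * R).
Let mD : measurable (disc r : set P) := measurable_disc r0.

Lemma sqint_integrable f : sqint leb2 (disc r) f -> leb2.-integrable (disc r : set P) (EFin \o f).
Proof.
move=> hf; have h1 : sqint leb2 (disc r) (cst 1).
  by apply: continuous_sqint2 => //; exact: cont_cst.
apply: eq_integrable (sqint_mul mD hf h1) => //.
by move=> x _ /=; rewrite mulr1.
Qed.

(* With [l < 1] the kernel at [x] in the disc is supported in the disc; with [l > 1] the
   mollified function has compact support in the disc. *)
Definition tensor k1 k2 l x y : R := k1 (l * x.1 - y.1) * k2 (l * x.2 - y.2).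
Definition mol f k1 k2 l x : R := \int[leb2]_(y in disc r) (f y * tensor k1 k2 l x y).

Lemma continuous_tensor k1 k2 l x : continuous k1 -> continuous k2 -> continuous (tensor k1 k2 l x).
Proof.
move=> c1 c2; apply: contM.
  by apply: cont_comp c1; apply: contB; [exact: cont_cst|exact: continuous_fst2].
by apply: cont_comp c2; apply: contB; [exact: cont_cst|exact: continuous_snd2].
Qed.

Lemma tensor_bounded a k1 k2 : kern a k1 -> kern a k2 ->
  exists2 M, 0 <= M & forall l x y, `|tensor k1 k2 l x y| <= M.
Proof.
move=> h1 h2; have [M1 M10 hM1] := kern_bounded h1; have [M2 M20 hM2] := kern_bounded h2.
by exists (M1 * M2); [exact: mulr_ge0|move=> l x y; rewrite normrM ler_pM].
Qed.

Lemma mol_integrable a f k1 k2 l x : kern a k1 -> kern a k2 ->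
  leb2.-integrable (disc r : set P) (EFin \o f) ->
  leb2.-integrable (disc r : set P) (EFin \o (fun y => f y * tensor k1 k2 l x y)).
Proof.
move=> h1 h2 hf; have [M M0 hM] := tensor_bounded h1 h2.
have c : continuous (tensor k1 k2 l x) by apply: continuous_tensor; [exact: (h1.1 0%N)|exact: (h2.1 0%N)].
have hMf : leb2.-integrable (disc r : set P) (fun y => M%:E * (f y)%:E)%E by exact: integrableZl.
apply: le_integrable hMf => //.
  apply/measurable_EFinP; apply: measurable_funM.
    by apply/measurable_EFinP; exact: measurable_int hf.
  exact: measurable_funS (continuous_measurable2 c).
move=> y _ /=; rewrite lee_fin normrM mulrC [leRHS]normrM (ger0_norm M0).
by rewrite ler_wpM2r.
Qed.

(** Differentiation under the integral sign, dominated by a constant times [|f|]: the derivative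
    falls on the kernel alone. *)
Lemma mol_derive1 a f k1 k2 l x : kern a k1 -> kern a k2 ->
  leb2.-integrable (disc r : set P) (EFin \o f) ->
  derivable (mol f k1 k2 l) x e1 /\
  'D_e1 (mol f k1 k2 l) x = l * mol f (derive1 k1) k2 l x.
Proof.
move=> h1 h2 hf; case: x => s t; have h1' := kern_derive h1.
have [M M0 hM] := tensor_bounded h1' h2.
pose F (z : R) (y : P) := f y * tensor k1 k2 l (z, t) y.
have dF (z : R) y : is_derive z 1 (fun z : R => F z y) (l * (f y * tensor (derive1 k1) k2 l (z, t) y)).
  have d := is_derive_compaffine (Ck1_is_derive (h1.1 1%N) (l * z + (- y.1))).
  have := is_deriveZR (f y * k2 (l * t - y.2)) d.
  congr (is_derive _ _ _ _); last by rewrite /tensor /=; ring.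
  by apply/funext => w; rewrite /F /tensor /=; ring.
have intF z : leb2.-integrable (disc r : set P) (EFin \o F z) by exact: mol_integrable h1 h2 hf.
have p1 z y : partial1of2 F z y = l * (f y * tensor (derive1 k1) k2 l (z, t) y).
  by rewrite partial1of2E; have [_ ->] := dF z y.
pose G (y : P) := `|l| * M * `|f y|.
have intG : leb2.-integrable (disc r : set P) (EFin \o G).
  have := integrableZl mD (`|l| * M) (integrable_norm hf).
  by apply: eq_integrable.
have G0 y : 0 <= G y by rewrite !mulr_ge0.
have Gub z y : (`]s - 1, s + 1[%classic : set R) z -> (disc r : set P) y ->
    `|partial1of2 F z y| <= G y.
  by move=> _ _; rewrite p1 (normrM l) (normrM (f y)) /G -mulrA; apply: ler_wpM2l => //; rewrite mulrC; apply: ler_wpM2r => //; exact: hM.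
have Is : (`]s - 1, s + 1[%classic : set R) s by rewrite /= in_itv /=; apply/andP; split; lra.
have dv z y : (`]s - 1, s + 1[%classic : set R) z -> (disc r : set P) y -> derivable (F ^~ y) z 1.
  by move=> _ _; have [] := dF z y.
have A := @derivable_under_integral R _ P leb2 F (disc r) mD s (s - 1) (s + 1) Is
  (fun z _ => intF z) dv G G0 intG Gub.
have B := @differentiation_under_integral R _ P leb2 F (disc r) mD s (s - 1) (s + 1) Is
  (fun z _ => intF z) dv G G0 intG Gub.
split; first by apply/derivable_e1E.
rewrite derive_e1E -derive1E [LHS]B /mol -RintegralZl//; last exact: mol_integrable h1' h2 hf.
by apply: eq_Rintegral => y _; rewrite p1.
Qed.

Lemma mol_derive2 a f k1 k2 l x : kern a k1 -> kern a k2 ->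
  leb2.-integrable (disc r : set P) (EFin \o f) ->
  derivable (mol f k1 k2 l) x e2 /\
  'D_e2 (mol f k1 k2 l) x = l * mol f k1 (derive1 k2) l x.
Proof.
move=> h1 h2 hf; case: x => s t; have h2' := kern_derive h2.
have [M M0 hM] := tensor_bounded h1 h2'.
pose F (z : R) (y : P) := f y * tensor k1 k2 l (s, z) y.
have dF (z : R) y : is_derive z 1 (fun z : R => F z y) (l * (f y * tensor k1 (derive1 k2) l (s, z) y)).
  have d := is_derive_compaffine (Ck1_is_derive (h2.1 1%N) (l * z + (- y.2))).
  have := is_deriveZR (f y * k1 (l * s - y.1)) d.
  congr (is_derive _ _ _ _); last by rewrite /tensor /=; ring.
  by apply/funext => w; rewrite /F /tensor /=; ring.
have intF z : leb2.-integrable (disc r : set P) (EFin \o F z) by exact: mol_integrable h1 h2 hf.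
have p1 z y : partial1of2 F z y = l * (f y * tensor k1 (derive1 k2) l (s, z) y).
  by rewrite partial1of2E; have [_ ->] := dF z y.
pose G (y : P) := `|l| * M * `|f y|.
have intG : leb2.-integrable (disc r : set P) (EFin \o G).
  have := integrableZl mD (`|l| * M) (integrable_norm hf).
  by apply: eq_integrable.
have G0 y : 0 <= G y by rewrite !mulr_ge0.
have Gub z y : (`]t - 1, t + 1[%classic : set R) z -> (disc r : set P) y ->
    `|partial1of2 F z y| <= G y.
  by move=> _ _; rewrite p1 (normrM l) (normrM (f y)) /G -mulrA; apply: ler_wpM2l => //; rewrite mulrC; apply: ler_wpM2r => //; exact: hM.
have Is : (`]t - 1, t + 1[%classic : set R) t by rewrite /= in_itv /=; apply/andP; split; lra.
have dv z y : (`]t - 1, t + 1[%classic : set R) z -> (disc r : set P) y -> derivable (F ^~ y) z 1.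
  by move=> _ _; have [] := dF z y.
have A := @derivable_under_integral R _ P leb2 F (disc r) mD t (t - 1) (t + 1) Is
  (fun z _ => intF z) dv G G0 intG Gub.
have B := @differentiation_under_integral R _ P leb2 F (disc r) mD t (t - 1) (t + 1) Is
  (fun z _ => intF z) dv G G0 intG Gub.
split; first by apply/derivable_e2E.
rewrite derive_e2E -derive1E [LHS]B /mol -RintegralZl//; last exact: mol_integrable h1 h2' hf.
by apply: eq_Rintegral => y _; rewrite p1.
Qed.

Lemma continuous_of_lipschitz (F : R * R -> R) C :
  (forall x y, `|F x - F y| <= C * (`|x.1 - y.1| + `|x.2 - y.2|)) -> continuous F.
Proof.
move=> hF x; apply/cvgrPdist_le => e e0.
have lim0 : C * (`|x.1 - y.1| + `|x.2 - y.2|) @[y --> x] --> (0 : R).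
  have c : continuous (fun y : R * R => C * (`|x.1 - y.1| + `|x.2 - y.2|)).
    apply/contZ/contD.
      have h : continuous (fun y : R * R => x.1 - y.1).
        by apply: contB; [exact: cont_cst|exact: continuous_fst2].
      by apply: cont_comp h _; exact: norm_continuous.
    have h : continuous (fun y : R * R => x.2 - y.2).
      by apply: contB; [exact: cont_cst|exact: continuous_snd2].
    by apply: cont_comp h _; exact: norm_continuous.
  by have := c x; rewrite /continuous_at !subrr !normr0 addr0 mulr0.
move/cvgrPdist_le : lim0 => /(_ e e0); apply: filterS => y; rewrite sub0r normrN.
by move=> h; apply: le_trans (hF x y) (le_trans (ler_norm _) h).
Qed.

Lemma continuous_mol a f k1 k2 l : kern a k1 -> kern a k2 ->
  leb2.-integrable (disc r : set P) (EFin \o f) -> continuous (mol f k1 k2 l).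
Proof.
move=> h1 h2 hf.
have [M1 M10 hM1] := kern_bounded h1; have [M2 M20 hM2] := kern_bounded h2.
have [L1 L10 hL1] := kern_lipschitz h1; have [L2 L20 hL2] := kern_lipschitz h2.
have nf := integrable_norm hf.
pose I := \int[leb2]_(y in disc r) `|f y|.
have I0 : 0 <= I by apply: Rintegral_ge0.
pose C := `|l| * (L1 * M2 + M1 * L2).
apply: (@continuous_of_lipschitz _ (C * I)) => x y.
have ix := mol_integrable l x h1 h2 hf; have iy := mol_integrable l y h1 h2 hf.
rewrite /mol -RintegralB//.
set d := `|x.1 - y.1| + `|x.2 - y.2|.
have d0 : 0 <= d by rewrite addr_ge0.
have ixy : leb2.-integrable (disc r : set P)
    (EFin \o (fun z => f z * tensor k1 k2 l x z - f z * tensor k1 k2 l y z)).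
  by have := integrableB mD ix iy; apply: eq_integrable.
apply: le_trans (le_normr_Rintegral mD ixy) _.
have key z : `|f z * tensor k1 k2 l x z - f z * tensor k1 k2 l y z| <= (C * d) * `|f z|.
  rewrite -mulrBr normrM mulrC ler_wpM2r//.
  have -> : tensor k1 k2 l x z - tensor k1 k2 l y z =
    (k1 (l * x.1 - z.1) - k1 (l * y.1 - z.1)) * k2 (l * x.2 - z.2) +
    k1 (l * y.1 - z.1) * (k2 (l * x.2 - z.2) - k2 (l * y.2 - z.2)).
    by rewrite /tensor; ring.
  apply: le_trans (ler_normD _ _) _; rewrite !normrM.
  have a1 : `|k1 (l * x.1 - z.1) - k1 (l * y.1 - z.1)| <= L1 * (`|l| * `|x.1 - y.1|).
    by apply: le_trans (hL1 _ _) _; rewrite -normrM ler_wpM2l//; rewrite le_eqVlt;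
       apply/orP; left; apply/eqP; congr (`|_|); ring.
  have a2 : `|k2 (l * x.2 - z.2) - k2 (l * y.2 - z.2)| <= L2 * (`|l| * `|x.2 - y.2|).
    by apply: le_trans (hL2 _ _) _; rewrite -normrM ler_wpM2l//; rewrite le_eqVlt;
       apply/orP; left; apply/eqP; congr (`|_|); ring.
  have b1 := ler_pM (normr_ge0 _) (normr_ge0 _) a1 (hM2 (l * x.2 - z.2)).
  have b2 := ler_pM (normr_ge0 _) (normr_ge0 _) (hM1 (l * y.1 - z.1)) a2.
  apply: le_trans (lerD b1 b2) _; rewrite /C /d.
  have p1 : 0 <= `|l| * L1 * M2 * `|x.2 - y.2| by rewrite !mulr_ge0.
  have p2 : 0 <= `|l| * M1 * L2 * `|x.1 - y.1| by rewrite !mulr_ge0.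
  rewrite -subr_ge0; apply: le_trans (addr_ge0 p1 p2) _.
  by rewrite le_eqVlt; apply/orP; left; apply/eqP; ring.
apply: le_trans (le_Rintegral mD (integrable_norm ixy) _ (fun z _ => key z)) _.
  by have := integrableZl mD (C * d) nf; apply: eq_integrable.
by rewrite RintegralZl// -/I mulrAC.
Qed.

Lemma smooth_mol a f k1 k2 l : kern a k1 -> kern a k2 ->
  leb2.-integrable (disc r : set P) (EFin \o f) -> smooth (mol f k1 k2 l).
Proof.
move=> h1 h2 hf n.
(* Each differentiation multiplies by [l] and replaces one kernel by its derivative, so the
   induction runs over all kernels and constant factors. *)
suff key c j1 j2 : kern a j1 -> kern a j2 -> Ck n (fun x => c * mol f j1 j2 l x).
  have := key 1 _ _ h1 h2; congr (Ck n _).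
  by apply/funext => x; rewrite mul1r.
elim: n c j1 j2 => [|n ih] c j1 j2 g1 g2 /=.
  by apply: contZ; exact: continuous_mol g1 g2 hf.
have D1 x := mol_derive1 l x g1 g2 hf.
have D2 x := mol_derive2 l x g1 g2 hf.
split.
- by move=> x; split; apply: derivableZ; [exact: (D1 x).1|exact: (D2 x).1].
- have := ih (c * l) _ _ (kern_derive g1) g2; congr (Ck n _); apply/funext => x.
  by rewrite -mulrA -(D1 x).2; apply/esym/deriveZ; exact: (D1 x).1.
- have := ih (c * l) _ _ g1 (kern_derive g2); congr (Ck n _); apply/funext => x.
  by rewrite -mulrA -(D2 x).2; apply/esym/deriveZ; exact: (D2 x).1.
Qed.
End Mollifier.

Section PlaneSigmaFinite.
Context {R : realType}.
Notation P := (measurableTypeR R * measurableTypeR R)%type.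

Lemma leb2_sigma_finiteT : sigma_finite (setT : set P) (@leb2 R).
Proof.
exists (fun n => `[- n%:R, n%:R]%classic `*` `[- n%:R, n%:R]%classic).
  apply/seteqP; split => // -[x y] _.
  exists (Num.bound (`|x| + `|y|)) => //; have h := archi_boundP (addr_ge0 (normr_ge0 x) (normr_ge0 y)).
  split; rewrite /= in_itv /= -ler_norml ltW//; apply: le_lt_trans h.
    by rewrite lerDl.
  by rewrite lerDr.
move=> n; split; last exact: leb2_box.
by apply: measurableX; exact: measurable_itv.
Qed.

(** [leb2] is declared as a plain measure; the sigma-finiteness that Tonelli's theorem for pairs of
    points asks for is attached to this copy. *)
Definition leb2_fun : set P -> \bar R := @leb2 R.
HB.instance Definition _ := Measure.copy leb2_fun (@leb2 R).
HB.instance Definition _ := Measure_isSigmaFinite.Build _ _ _ leb2_fun leb2_sigma_finiteT.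

Lemma leb2_tonelli (H : P * P -> \bar R) : measurable_fun setT H -> (forall z, (0 <= H z)%E) ->
  [/\ measurable_fun setT (fun x => (\int[leb2]_y H (x, y))%E),
      measurable_fun setT (fun y => (\int[leb2]_x H (x, y))%E) &
      (\int[leb2]_x \int[leb2]_y H (x, y) = \int[leb2]_y \int[leb2]_x H (x, y))%E].
Proof.
move=> mH H0; split.
- exact: (@measurable_fun_fubini_tonelli_F _ _ P P R leb2_fun H mH H0).
- exact: (@measurable_fun_fubini_tonelli_G _ _ P P R leb2_fun H mH H0).
- exact: (@fubini_tonelli _ _ P P R leb2_fun leb2_fun H mH H0).
Qed.
End PlaneSigmaFinite.

(** * Mass of the kernels and boundedness of mollification in [L2] *)

Section MollifierMass.
Context {R : realType}.
Notation mu := (@lebesgue_measure R).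
Notation P := (measurableTypeR R * measurableTypeR R)%type.

Lemma mollk_primitive e (k : R -> R) : 0 < e -> mollk e k -> exists K : R -> R,
  [/\ forall x : R, is_derive x 1 K (k x),
      forall u v, v <= u -> 0 <= K u - K v <= 1 &
      forall u v, v <= - e -> e <= u -> K u - K v = 1].
Proof.
move=> e0 [kk k0 [K dK K1]]; exists K.
have out a b : a <= b -> (forall c, a <= c <= b -> e <= `|c|) -> K a = K b.
  move=> ab h; have [c cab d] := mean_value ab dK.
  by apply/eqP; rewrite eq_sym -subr_eq0 d kk.2 ?mul0r//; exact: h.
have mono v u : v <= u -> K v <= K u.
  by move=> vu; exact: derive_ge0_le vu dK (fun x _ => k0 x).
have hi u : e <= u -> K u = K e.
  move=> eu; apply/esym/out => // c /andP[ec _]; rewrite ger0_norm//; lra.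
have lo u : u <= - e -> K u = K (- e).
  move=> eu; apply: out => // c /andP[_ ec]; rewrite ler0_norm; lra.
have le_hi u : K u <= K e.
  by have [h|/ltW h] := leP u e; [exact: mono|rewrite hi].
have ge_lo u : K (- e) <= K u.
  by have [h|/ltW h] := leP (- e) u; [exact: mono|rewrite lo].
split => //.
- move=> u v vu; have := mono _ _ vu; have := le_hi u; have := ge_lo v.
  by move: K1; move: (K u) (K v) (K e) (K (- e)) => A B C D *; apply/andP; split; lra.
- by move=> u v h1 h2; rewrite (lo v)// (hi u).
Qed.

Lemma integral_tensor_box (g h : R -> R) a b : continuous g -> continuous h ->
  (forall t, 0 <= g t) -> (forall t, 0 <= h t) ->
  (\int[leb2]_(y in (`[a, b]%classic `*` `[a, b]%classic : set P)) (g y.1 * h y.2)%:E =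
   ((\int[mu]_(t in `[a, b]) g t) * (\int[mu]_(t in `[a, b]) h t))%:E)%E.
Proof.
move=> cg ch g0 h0.
have mI : measurable (`[a, b]%classic : set (measurableTypeR R)) by exact: measurable_itv.
pose G := g \_ `[a, b]; pose H := h \_ `[a, b].
have mG : measurable_fun setT (G : measurableTypeR R -> R).
  by apply/(measurable_restrictT _ mI); apply: measurable_funS (continuous_measurable_fun cg).
have mH : measurable_fun setT (H : measurableTypeR R -> R).
  by apply/(measurable_restrictT _ mI); apply: measurable_funS (continuous_measurable_fun ch).
have G0 t : 0 <= G t by rewrite /G patchE; case: ifP.
have H0 t : 0 <= H t by rewrite /H patchE; case: ifP.
have GE : (\int[mu]_t (G t)%:E = (\int[mu]_(t in `[a, b]) g t)%:E)%E.
  rewrite -EFin_Rintegral1// [RHS]integral_mkcond; apply: eq_integral => t _.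
  by rewrite /G !patchE; case: ifP.
have HE : (\int[mu]_t (H t)%:E = (\int[mu]_(t in `[a, b]) h t)%:E)%E.
  rewrite -EFin_Rintegral1// [RHS]integral_mkcond; apply: eq_integral => t _.
  by rewrite /H !patchE; case: ifP.
rewrite integral_mkcond.
transitivity (\int[leb2]_(y in (setT : set P)) (G y.1 * H y.2)%:E)%E.
  apply: eq_integral => -[s t] _; rewrite !patchE /G /H !patchE /=.
  have -> : ((s, t) \in (`[a, b]%classic `*` `[a, b]%classic)) =
      (s \in `[a, b]%classic) && (t \in `[a, b]%classic).
    apply/idP/andP => [/set_mem[/= hs ht]|[/set_mem hs /set_mem ht]].
      by split; exact: mem_set.
    exact: mem_set.
  by case: (s \in _); case: (t \in _); rewrite /= ?mulr0 ?mul0r.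
have mGH : measurable_fun (setT : set P) (fun y => (G y.1 * H y.2)%:E).
  apply/measurable_EFinP; apply: measurable_funM.
    exact: (measurableT_comp mG (@measurable_fst _ _ _ _)).
  exact: (measurableT_comp mH (@measurable_snd _ _ _ _)).
have := @fubini_tonelli1 _ _ (measurableTypeR R) (measurableTypeR R) R
  (@lebesgue_measure R) (@lebesgue_measure R) (fun y => (G y.1 * H y.2)%:E) mGH.
move=> ->; last by move=> y; rewrite lee_fin mulr_ge0.
rewrite /fubini_F /=.
transitivity (\int[mu]_x ((G x)%:E * (\int[mu]_(t in `[a, b]) h t)%:E))%E.
  apply: eq_integral => x _; rewrite -HE.
  under eq_integral do rewrite EFinM.
  rewrite ge0_integralZl//; last by rewrite lee_fin.
    exact/measurable_EFinP.
  by move=> t _; rewrite lee_fin.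
rewrite ge0_integralZr//; first by rewrite GE EFinM.
- exact/measurable_EFinP.
- by move=> t _; rewrite lee_fin.
- by rewrite lee_fin; apply: Rintegral_ge0.
Qed.

Variables (r : R) (r0 : 0 < r).
Let mD : measurable (disc r : set P) := measurable_disc r0.
Notation box := (`[- r, r]%classic `*` `[- r, r]%classic : set P).
Let mbox : measurable box.
Proof. by apply: measurableX; exact: measurable_itv. Qed.
Let disc_box : (disc r : set P) `<=` box.
Proof. by move=> x /disc_cdisc; exact: cdisc_box. Qed.

Lemma continuous_compaff (k : R -> R) (l c : R) : continuous k -> continuous (fun t : R => k (l * t + c)).
Proof.
move=> ck; have h : continuous (fun t : R => l * t + c) by exact: is_derive_continuous (is_derive_affine l c).
exact: cont_comp h ck.
Qed.

(** The masses in [x] and in [y] are the two bounds of Schur's test for the mollification operator;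
    in [x] each coordinate contributes a factor [1 / l]. *)
Lemma mollk_mass_x e k l y : 0 < e -> mollk e k -> 0 < l ->
  (\int[leb2]_(x in disc r) (tensor k k l x y)%:E <= (l^-1 ^+ 2)%:E)%E.
Proof.
move=> e0 hk l0; have [kk k0 _] := hk; have [K [dK K01 _]] := mollk_primitive e0 hk.
have ck : continuous k by exact: (kk.1 0%N).
have c1 c : continuous (fun t => k (l * t + c)) by exact: continuous_compaff.
have one c : 0 <= \int[mu]_(t in `[- r, r]) k (l * t + c) <= l^-1.
  rewrite Rintegral_ge0//=.
  have -> : \int[mu]_(t in `[- r, r]) k (l * t + c) = l^-1 * K (l * r + c) - l^-1 * K (l * - r + c).
    apply: (@Rintegral_FTC2 _ (fun t => l^-1 * K (l * t + c))) => //.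
    - by move: r0 => r0'; lra.
    - move=> t _; have := is_deriveZR l^-1 (is_derive_compaffine (dK (l * t + c))).
      by rewrite [_ * l]mulrC mulKf ?gt_eqF.
    - by apply: contZ; apply: continuous_compaff; exact: is_derive_continuous dK.
  rewrite -mulrBr ler_piMr ?invr_ge0 ?(ltW l0)//.
  have lr : l * - r + c <= l * r + c by rewrite lerD2r ler_pM2l//; move: r0 => r0'; lra.
  by have /andP[] := K01 _ _ lr.
apply: (@le_trans _ _ (\int[leb2]_(x in box) (tensor k k l x y)%:E)%E).
  apply: ge0_subset_integral => //.
    apply/measurable_EFinP; apply: measurable_funS (_ : measurable_fun setT _) => //.
    apply: continuous_measurable2; apply: contM.
      have := cont_comp (@continuous_fst2 R) (c1 (- y.1)); exact.
    have := cont_comp (@continuous_snd2 R) (c1 (- y.2)); exact.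
  by move=> x _; rewrite lee_fin mulr_ge0.
rewrite (integral_tensor_box (- r) r (c1 (- y.1)) (c1 (- y.2)))//.
rewrite lee_fin expr2; have /andP[? ?] := one (- y.1); have /andP[? ?] := one (- y.2).
exact: ler_pM.
Qed.

(** Where the kernel crosses the circle part of its mass is lost, hence only a bound in general;
    equality holds when its whole support lies in the disc. *)
Lemma mollk_mass_y e k l x : 0 < e -> mollk e k ->
  0 <= \int[leb2]_(y in disc r) tensor k k l x y <= 1 /\
  ((forall y : R * R, `|l * x.1 - y.1| <= e -> `|l * x.2 - y.2| <= e -> disc r y) ->
   \int[leb2]_(y in disc r) tensor k k l x y = 1).
Proof.
move=> e0 hk; have [kk k0 _] := hk; have [K [dK K01 K1]] := mollk_primitive e0 hk.
have ck : continuous k by exact: (kk.1 0%N).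
have cB c : continuous (fun t => k (c - t)).
  by apply: cont_comp ck; exact: continuous_subl.
have ct : continuous (tensor k k l x) by exact: continuous_tensor.
have t0 y : 0 <= tensor k k l x y by rewrite mulr_ge0.
have mT A : measurable_fun (A : set P) (fun y => (tensor k k l x y)%:E).
  apply/measurable_EFinP; apply: measurable_funS (_ : measurable_fun setT _) => //.
  exact: continuous_measurable2.
have one c : \int[mu]_(t in `[- r, r]) k (c - t) = K (c + r) - K (c - r).
  have -> : K (c + r) - K (c - r) = - K (c - r) - (- K (c - - r)) by rewrite !opprK addrC.
  apply: (@Rintegral_FTC2 _ (fun t => - K (c - t))) => //.
  - by move: r0 => r0'; lra.
  - move=> t _; have := is_deriveZR (-1) (@is_derive_compR R K (fun t => c - t) t _ _ (dK (c - t)) (is_derive_subl c t)).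
    rewrite mulrN1 mulN1r opprK; congr (is_derive _ _ _ _).
    by apply/funext => s; rewrite mulN1r.
  - by apply: contN; apply: cont_comp (is_derive_continuous dK); exact: continuous_subl.
have B01 c : 0 <= K (c + r) - K (c - r) <= 1 by apply: K01; move: r0 => r0'; lra.
have Ebox : (\int[leb2]_(y in box) (tensor k k l x y)%:E =
    ((K (l * x.1 + r) - K (l * x.1 - r)) * (K (l * x.2 + r) - K (l * x.2 - r)))%:E)%E.
  by rewrite -!one (integral_tensor_box (- r) r (cB (l * x.1)) (cB (l * x.2))).
have fin : (\int[leb2]_(y in disc r) (tensor k k l x y)%:E \is a fin_num)%E.
  by apply: integrable_fin_num => //; exact: (continuous_integrable2 r0 ct).
split.
  apply/andP; split; first exact: Rintegral_ge0.
  rewrite -lee_fin /Rintegral fineK//.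
  apply: (@le_trans _ _ (\int[leb2]_(y in box) (tensor k k l x y)%:E)%E).
    by apply: ge0_subset_integral => //; move=> y _; rewrite lee_fin.
  rewrite Ebox lee_fin.
  have /andP[? ?] := B01 (l * x.1); have /andP[? ?] := B01 (l * x.2).
  by rewrite mulr_ile1.
move=> hin; apply/EFin_inj; rewrite /Rintegral fineK//.
have -> : (\int[leb2]_(y in disc r) (tensor k k l x y)%:E =
           \int[leb2]_(y in box) (tensor k k l x y)%:E)%E.
  rewrite integral_mkcond [RHS]integral_mkcond; apply: eq_integral => y _; rewrite !patchE.
  case: ifPn => [/set_mem yD|yD]; first by rewrite mem_set//; exact: disc_box.
  case: ifPn => // _; apply/esym; congr EFin.
  have [h1|h1] := leP `|l * x.1 - y.1| e; last by rewrite /tensor kk.2 ?mul0r// ltW.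
  have [h2|h2] := leP `|l * x.2 - y.2| e; last by rewrite /tensor (kk.2 (_ - y.2)) ?mulr0// ltW.
  by move: yD; rewrite mem_set//; exact: hin.
rewrite Ebox; congr EFin.
have inb z1 z2 : `|l * x.1 - z1| <= e -> `|l * x.2 - z2| <= e ->
    (- r <= z1 <= r) /\ (- r <= z2 <= r).
  by move=> a1 a2; have [] := disc_box (hin (z1, z2) a1 a2).
have e00 : 0 <= e by exact: ltW.
have m1 c : `|c - (c - e)| <= e by rewrite opprB addrC subrK ger0_norm.
have p1 c : `|c - (c + e)| <= e by rewrite opprD addrA subrr sub0r normrN ger0_norm.
have [/andP[i1 _] /andP[i2 _]] := inb _ _ (m1 (l * x.1)) (m1 (l * x.2)).
have [/andP[_ i3] /andP[_ i4]] := inb _ _ (p1 (l * x.1)) (p1 (l * x.2)).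
by rewrite !K1 ?mulr1//; lra.
Qed.

(** Jensen's inequality for a kernel of mass [m <= 1]: with [c] the mollified value, expanding the
    integral of [(f - c) ^+ 2] against the kernel gives [S - 2 * c ^+ 2 + c ^+ 2 * m >= 0]. *)
Lemma sqr_mol_le e k l (f : R * R -> R) x : 0 < e -> mollk e k -> sqint leb2 (disc r) f ->
  mol r f k k l x ^+ 2 <= \int[leb2]_(y in disc r) (f y ^+ 2 * tensor k k l x y).
Proof.
move=> e0 hk hf; have [kk k0 _] := hk.
have [/andP[m0 m1] _] := mollk_mass_y l x e0 hk.
have i1 : leb2.-integrable (disc r : set P) (EFin \o (fun y => f y ^+ 2 * tensor k k l x y)).
  exact: (@mol_integrable _ _ r0 e (fun y => f y ^+ 2) k k l x kk kk (sqint_sqr hf)).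
have i2 := mol_integrable r0 l x kk kk (sqint_integrable r0 hf).
have i3 : leb2.-integrable (disc r : set P) (EFin \o (fun y => tensor k k l x y)).
  by apply: (continuous_integrable2 r0); apply: continuous_tensor; exact: (kk.1 0%N).
set c := mol r f k k l x; set m := \int[leb2]_(y in disc r) _ in m0 m1.
set S := \int[leb2]_(y in disc r) _.
have i2' : leb2.-integrable (disc r : set P) (EFin \o (fun y => (2 * c) * (f y * tensor k k l x y))).
  by have := integrableZl mD (2 * c) i2; apply: eq_integrable.
have i3' : leb2.-integrable (disc r : set P) (EFin \o (fun y => (c ^+ 2) * tensor k k l x y)).
  by have := integrableZl mD (c ^+ 2) i3; apply: eq_integrable.
have i12 : leb2.-integrable (disc r : set P)
   (EFin \o (fun y => f y ^+ 2 * tensor k k l x y - (2 * c) * (f y * tensor k k l x y))).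
  by have := integrableB mD i1 i2'; apply: eq_integrable.
have : 0 <= \int[leb2]_(y in disc r) ((f y - c) ^+ 2 * tensor k k l x y).
  by apply: Rintegral_ge0 => y _; rewrite mulr_ge0 ?sqr_ge0// mulr_ge0.
have -> : \int[leb2]_(y in disc r) ((f y - c) ^+ 2 * tensor k k l x y) =
    S - (2 * c) * c + c ^+ 2 * m.
  have -> : (2 * c) * c = \int[leb2]_(y in disc r) ((2 * c) * (f y * tensor k k l x y)).
    by rewrite RintegralZl.
  have -> : c ^+ 2 * m = \int[leb2]_(y in disc r) (c ^+ 2 * tensor k k l x y).
    by rewrite RintegralZl.
  rewrite -RintegralB// -RintegralD//.
  by apply: eq_Rintegral => y _; ring.
have := sqr_ge0 c; nra.
Qed.

(** Schur's test: Jensen's bound is integrated in [x], the integrals are exchanged by Tonelli, and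
    the mass in [x] is bounded. *)
Lemma nrm2_mol_le e k l (f : R * R -> R) : 0 < e -> mollk e k -> 0 < l -> sqint leb2 (disc r) f ->
  sqint leb2 (disc r) (mol r f k k l) /\
  nrm2 leb2 (disc r) (mol r f k k l) <= l^-1 ^+ 2 * nrm2 leb2 (disc r) f.
Proof.
move=> e0 hk l0 hf; have [kk k0 _] := hk.
have ck : continuous k by exact: (kk.1 0%N).
have cm : continuous (mol r f k k l) by exact: (continuous_mol r0 kk kk (sqint_integrable r0 hf)).
have sm : sqint leb2 (disc r) (mol r f k k l) by exact: continuous_sqint2.
split => //.
pose F2 := (fun y => f y ^+ 2) \_ (disc r).
pose H (z : P * P) : \bar R := (\1_(disc r) z.1 * (F2 z.2 * tensor k k l z.1 z.2))%:E.
have mF2 : measurable_fun (setT : set P) F2.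
  by apply/(measurable_restrictT _ mD); apply: measurable_funX; exact: hf.1.
have F20 y : 0 <= F2 y by rewrite /F2 patchE; case: ifP => // _; rewrite sqr_ge0.
have t0 x y : 0 <= tensor k k l x y by rewrite mulr_ge0.
have H0 z : (0 <= H z)%E by rewrite lee_fin !mulr_ge0// indicE.
have mk : measurable_fun setT (k : measurableTypeR R -> R) by exact: continuous_measurable_fun.
have mc1 : measurable_fun (setT : set (P * P)) (fun z => k (l * z.1.1 - z.2.1)).
  apply: (measurableT_comp mk); apply: measurable_funB.
    apply: measurable_funM => //.
    exact: (measurableT_comp (@measurable_fst _ _ _ _) (@measurable_fst _ _ _ _)).
  exact: (measurableT_comp (@measurable_fst _ _ _ _) (@measurable_snd _ _ _ _)).
have mc2 : measurable_fun (setT : set (P * P)) (fun z => k (l * z.1.2 - z.2.2)).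
  apply: (measurableT_comp mk); apply: measurable_funB.
    apply: measurable_funM => //.
    exact: (measurableT_comp (@measurable_snd _ _ _ _) (@measurable_fst _ _ _ _)).
  exact: (measurableT_comp (@measurable_snd _ _ _ _) (@measurable_snd _ _ _ _)).
have mH : measurable_fun setT H.
  apply/measurable_EFinP; apply: measurable_funM.
    apply: (measurableT_comp _ (@measurable_fst _ _ _ _)).
    exact: measurable_indic.
  apply: measurable_funM; first exact: (measurableT_comp mF2 (@measurable_snd _ _ _ _)).
  exact: measurable_funM.
have [mF mG FT] := leb2_tonelli mH H0; move: mH H0 => _ H0.
rewrite -lee_fin {1}/nrm2 /Rintegral fineK; last first.
  exact: (integrable_fin_num mD (sqint_sqr sm)).
apply: (@le_trans _ _ (\int[leb2]_x \int[leb2]_y H (x, y))%E).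
  rewrite integral_mkcond; apply: ge0_le_integral.
  - exact: measurableT.
  - by move=> x _; rewrite patchE; case: ifP => // _; rewrite lee_fin sqr_ge0.
  - apply/(measurable_restrictT _ mD); apply/measurable_EFinP; apply: measurable_funX.
    exact: sm.1.
  - exact: mF.
  - move=> x _; rewrite patchE; case: ifPn => xD; last first.
      by apply: integral_ge0 => y _; exact: H0.
    have -> : (\int[leb2]_y H (x, y) =
        (\int[leb2]_(y in disc r) (f y ^+ 2 * tensor k k l x y))%:E)%E.
      rewrite /Rintegral fineK; last first.
        apply: (integrable_fin_num mD).
        exact: (@mol_integrable _ _ r0 e (fun y => f y ^+ 2) k k l x kk kk (sqint_sqr hf)).
      rewrite [RHS]integral_mkcond; apply: eq_integral => y _.
      rewrite /H /F2 indicE xD mul1r !patchE /=; case: ifP => _ //=.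
      by rewrite mul0r.
    by rewrite lee_fin; exact: (sqr_mol_le l x e0 hk hf).
rewrite FT; clear FT mF.
have -> : ((l^-1 ^+ 2 * nrm2 leb2 (disc r) f)%:E = \int[leb2]_y ((l^-1 ^+ 2)%:E * (F2 y)%:E))%E.
  rewrite ge0_integralZl//; last 3 first.
  - by apply/measurable_EFinP; exact: mF2.
  - by move=> y _; rewrite lee_fin; exact: F20.
  - by rewrite lee_fin sqr_ge0.
  rewrite EFinM; congr (_ * _)%E; rewrite /nrm2 /Rintegral fineK; last first.
    exact: (integrable_fin_num mD (sqint_sqr hf)).
  by rewrite integral_mkcond; apply: eq_integral => y _; rewrite /F2 !patchE; case: ifP.
apply: ge0_le_integral.
- exact: measurableT.
- by move=> y _; apply: integral_ge0 => x _; exact: H0.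
- exact: mG.
- by apply/measurable_EFinP; apply: measurable_funM.
- move=> y _; clear mG H0 mc1 mc2.
  have -> : (\int[leb2]_x H (x, y) = (F2 y)%:E * \int[leb2]_(x in disc r) (tensor k k l x y)%:E)%E.
    rewrite -ge0_integralZl//.
    - rewrite [RHS]integral_mkcond; apply: eq_integral => x _; rewrite /H /= indicE !patchE.
      by case: ifP => _ /=; rewrite ?mul1r ?mul0r// EFinM.
    - apply/measurable_EFinP; apply: measurable_funM.
        apply: measurable_funS (_ : measurable_fun setT _) => //; apply: continuous_measurable2.
        by apply: cont_comp ck; apply: contB; [apply: contZ; exact: continuous_fst2|exact: cont_cst].
      apply: measurable_funS (_ : measurable_fun setT _) => //; apply: continuous_measurable2.
      by apply: cont_comp ck; apply: contB; [apply: contZ; exact: continuous_snd2|exact: cont_cst].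
    - by move=> x _; rewrite lee_fin.
    - by rewrite lee_fin.
  rewrite muleC; apply: lee_wpmul2r; first by rewrite lee_fin.
  exact: (mollk_mass_x y e0 hk l0).
Qed.
End MollifierMass.

Section DominatedL2.
Context {d} {T : measurableType d} {R : realType}.
Variables (mu : {measure set T -> \bar R}) (D : set T).
Hypothesis mD : measurable D.

Lemma cvg2_dominated (f_ : nat -> T -> R) (f G : T -> R) :
  (forall n, measurable_fun D (f_ n)) -> measurable_fun D f ->
  {ae mu, forall x, D x -> f_ n x @[n --> \oo] --> f x} ->
  sqint mu D G -> (forall n x, D x -> `|f_ n x - f x| <= G x) ->
  cvg2 mu D f_ f.
Proof.
move=> mf_ mf fcvg hG dom.
pose h n x : \bar R := ((f_ n x - f x) ^+ 2)%:E.
have mh n : measurable_fun D (h n).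
  by apply/measurable_EFinP; apply: measurable_funX; exact: measurable_funB.
have ch : {ae mu, forall x, D x -> h ^~ x @ \oo --> (cst 0%E : T -> \bar R) x}.
  apply: filterS fcvg => x hx Dx; apply/fine_cvgP; split; first exact: nearW.
  have c1 : f_ n x - f x @[n --> \oo] --> f x - f x by apply: cvgB (hx Dx) (cvg_cst _).
  have -> : fine \o h ^~ x = (fun n => (f_ n x - f x) * (f_ n x - f x)).
    by apply/funext => n; rewrite /= expr2.
  have c2 : (f_ n x - f x) * (f_ n x - f x) @[n --> \oo] --> (f x - f x) * (f x - f x).
    exact: cvgM.
  by move: c2; rewrite subrr mulr0; apply.
have bh : {ae mu, forall x n, D x -> (`|h n x| <= (EFin \o (fun x => G x ^+ 2)%R) x)%E}.
  apply: aeW => x n Dx /=; rewrite lee_fin ger0_norm ?sqr_ge0//.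
  rewrite -real_normK ?num_real// lerXn2r ?nnegrE ?dom//.
  exact: le_trans (normr_ge0 _) (dom n x Dx).
have [_ _ c] := dominated_convergence mD mh (measurable_cst _) ch hG.2 bh.
rewrite integral0 in c; exact: fine_cvg c.
Qed.
End DominatedL2.

(** * Convergence of mollifications in [L2] *)

Section MollifierConvergence.
Context {R : realType}.
Notation mu := (@lebesgue_measure R).
Notation P := (measurableTypeR R * measurableTypeR R)%type.
Variables (r : R) (r0 : 0 < r).
Let mD : measurable (disc r : set P) := measurable_disc r0.
Variables (l_ e_ : nat -> R) (k_ : nat -> R -> R).
Hypothesis (l12 : forall n, 2^-1 <= l_ n) (l1 : l_ n @[n --> \oo] --> (1 : R)).
Hypothesis (e_gt0 : forall n, 0 < e_ n) (e_0 : e_ n @[n --> \oo] --> (0 : R)).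
Hypothesis (hk : forall n, mollk (e_ n) (k_ n)).
Implicit Types (f g : R * R -> R).

Local Notation M n f := (mol r f (k_ n) (k_ n) (l_ n)).
Notation sq f := (sqint leb2 (disc r) f).
Notation nrm f := (nrm2 leb2 (disc r) f).

Let l_gt0 n : 0 < l_ n.
Proof. by apply: lt_le_trans (l12 n); rewrite invr_gt0. Qed.

Lemma sqint_mol n f : sq f -> sq (M n f).
Proof. by move=> hf; have [] := nrm2_mol_le r0 (e_gt0 n) (hk n) (l_gt0 n) hf. Qed.

Lemma nrm2_mol4 n f : sq f -> nrm (M n f) <= 4 * nrm f.
Proof.
move=> hf; have [_ h] := nrm2_mol_le r0 (e_gt0 n) (hk n) (l_gt0 n) hf.
apply: le_trans h _; apply: ler_wpM2r; first exact: nrm2_ge0.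
have h2 : (l_ n)^-1 <= 2 by rewrite -[leRHS]invrK lef_pV2 ?posrE ?invr_gt0.
have h0 : 0 <= (l_ n)^-1 by rewrite invr_ge0 ltW.
by rewrite expr2 (_ : 4 = 2 * 2 :> R) ?ler_pM//; ring.
Qed.

Lemma molB n f g x : sq f -> sq g -> M n (fun y => f y - g y) x = M n f x - M n g x.
Proof.
move=> hf hg; have [kk _ _] := hk n; rewrite /mol -RintegralB//.
- by apply: eq_Rintegral => y _; rewrite mulrBl.
- exact: (mol_integrable r0 (l_ n) x kk kk (sqint_integrable r0 hf)).
- exact: (mol_integrable r0 (l_ n) x kk kk (sqint_integrable r0 hg)).
Qed.

Lemma molD n f g x : sq f -> sq g -> M n (fun y => f y + g y) x = M n f x + M n g x.
Proof.
move=> hf hg; have [kk _ _] := hk n; rewrite /mol -RintegralD//.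
- by apply: eq_Rintegral => y _; rewrite mulrDl.
- exact: (mol_integrable r0 (l_ n) x kk kk (sqint_integrable r0 hf)).
- exact: (mol_integrable r0 (l_ n) x kk kk (sqint_integrable r0 hg)).
Qed.

Lemma molZ n c f x : sq f -> M n (fun y => c * f y) x = c * M n f x.
Proof.
move=> hf; have [kk _ _] := hk n; rewrite /mol -RintegralZl//.
- by apply: eq_Rintegral => y _; rewrite mulrA.
- exact: (mol_integrable r0 (l_ n) x kk kk (sqint_integrable r0 hf)).
Qed.

(** The functions that their mollifications approximate. They form a subspace, closed in [L2]
    because the operators are uniformly bounded; it is shown to be everything by way of boxes,
    measurable sets and simple functions. *)
Definition appr f := sq f /\ cvg2 leb2 (disc r) (fun n => M n f) f.

Lemma eq_appr f g : {in disc r, f =1 g} -> appr f -> appr g.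
Proof.
move=> fg [hf c]; split; first exact: (eq_sqint mD fg hf).
rewrite /cvg2; have -> // : (fun n => nrm (fun x => M n g x - g x)) =
  (fun n => nrm (fun x => M n f x - f x)).
apply/funext => n; apply: eq_nrm2 => x xD; rewrite fg//; congr (_ - _).
by apply: eq_Rintegral => y yD; rewrite fg.
Qed.

Lemma apprD f g : appr f -> appr g -> appr (fun x => f x + g x).
Proof.
move=> [hf cf] [hg cg]; split; first exact: sqintD.
apply: (@squeeze_cvgr _ _ _ _ (cst 0) (fun n => 2 * nrm (fun x => M n f x - f x) +
   2 * nrm (fun x => M n g x - g x))).
- apply: nearW => n; rewrite nrm2_ge0 /=.
  have h1 := sqintB mD (sqint_mol n hf) hf; have h2 := sqintB mD (sqint_mol n hg) hg.
  apply: le_trans (nrm2D_le mD h1 h2); rewrite le_eqVlt; apply/orP; left; apply/eqP.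
  by apply: eq_nrm2 => x _; rewrite molD//; ring.
- exact: cvg_cst.
- have h1 : 2 * nrm (fun x => M n f x - f x) @[n --> \oo] --> 2 * (0 : R) by apply: cvgMl_tmp.
  have h2 : 2 * nrm (fun x => M n g x - g x) @[n --> \oo] --> 2 * (0 : R) by apply: cvgMl_tmp.
  by have := cvgD h1 h2; rewrite mulr0 addr0; apply.
Qed.

Lemma apprZ c f : appr f -> appr (fun x => c * f x).
Proof.
move=> [hf cf]; split; first exact: sqintZ.
rewrite /cvg2 (_ : (fun n => nrm (fun x => M n (fun y => c * f y) x - c * f x)) =
  (fun n => c ^+ 2 * nrm (fun x => M n f x - f x))).
  by rewrite -[X in _ --> X](mulr0 (c ^+ 2)); apply: cvgMl_tmp.
apply/funext => n; rewrite -(nrm2Z mD c (sqintB mD (sqint_mol n hf) hf)).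
by apply: eq_nrm2 => x _; rewrite molZ//; ring.
Qed.

Lemma apprB f g : appr f -> appr g -> appr (fun x => f x - g x).
Proof.
move=> hf hg; have := apprD hf (apprZ (-1) hg).
by apply: eq_appr => x _; rewrite mulN1r.
Qed.

Lemma appr_closed f : sq f ->
  (forall e, 0 < e -> exists2 g, appr g & nrm (fun x => f x - g x) <= e) -> appr f.
Proof.
move=> hf hc; split => //; apply/cvgrPdist_le => e e0.
(* Three terms with squared norms: [8 * (e / 24) + 4 * (e / 8) + 4 * (e / 24) = e]. *)
have [|g [hg cg] fg] := hc (e / 24); first by rewrite divr_gt0.
have hfg := sqintB mD hf hg.
move/cvgrPdist_le : cg => /(_ (e / 8) ltac:(by rewrite divr_gt0)).
apply: filterS => n; rewrite !sub0r !normrN !ger0_norm ?nrm2_ge0// => hn.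
have a1 := sqint_mol n hfg; have a2 := sqintB mD (sqint_mol n hg) hg.
have a3 := sqintB mD hg hf.
have -> : nrm (fun x => M n f x - f x) =
   nrm (fun x => M n (fun y => f y - g y) x + ((M n g x - g x) + (g x - f x))).
  by apply: eq_nrm2 => x _; rewrite molB//; ring.
apply: le_trans (nrm2D_le mD a1 (sqintD mD a2 a3)) _.
have b1 := nrm2_mol4 n hfg; have b2 := nrm2D_le mD a2 a3.
have b3 : nrm (fun x => g x - f x) = nrm (fun x => f x - g x) by rewrite nrm2_subC.
move: fg hn b1 b2; rewrite b3.
move: (nrm (fun x => f x - g x)) (nrm _) (nrm _) (nrm (fun x => M n g x - g x)) => A B C E.
lra.
Qed.

Lemma appr_dominated (f_ : nat -> R * R -> R) f G : (forall n, appr (f_ n)) ->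
  sq f -> (forall x, disc r x -> f_ n x @[n --> \oo] --> f x) ->
  sq G -> (forall n x, disc r x -> `|f_ n x - f x| <= G x) -> appr f.
Proof.
move=> hf_ hf c hG dom; apply: appr_closed => // e e0.
have : cvg2 leb2 (disc r) f_ f.
  apply: (@cvg2_dominated _ _ _ leb2 (disc r : set P) mD f_ f G) => //.
  - by move=> n; exact: (hf_ n).1.1.
  - exact: hf.1.
  - exact: aeW.
move/cvgrPdist_le => /(_ e e0) [N _ hN]; exists (f_ N) => //.
have := hN N (leqnn N); rewrite /= sub0r normrN ger0_norm ?nrm2_ge0//.
by rewrite nrm2_subC.
Qed.

Lemma mol_locconst f x dl : sq f -> 0 < dl ->
  (forall y : R * R, `|x.1 - y.1| < dl -> `|x.2 - y.2| < dl -> disc r y /\ f y = f x) ->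
  \forall n \near \oo, M n f x = f x.
Proof.
move=> hf dl0 hx; have d2 : 0 < dl / 2 by rewrite divr_gt0.
have near_l c : \forall n \near \oo, `|c - l_ n * c| < dl / 2.
  have : l_ n * c @[n --> \oo] --> 1 * c by apply: cvgMr_tmp.
  by rewrite mul1r => /cvgrPdist_lt; exact.
have near_e : \forall n \near \oo, e_ n < dl / 2.
  move/cvgrPdist_lt : e_0 => /(_ _ d2); apply: filterS => n.
  by rewrite sub0r normrN gtr0_norm.
near=> n.
have n1 : `|x.1 - l_ n * x.1| < dl / 2 by near: n; exact: near_l.
have n2 : `|x.2 - l_ n * x.2| < dl / 2 by near: n; exact: near_l.
have n3 : e_ n < dl / 2 by near: n.
have tri (a b c : R) : `|a - b| < dl / 2 -> `|b - c| <= e_ n -> `|a - c| < dl.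
  move=> h1 h2; have -> : a - c = (a - b) + (b - c) by ring.
  by apply: le_lt_trans (ler_normD _ _) _; lra.
have [_ mass1] := mollk_mass_y r0 (l_ n) x (e_gt0 n) (hk n).
have [kk k0 _] := hk n.
transitivity (f x * \int[leb2]_(y in disc r) tensor (k_ n) (k_ n) (l_ n) x y); last first.
  rewrite mass1 ?mulr1// => y h1 h2.
  by have [] := hx y (tri _ _ _ n1 h1) (tri _ _ _ n2 h2).
rewrite -RintegralZl//; last first.
  by apply: (continuous_integrable2 r0); apply: continuous_tensor; exact: (kk.1 0%N).
apply: eq_Rintegral => y _.
have [h1|h1] := leP `|l_ n * x.1 - y.1| (e_ n); last first.
  by rewrite /tensor kk.2 ?mul0r ?mulr0// ltW.
have [h2|h2] := leP `|l_ n * x.2 - y.2| (e_ n); last first.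
  by rewrite /tensor (kk.2 (_ - y.2)) ?mulr0 ?mulr0// ltW.
by have [_ ->] := hx y (tri _ _ _ n1 h1) (tri _ _ _ n2 h2).
Unshelve. all: by end_near. Qed.

Lemma sqint_indic (A : set P) : measurable A -> sq (\1_A : P -> R).
Proof.
move=> mA; apply: (@bounded_sqint2 _ _ _ 1) => //.
by move=> x _; rewrite indicE; case: (_ \in _); rewrite ?normr1 ?normr0.
Qed.

(** At a point of local constancy the mollified values are eventually exact. They are at most 1 in
    modulus, so dominated convergence applies with the constant 2. *)
Lemma appr_indic_locconst (A : set P) : measurable A ->
  {ae leb2, forall x : P, disc r x -> exists2 dl, 0 < dl & forall y : R * R,
     `|x.1 - y.1| < dl -> `|x.2 - y.2| < dl -> (\1_A : P -> R) y = (\1_A : P -> R) x} ->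
  appr (\1_A : P -> R).
Proof.
move=> mA hA; have hf := sqint_indic mA; split => //.
have mol1 n x : `|M n (\1_A : P -> R) x| <= 1.
  have [kk k0 _] := hk n.
  have [/andP[m0 m1] _] := mollk_mass_y r0 (l_ n) x (e_gt0 n) (hk n).
  rewrite -(@ler_pXn2r _ 2)// ?nnegrE// expr1n real_normK ?num_real//.
  apply: le_trans (sqr_mol_le r0 (l_ n) x (e_gt0 n) (hk n) hf) (le_trans _ m1).
  apply: le_Rintegral => //.
  - exact: (@mol_integrable _ _ r0 (e_ n) (fun y => (\1_A : P -> R) y ^+ 2) (k_ n) (k_ n) (l_ n) x kk kk (sqint_sqr hf)).
  - by apply: (continuous_integrable2 r0); apply: continuous_tensor; exact: (kk.1 0%N).
  - move=> y _; rewrite indicE; case: (_ \in _); first by rewrite expr1n mul1r.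
    by rewrite expr0n mul0r mulr_ge0.
have h1 : sq (cst 2) by apply: continuous_sqint2 => //; exact: cont_cst.
apply: (@cvg2_dominated _ _ _ leb2 (disc r : set P) mD (fun n => M n (\1_A : P -> R)) _ (cst 2)) => //.
- by move=> n; exact: (sqint_mol n hf).1.
- apply: filterS hA => x hx xD; have [dl dl0 hdl] := hx xD.
  have [d2 /= d20 hd2] : exists2 d2, 0 < d2 & forall y : R * R, `|x.1 - y.1| < d2 -> `|x.2 - y.2| < d2 -> disc r y.
    have [d2 /= d20 hd2] := (nbhs_ballP _ _).1 (open_nbhs_nbhs (conj (open_disc r0) xD)).
    by exists d2 => // y y1 y2; apply: hd2; split.
  apply: cvg_near_cst.
  apply: (@mol_locconst _ _ (Num.min dl d2)) => //; first by rewrite lt_min dl0.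
  by move=> y; rewrite !lt_min => /andP[a1 a2] /andP[b1 b2]; split; [exact: hd2|exact: hdl].
- move=> n x _; apply: le_trans (ler_normB _ _) _; rewrite -[cst 2 x]/(2 : R).
  have := mol1 n x; rewrite indicE; case: (_ \in _); rewrite ?normr1 ?normr0; lra.
Qed.

Lemma null_line1 (a : R) : leb2.-negligible [set x : P | x.1 = a].
Proof.
exists ([set a] `*` setT); split.
- by apply: measurableX => //; exact: measurable_set1.
- apply: (etrans (product_measure1E (@lebesgue_measure R) (@lebesgue_measure R)
    (measurable_set1 a) measurableT)).
  exact: (etrans (congr1 (fun z : \bar R => (z * _)%E) (lebesgue_measure_set1 a)) (mul0e _)).
- by move=> x /= ->.
Qed.

Lemma null_line2 (a : R) : leb2.-negligible [set x : P | x.2 = a].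
Proof.
exists (setT `*` [set a]); split.
- by apply: measurableX => //; exact: measurable_set1.
- apply: (etrans (product_measure1E (@lebesgue_measure R) (@lebesgue_measure R)
    measurableT (measurable_set1 a))).
  exact: (etrans (congr1 (fun z : \bar R => (_ * z)%E) (lebesgue_measure_set1 a)) (mule0 _)).
- by move=> x /= ->.
Qed.

Lemma ltr_side (a x y : R) : `|x - y| < `|x - a| -> (a < y) = (a < x) /\ (y <= a) = (x <= a).
Proof.
move=> h; have [ax|xa] := ltP a x.
  have xy : a < y by move: h; rewrite (gtr0_norm (_ : 0 < x - a)) ?subr_gt0// ltr_norml => /andP[_]; lra.
  by rewrite xy; split => //; apply/negbTE; rewrite -ltNge.
have [ya|ay] := leP y a; first by split.
by move: h; rewrite (ler0_norm (_ : x - a <= 0)) ?subr_le0// ltr_norml => /andP[h1 _]; exfalso; lra.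
Qed.

Lemma appr_box (a b c d : R) : appr (\1_(`]a, b]%classic `*` `]c, d]%classic) : P -> R).
Proof.
apply: appr_indic_locconst; first by apply: measurableX; exact: measurable_itv.
have : {ae leb2, forall x : P, [/\ x.1 <> a, x.1 <> b, x.2 <> c & x.2 <> d]}.
  have n1 := null_line1 a; have n2 := null_line1 b; have n3 := null_line2 c; have n4 := null_line2 d.
  have := negligibleU (negligibleU n1 n2) (negligibleU n3 n4).
  apply: negligibleS => x /= h.
  apply: contrapT => h2; apply: h; split => e; apply: h2; rewrite e.
  - by left; left.
  - by left; right.
  - by right; left.
  - by right; right.
apply: filterS => x [/eqP xa /eqP xb /eqP xc /eqP xd] _.
have p (u v : R) : u != v -> 0 < `|u - v| by rewrite normr_gt0 subr_eq0.
exists (Num.min (Num.min `|x.1 - a| `|x.1 - b|) (Num.min `|x.2 - c| `|x.2 - d|)).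
  by rewrite !lt_min !p.
move=> y; rewrite !lt_min => /andP[/andP[h1 h2] _] /andP[_ /andP[h3 h4]].
rewrite !indicE; congr (nat_of_bool _)%:R.
have [s1 _] := ltr_side h1; have [_ s2] := ltr_side h2.
have [s3 _] := ltr_side h3; have [_ s4] := ltr_side h4.
by apply/idP/idP => /set_mem[/=]; rewrite !in_itv /= => u v; apply/mem_set; split;
  rewrite /= in_itv /=; [rewrite -s1 -s2|rewrite -s3 -s4|rewrite s1 s2|rewrite s3 s4].
Qed.

Definition boxes : set (set (R * R)) :=
  [set A | exists a b c d : R, A = `]a, b]%classic `*` `]c, d]%classic].

Lemma measurable_boxes : @measurable _ P = <<s boxes >>.
Proof.
apply/seteqP; split; last first.
  apply: smallest_sub; first exact: sigma_algebra_measurable.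
  by move=> _ [a [b [c [d ->]]]]; apply: measurableX; exact: measurable_itv.
pose Q := g_sigma_algebraType boxes.
have mb a b c d : measurable (`]a, b]%classic `*` `]c, d]%classic : set Q).
  by apply: sub_sigma_algebra; exists a, b, c, d.
have bound (s u : R) : exists n : nat, s <= n%:R /\ (- n%:R < u /\ u <= n%:R).
  exists (Num.bound (`|s| + `|u|)).
  have := archi_boundP (addr_ge0 (normr_ge0 s) (normr_ge0 u)).
  have := ler_norm s; have := ler_norm u; have := ler_norm (- u); rewrite normrN.
  have := normr_ge0 s; have := normr_ge0 u.
  by move: (`|s|) (`|u|) (_%:R) => A B C *; repeat split; lra.
have m1 : measurable_fun setT (fst : Q -> measurableTypeR R).
  apply: (measurability _ (RGenOInfty.measurableE R)) => _ [_ [a ->] <-]; rewrite setTI.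
  have -> : fst @^-1` `]a, +oo[%classic =
      \bigcup_n (`]a, n%:R]%classic `*` `]- n%:R, n%:R]%classic) :> set Q.
    apply/seteqP; split => [[s u]|[s u] [n _ [/= + _]]] /=; rewrite !in_itv /= andbT.
      move=> hs; have [n [h1 [h2 h3]]] := bound s u.
      by exists n => //; split; rewrite /= in_itv /=; apply/andP.
    by case/andP.
  by apply: bigcup_measurable => n _; exact: mb.
have m2 : measurable_fun setT (snd : Q -> measurableTypeR R).
  apply: (measurability _ (RGenOInfty.measurableE R)) => _ [_ [a ->] <-]; rewrite setTI.
  have -> : snd @^-1` `]a, +oo[%classic =
      \bigcup_n (`]- n%:R, n%:R]%classic `*` `]a, n%:R]%classic) :> set Q.
    apply/seteqP; split => [[s u]|[s u] [n _ [/= _]]] /=; rewrite !in_itv /= andbT.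
      move=> hs; have [n [h1 [h2 h3]]] := bound u s.
      by exists n => //; split; rewrite /= in_itv /=; apply/andP.
    by case/andP.
  by apply: bigcup_measurable => n _; exact: mb.
rewrite measurable_prod_measurableType; apply: smallest_sub.
  exact: smallest_sigma_algebra.
move=> _ [A mA [B mB <-]].
have -> : A `*` B = (fst @^-1` A) `&` (snd @^-1` B) :> set Q by [].
apply: (@measurableI _ Q).
  by rewrite -[X in measurable X]setTI; exact: m1.
by rewrite -[X in measurable X]setTI; exact: m2.
Qed.

Lemma boxes_setI : setI_closed boxes.
Proof.
move=> _ _ [a [b [c [d ->]]]] [a' [b' [c' [d' ->]]]].
exists (Num.max a a'), (Num.min b b'), (Num.max c c'), (Num.min d d').
apply/seteqP; split => -[s u].
  move=> [[/= + +] [/= + +]]; rewrite !in_itv /= => /andP[? ?] /andP[? ?] /andP[? ?] /andP[? ?].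
  by rewrite !gt_max !le_min; split; apply/andP; split; apply/andP.
move=> [/=]; rewrite !in_itv /= !gt_max !le_min.
by move=> /andP[/andP[? ?] /andP[? ?]] /andP[/andP[? ?] /andP[? ?]];
  split; split; apply/andP.
Qed.

Lemma appr_sum (I : Type) (s : seq I) (F : I -> R * R -> R) : (forall i, appr (F i)) ->
  appr (fun x => \sum_(i <- s) F i x).
Proof.
move=> hF; elim: s => [|i s ih].
  have := apprZ 0 (appr_box 0 0 0 0); apply: eq_appr => x _.
  by rewrite big_nil mul0r.
have := apprD (hF i) ih; apply: eq_appr => x _; first by rewrite big_cons.
Qed.

(** Dynkin's lemma on the half-open boxes, a generating family closed under intersection.
    Complements are differences; disjoint unions are dominated limits of partial sums. *)
Lemma appr_indic (A : set P) : measurable A -> appr (\1_A : P -> R).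
Proof.
move=> mA; move: (mA); rewrite measurable_boxes; move: A {mA}.
have c2 : sq (cst 2) by apply: continuous_sqint2 => //; exact: cont_cst.
have aT : appr (\1_(setT : set P) : P -> R).
  have e (z : P) : (\1_(setT : set P) : P -> R) z = 1 by rewrite indicE in_setT.
  apply: appr_indic_locconst => //; apply: aeW => x _; exists 1; first exact: ltr01.
  by move=> y _ _; rewrite (e x) (e y).
apply: (@dynkin_induction _ P boxes (fun A => appr (\1_A : P -> R))).
- exact: measurable_boxes.
- exact: boxes_setI.
- exact: aT.
- by move=> _ [a [b [c [d ->]]]]; exact: appr_box.
- move=> A mA hA; have := apprB aT hA; apply: eq_appr => x _.
  by rewrite !indicE in_setT in_setC; case: (x \in A); rewrite ?subrr ?subr0.
- move=> F mF tF hF.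
  have mU : measurable (\bigcup_k F k) by exact: bigcup_measurable.
  apply: (@appr_dominated (fun n x => \sum_(i <- iota 0 n) (\1_(F i) : P -> R) x) _ (cst 2)) => //.
  + by move=> n; exact: appr_sum.
  + exact: sqint_indic.
  + move=> x _; apply: cvg_near_cst; rewrite indicE.
    have [/set_mem [k _ Fkx]|hx] := boolP (x \in \bigcup_k F k).
      near=> n; have kn : (k < n)%N by near: n; exists k.+1.
      have e i : (\1_(F i) : P -> R) x = (i == k)%:R.
        rewrite indicE; congr (nat_of_bool _)%:R.
        apply/idP/eqP => [/set_mem Fix|->]; last exact: mem_set.
        by apply: (tF i k) => //; exists x.
      under eq_bigr do rewrite e.
      rewrite -(subn0 n) -/(index_iota 0 n) big_mkord.
      rewrite (bigD1 (Ordinal kn))//= eqxx big1 ?addr0// => j; rewrite -val_eqE /=.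
      by move=> /negbTE ->.
    near=> n; rewrite big1// => i _; rewrite indicE; case: (boolP (x \in F i)) => // /set_mem Fix.
    by move: hx; rewrite mem_set//; exists i.
  + move=> n x _; rewrite -[cst 2 x]/(2 : R).
    have h1 : 0 <= \sum_(i <- iota 0 n) (\1_(F i) : P -> R) x <= 1.
      rewrite sumr_ge0//=.
      have [[i Fix]|no] := pselect (exists i, F i x).
        rewrite -(subn0 n) -/(index_iota 0 n) big_mkord.
        have e j : (\1_(F j) : P -> R) x = (j == i)%:R.
          rewrite indicE; congr (nat_of_bool _)%:R.
          apply/idP/eqP => [/set_mem Fjx|->]; last exact: mem_set.
          by apply: (tF j i) => //; exists x.
        under eq_bigr do rewrite e.
        have [ni|ni] := ltnP i n.
          by rewrite (bigD1 (Ordinal ni))//= eqxx big1 ?addr0// => j; rewrite -val_eqE /= => /negbTE ->.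
        rewrite big1// => j _; case: eqP => // ji; have := ltn_ord j.
        by rewrite ji ltnNge ni.
      rewrite big1// => i _; rewrite indicE; case: (boolP (x \in F i)) => // /set_mem Fix.
      by exfalso; apply: no; exists i.
    have h2 : 0 <= (\1_(\bigcup_k F k) : P -> R) x <= 1 by rewrite indicE; case: (_ \in _); rewrite ?lexx ?ler01.
    move: h1 h2; move: (\sum_(i <- iota 0 n) _) ((\1_(\bigcup_k F k) : P -> R) x) => A B /andP[? ?] /andP[? ?].
    by rewrite ler_norml; apply/andP; split; lra.
Unshelve. all: by end_near. Qed.

Import HBNNSimple.

Lemma appr_nnsfun (h : {nnsfun P >-> R}) : appr (h : P -> R).
Proof.
pose s := finmap.enum_fset (fset_set (range h)).
have := @appr_sum R s (fun y x => y * (\1_(h @^-1` [set y]) : P -> R) x) _.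
have hi y : appr (fun x => y * (\1_(h @^-1` [set y]) : P -> R) x).
  by apply: apprZ; apply: appr_indic; exact: measurable_funPTI.
move=> /(_ hi); apply: eq_appr => x _.
by rewrite [RHS]fimfunE fsbig_finite.
Qed.

Lemma appr_ge0 f : sq f -> (forall x, 0 <= f x) -> appr f.
Proof.
move=> hf f0.
have mf : measurable_fun (disc r : set P) (EFin \o f) by apply/measurable_EFinP; exact: hf.1.
have f0' (x : P) : disc r x -> (0%R <= (EFin \o f) x)%E by move=> _; rewrite lee_fin.
pose g n := nnsfun_approx mD mf n.
have gle n x : disc r x -> 0 <= g n x <= f x.
  move=> xD; rewrite fun_ge0 /= -lee_fin /g nnsfun_approxE.
  exact: (le_approx n f0' xD).
apply: (@appr_dominated (fun n => g n) _ f) => //.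
- by move=> n; exact: appr_nnsfun.
- move=> x xD; have := cvg_nnsfun_approx mD mf f0' xD.
  by move/fine_cvgP => [_].
- move=> n x xD; have /andP[h1 h2] := gle n x xD.
  by rewrite distrC ger0_norm ?subr_ge0// lerBlDr lerDl.
Qed.

Theorem mollifier_cvg f : sq f -> cvg2 leb2 (disc r) (fun n => M n f) f.
Proof.
move=> hf; suff [] : appr f by [].
have sp : sq (fun x => Num.max (f x) 0).
  split; first by apply: measurable_maxr => //; exact: hf.1.
  apply: le_integrable hf.2 => //.
    apply/measurable_EFinP; apply: measurable_funX; apply: measurable_maxr => //.
    exact: hf.1.
  move=> x _ /=; rewrite lee_fin !ger0_norm ?sqr_ge0//.
  by case: (leP (f x) 0) => h; rewrite ?expr0n/= ?sqr_ge0.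
have sn : sq (fun x => Num.max (- f x) 0).
  have mN : measurable_fun (disc r : set P) (fun x => - f x) by apply: measurableT_comp => //; exact: hf.1.
  split; first exact: measurable_maxr.
  apply: le_integrable hf.2 => //.
    by apply/measurable_EFinP; apply: measurable_funX; apply: measurable_maxr.
  move=> x _ /=; rewrite lee_fin !ger0_norm ?sqr_ge0//.
  by case: (leP (- f x) 0) => h; rewrite ?sqrrN ?expr0n/= ?sqr_ge0.
have p0 x : 0 <= Num.max (f x) 0 by rewrite le_max lexx orbT.
have n0 x : 0 <= Num.max (- f x) 0 by rewrite le_max lexx orbT.
have := apprB (appr_ge0 sp p0) (appr_ge0 sn n0).
apply: eq_appr => x _; case: (leP (f x) 0) => h1; case: (leP (- f x) 0) => h2; lra.
Qed.
End MollifierConvergence.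

(** * Weak derivatives *)

Section Sobolev.
Context {R : realType}.
Notation P := (measurableTypeR R * measurableTypeR R)%type.
Variables (r : R) (r0 : 0 < r).
Let mD : measurable (disc r : set P) := measurable_disc r0.
Implicit Types (f g u v phi : R * R -> R) (x : R * R).
Notation sq f := (sqint leb2 (disc r) f).
Notation nrm f := (nrm2 leb2 (disc r) f).
Notation "'I' f" := (\int[leb2]_(x in disc r) f x) (at level 10).

Lemma L2P f : L2 (disc r) f <-> sq f.
Proof. exact: (Lfun2P leb2 mD f). Qed.

Lemma L2dist_cvgP (f_ : nat -> R * R -> R) g : (forall n, sq (f_ n)) -> sq g ->
  (L2dist (disc r) (f_ n) g @[n --> \oo] --> 0%E) <-> cvg2 leb2 (disc r) f_ g.
Proof. exact: (Lnorm2_cvgP mD). Qed.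

Lemma Ck_tensor n (k1 k2 : R -> R) : (forall j, Ck1 j k1) -> (forall j, Ck1 j k2) ->
  Ck n (fun x : R * R => k1 x.1 * k2 x.2).
Proof.
elim: n k1 k2 => [|n ih] k1 k2 h1 h2 /=.
  apply: contM; first exact: cont_comp (@continuous_fst2 R) (h1 0%N).
  exact: cont_comp (@continuous_snd2 R) (h2 0%N).
have d1 (x : R * R) : is_derive x.1 1 (fun t => k1 t * k2 x.2) (derive1 k1 x.1 * k2 x.2).
  have := is_deriveMR (Ck1_is_derive (h1 1%N) x.1) (is_derive_cstR (k2 x.2) x.1).
  by rewrite mulr0 addr0.
have d2 (x : R * R) : is_derive x.2 1 (fun t => k1 x.1 * k2 t) (k1 x.1 * derive1 k2 x.2).
  have := is_deriveMR (is_derive_cstR (k1 x.1) x.2) (Ck1_is_derive (h2 1%N) x.2).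
  by rewrite mul0r add0r.
split.
- by move=> [s t]; split; [apply/derivable_e1E; have [] := d1 (s, t)|apply/derivable_e2E; have [] := d2 (s, t)].
- have := ih (derive1 k1) k2 (fun j => (h1 j.+1).2) h2; congr (Ck n _).
  by apply/funext => -[s t]; rewrite derive_e1E; have [_ ->] := d1 (s, t).
- have := ih k1 (derive1 k2) h1 (fun j => (h2 j.+1).2); congr (Ck n _).
  by apply/funext => -[s t]; rewrite derive_e2E; have [_ ->] := d2 (s, t).
Qed.

Lemma smooth_tensor e (k1 k2 : R -> R) l x : kern e k1 -> kern e k2 -> smooth (tensor k1 k2 l x).
Proof.
move=> h1 h2 n; have a1 j : Ck1 j (fun t => 1 * k1 (-1 * t + l * x.1)) by apply: Ck1_affine; exact: h1.1.
have a2 j : Ck1 j (fun t => 1 * k2 (-1 * t + l * x.2)) by apply: Ck1_affine; exact: h2.1.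
have := Ck_tensor n a1 a2; congr (Ck n _); apply/funext => y; rewrite /tensor.
by rewrite !mul1r !mulN1r addrC [- y.2 + _]addrC.
Qed.

Lemma test_function_tensor e (k1 k2 : R -> R) l x : kern e k1 -> kern e k2 ->
  (forall y : R * R, `|l * x.1 - y.1| <= e -> `|l * x.2 - y.2| <= e -> disc r y) ->
  test_function (disc r) (tensor k1 k2 l x).
Proof.
move=> h1 h2 hb.
pose K : set (R * R) := `[l * x.1 - e, l * x.1 + e]%classic `*` `[l * x.2 - e, l * x.2 + e]%classic.
have cK : compact K by apply: compact_setX; exact: segment_compact.
have clK : closed K by apply: compact_closed => //; exact: norm_hausdorff.
have sub : closure [set y | tensor k1 k2 l x y != 0] `<=` K.
  apply: (subset_trans (closureS _ : _ `<=` closure K)); last by move: clK; rewrite closure_id => <-.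
  move=> y /= hy; rewrite /K /=; split; rewrite /= in_itv /=; apply/andP.
    have : `|l * x.1 - y.1| <= e.
      by rewrite leNgt; apply/negP => /ltW h; move: hy; rewrite /tensor h1.2 ?mul0r ?eqxx.
    by rewrite ler_norml => /andP[? ?]; split; lra.
  have : `|l * x.2 - y.2| <= e.
    by rewrite leNgt; apply/negP => /ltW h; move: hy; rewrite /tensor (h2.2 (_ - y.2)) ?mulr0 ?eqxx.
  by rewrite ler_norml => /andP[? ?]; split; lra.
split.
- exact: smooth_tensor h1 h2.
- by apply: (subclosed_compact _ cK) => //; exact: closed_closure.
- move=> y /sub [] /=; rewrite !in_itv /= => /andP[? ?] /andP[? ?].
  by apply: hb; rewrite ler_norml; apply/andP; split; lra.
Qed.

Lemma derive_tensor (k1 k2 : R -> R) e l x y : kern e k1 -> kern e k2 ->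
  'D_e1 (tensor k1 k2 l x) y = - tensor (derive1 k1) k2 l x y /\
  'D_e2 (tensor k1 k2 l x) y = - tensor k1 (derive1 k2) l x y.
Proof.
move=> h1 h2; case: y => s t; split.
  rewrite derive_e1E /tensor /=.
  have d := @is_derive_compR R k1 (fun s => l * x.1 - s) s _ _ (Ck1_is_derive (h1.1 1%N) _) (is_derive_subl (l * x.1) s).
  have [_ ->] := is_deriveMR d (is_derive_cstR (k2 (l * x.2 - t)) s).
  by rewrite mulr0 addr0 mulrN1 mulNr.
rewrite derive_e2E /tensor /=.
have d := @is_derive_compR R k2 (fun s => l * x.2 - s) t _ _ (Ck1_is_derive (h2.1 1%N) _) (is_derive_subl (l * x.2) t).
have [_ ->] := is_deriveMR (is_derive_cstR (k1 (l * x.1 - s)) t) d.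
by rewrite mul0r add0r mulrN1 mulrN.
Qed.

(** A square of half side [e] has Euclidean radius [sqrt 2 * e], which the margin [2 * e] covers.
    The computation is carried out on squares of norms. *)
Lemma shrink_box l e x : 0 < l -> 0 < e -> l * r + 2 * e <= r -> disc r x ->
  forall y : R * R, `|l * x.1 - y.1| <= e -> `|l * x.2 - y.2| <= e -> disc r y.
Proof.
move=> l0 e0 le xD y; rewrite !ler_norml => /andP[a1 a2] /andP[b1 b2].
move/(disc_sqn r0): xD => xD; apply/(disc_sqn r0); move: xD; rewrite /sqn => xD.
have bd (s t : R) : s ^+ 2 + t ^+ 2 < r ^+ 2 -> - r < s < r.
  move=> h; rewrite -ltr_norml -(@ltr_pXn2r _ 2)// ?nnegrE ?(ltW r0)// real_normK ?num_real//.
  by have := sqr_ge0 t; lra.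
have /andP[c1 c2] := bd _ _ xD; have /andP[d1 d2] : - r < x.2 < r by apply: (bd _ x.1); rewrite addrC.
have sq_le (s y' : R) : - e <= l * s - y' -> l * s - y' <= e -> - r < s -> s < r ->
    y' ^+ 2 <= l ^+ 2 * s ^+ 2 + 2 * l * r * e + e ^+ 2.
  move=> h1 h2 h3 h4; set d := y' - l * s; have -> : y' = l * s + d by rewrite /d; ring.
  have hd1 : - e <= d by rewrite /d; lra.
  have hd2 : d <= e by rewrite /d; lra.
  have q1 : d ^+ 2 <= e ^+ 2 by nra.
  have q2 : s * d <= r * e by nra.
  have q3 : l * (s * d) <= l * (r * e) by apply: ler_wpM2l => //; exact: ltW.
  by rewrite sqrrD; nra.
have s1 := sq_le _ _ a1 a2 c1 c2; have s2 := sq_le _ _ b1 b2 d1 d2.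
have l2 : 0 < l ^+ 2 by rewrite exprn_gt0.
have m : l ^+ 2 * (x.1 ^+ 2 + x.2 ^+ 2) < l ^+ 2 * r ^+ 2 by rewrite ltr_pM2l.
have lr : 0 < l * r by rewrite mulr_gt0.
have t : (l * r + 2 * e) ^+ 2 <= r ^+ 2.
  by rewrite ler_pXn2r ?nnegrE ?(ltW r0)// addr_ge0 ?(ltW lr)// mulr_ge0// ltW.
have e2 : 0 < e ^+ 2 by rewrite exprn_gt0.
have t' : l ^+ 2 * r ^+ 2 + 4 * l * r * e + 4 * e ^+ 2 <= r ^+ 2.
  by apply: le_trans t; rewrite le_eqVlt; apply/orP; left; apply/eqP; ring.
move: m; rewrite mulrDr => m.
move: s1 s2 m t' e2.
move: (l ^+ 2 * x.1 ^+ 2) (l ^+ 2 * x.2 ^+ 2) (l ^+ 2 * r ^+ 2) (y.1 ^+ 2) (y.2 ^+ 2) (e ^+ 2) (r ^+ 2) => A B C D E F G.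
have -> : 2 * l * r * e = l * r * e * 2 by ring.
have -> : 4 * l * r * e = l * r * e * 4 by ring.
by move: (l * r * e) => H; lra.
Qed.

(** The shift by 2 keeps [lseq] at least [1 / 2], and the factor [r / 4] in [eseq] gives
    [lseq n * r + 2 * eseq n <= r], the condition of [shrink_box]. *)
Definition lseq (n : nat) : R := 1 - n.+2%:R^-1.
Definition eseq (n : nat) : R := r / 4 * n.+2%:R^-1.

Lemma n2_bounds n : 0 < n.+2%:R^-1 :> R /\ n.+2%:R^-1 <= 2^-1 :> R.
Proof. by split; [rewrite invr_gt0|rewrite lef_pV2 ?posrE// ler_nat]. Qed.

Lemma cvg_n2 : n.+2%:R^-1 @[n --> \oo] --> (0 : R).
Proof. by have := @cvg_harmonic R; rewrite -(cvg_shiftS (@harmonic R)). Qed.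

Lemma lseq_ge n : 2^-1 <= lseq n.
Proof. by have [_ h] := n2_bounds n; rewrite /lseq; move: (n.+2%:R^-1) h => q h; lra. Qed.

Lemma lseq_cvg : lseq n @[n --> \oo] --> (1 : R).
Proof.
have h : lseq n @[n --> \oo] --> (1 - 0 : R) by apply: cvgB cvg_n2; exact: cvg_cst.
by move: h; rewrite subr0; apply.
Qed.

Lemma eseq_gt0 n : 0 < eseq n.
Proof. by have [h _] := n2_bounds n; rewrite mulr_gt0// divr_gt0. Qed.

Lemma eseq_cvg : eseq n @[n --> \oo] --> (0 : R).
Proof.
have h : eseq n @[n --> \oo] --> (r / 4 * 0 : R) by apply: cvgMl_tmp; exact: cvg_n2.
by move: h; rewrite mulr0; apply.
Qed.

Definition kseq (n : nat) : R -> R := xget (fun=> 0) [set k | mollk (eseq n) k].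

Lemma kseqP n : mollk (eseq n) (kseq n).
Proof. by have [k hk] := exists_mollk (eseq_gt0 n); rewrite /kseq; exact: (xgetPex _ (ex_intro _ k hk)). Qed.

Definition smoothing u n := mol r u (kseq n) (kseq n) (lseq n).

Lemma smoothing_cvg u : sq u -> cvg2 leb2 (disc r) (smoothing u) u.
Proof. exact: (mollifier_cvg r0 lseq_ge lseq_cvg eseq_gt0 eseq_cvg kseqP). Qed.

Lemma sqint_smoothing u n : sq u -> sq (smoothing u n).
Proof. exact: (sqint_mol r0 lseq_ge eseq_gt0 kseqP). Qed.

Lemma smooth_smoothing u n : sq u -> smooth (smoothing u n).
Proof.
move=> hu; have [kk _ _] := kseqP n.
exact: (smooth_mol r0 (lseq n) kk kk (sqint_integrable r0 hu)).
Qed.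

Lemma smoothing_box n x : disc r x ->
  forall y : R * R, `|lseq n * x.1 - y.1| <= eseq n -> `|lseq n * x.2 - y.2| <= eseq n -> disc r y.
Proof.
apply: shrink_box; [|exact: eseq_gt0|].
  by apply: lt_le_trans (lseq_ge n); rewrite invr_gt0.
have [h _] := n2_bounds n; rewrite /lseq /eseq; move: (n.+2%:R^-1) h => q h.
by have := mulr_gt0 r0 h; nra.
Qed.

Lemma test_smoothing n x : disc r x -> test_function (disc r) (tensor (kseq n) (kseq n) (lseq n) x).
Proof.
move=> xD; have [kk _ _] := kseqP n.
exact: (test_function_tensor kk kk (smoothing_box xD)).
Qed.

(** The kernels centred at points of the disc are themselves test functions, so every smoothing of
    [h] vanishes there; but the smoothings converge to [h]. *)
Lemma fundamental_lemma h : sq h -> (forall phi, test_function (disc r) phi ->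
  \int[leb2]_(x in disc r) (h x * phi x) = 0) -> nrm h = 0.
Proof.
move=> hh h0; have := smoothing_cvg hh; rewrite /cvg2.
have -> : (fun n => nrm (fun x => smoothing h n x - h x)) = (fun=> nrm h).
  apply/funext => n.
  transitivity (nrm (fun x => (-1) * h x)); last by rewrite nrm2Z// sqrrN expr1n mul1r.
  apply: eq_nrm2 => x /set_mem xD.
  by rewrite /smoothing /mol h0 ?sub0r ?mulN1r//; exact: test_smoothing.
by move=> c; apply: (cvg_unique _ (cvg_cst _) c).
Qed.

Lemma test_continuous phi : test_function (disc r) phi -> continuous phi.
Proof. by case=> sp _ _; exact: (sp 0%N). Qed.

Lemma weak_deriv_unique e u g1 g2 : is_weak_deriv (disc r) e u g1 ->
  is_weak_deriv (disc r) e u g2 -> nrm (fun x => g1 x - g2 x) = 0.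
Proof.
move=> [/L2P s1 h1] [/L2P s2 h2]; apply: fundamental_lemma; first exact: sqintB.
move=> phi tp; have sp := continuous_sqint2 r0 (test_continuous tp).
rewrite -[LHS]/(ip leb2 (disc r) (fun x => g1 x - g2 x) phi) ipBl// /ip.
by apply/eqP; rewrite subr_eq0 -eqr_opp -h1// -h2.
Qed.

Lemma wDP e u g : is_weak_deriv (disc r) e u g ->
  is_weak_deriv (disc r) e u (wD (disc r) e u) /\ nrm (fun x => wD (disc r) e u x - g x) = 0.
Proof.
move=> h; have h' : is_weak_deriv (disc r) e u (wD (disc r) e u).
  by rewrite /wD; exact: (xgetPex _ (ex_intro _ g h)).
by split => //; exact: weak_deriv_unique h' h.
Qed.

Lemma H1_sq u : H1 (disc r) u ->
  [/\ sq u, sq (wD (disc r) e1 u), sq (wD (disc r) e2 u),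
   is_weak_deriv (disc r) e1 u (wD (disc r) e1 u) & is_weak_deriv (disc r) e2 u (wD (disc r) e2 u)].
Proof.
move=> [/L2P hu [g1 h1] [g2 h2]].
have [a1 _] := wDP h1; have [a2 _] := wDP h2.
by split => //; [have [/L2P] := a1|have [/L2P] := a2].
Qed.

(** The [x]-derivative of the kernel is [- lseq n] times its [y]-derivative, and the kernel is a
    test function, so the definition of the weak derivative applies to it directly. *)
Lemma deriv_smoothing1 u g n x : sq u -> is_weak_deriv (disc r) e1 u g -> disc r x ->
  'D_e1 (smoothing u n) x = lseq n * smoothing g n x.
Proof.
move=> hu [/L2P hg h] xD; have [kk _ _] := kseqP n.
have [_ ->] := mol_derive1 r0 (lseq n) x kk kk (sqint_integrable r0 hu).
congr (_ * _); apply/eqP; rewrite -eqr_opp -(h _ (test_smoothing n xD)); apply/eqP.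
rewrite -mulN1r /mol -RintegralZl//; last first.
  exact: (mol_integrable r0 (lseq n) x (kern_derive kk) kk (sqint_integrable r0 hu)).
by apply: eq_Rintegral => y _; rewrite (derive_tensor _ _ _ kk kk).1; ring.
Qed.

Lemma deriv_smoothing2 u g n x : sq u -> is_weak_deriv (disc r) e2 u g -> disc r x ->
  'D_e2 (smoothing u n) x = lseq n * smoothing g n x.
Proof.
move=> hu [/L2P hg h] xD; have [kk _ _] := kseqP n.
have [_ ->] := mol_derive2 r0 (lseq n) x kk kk (sqint_integrable r0 hu).
congr (_ * _); apply/eqP; rewrite -eqr_opp -(h _ (test_smoothing n xD)); apply/eqP.
rewrite -mulN1r /mol -RintegralZl//; last first.
  exact: (mol_integrable r0 (lseq n) x kk (kern_derive kk) (sqint_integrable r0 hu)).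
by apply: eq_Rintegral => y _; rewrite (derive_tensor _ _ _ kk kk).2; ring.
Qed.

Lemma scaled_cvg2 (l_ : nat -> R) (f_ : nat -> R * R -> R) g : l_ n @[n --> \oo] --> (1 : R) ->
  (forall n, sq (f_ n)) -> sq g -> cvg2 leb2 (disc r) f_ g ->
  cvg2 leb2 (disc r) (fun n x => l_ n * f_ n x) g.
Proof.
move=> l1 hf hg c.
have d0 : (fun n => l_ n - 1) n @[n --> \oo] --> (1 - 1 : R) by apply: cvgB l1 _; exact: cvg_cst.
have u1 : 2 * (l_ n * l_ n * nrm (fun x => f_ n x - g x)) @[n --> \oo] --> 2 * (1 * 1 * 0 : R).
  by apply: cvgMl_tmp; apply: cvgM c; exact: cvgM.
have u2 : 2 * ((l_ n - 1) * (l_ n - 1) * nrm g) @[n --> \oo] --> 2 * ((1 - 1) * (1 - 1) * nrm g : R).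
  by apply: cvgMl_tmp; apply: cvgMr_tmp; exact: cvgM.
have u3 : 2 * (l_ n * l_ n * nrm (fun x => f_ n x - g x)) + 2 * ((l_ n - 1) * (l_ n - 1) * nrm g)
    @[n --> \oo] --> (0 : R).
  by have h := cvgD u1 u2; move: h; rewrite subrr !mul0r !mulr0 addr0; apply.
rewrite /cvg2; apply: (@squeeze_cvgr _ _ _ _ (cst 0) _ _ _ _ _ u3); last exact: cvg_cst.
apply: nearW => n; rewrite nrm2_ge0 /=.
have h1 := sqintZ mD (l_ n) (sqintB mD (hf n) hg); have h2 := sqintZ mD (l_ n - 1) hg.
have := nrm2D_le mD h1 h2; rewrite !nrm2Z ?expr2//; last exact: sqintB.
by apply: le_trans; rewrite le_eqVlt; apply/orP; left; apply/eqP; apply: eq_nrm2 => x _; ring.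
Qed.

Lemma eq_cvg2 (f_ f_' : nat -> R * R -> R) g : (forall n x, disc r x -> f_ n x = f_' n x) ->
  cvg2 leb2 (disc r) f_ g -> cvg2 leb2 (disc r) f_' g.
Proof.
move=> e; rewrite /cvg2; have -> // : (fun n => nrm (fun x => f_ n x - g x)) = (fun n => nrm (fun x => f_' n x - g x)).
by apply/funext => n; apply: eq_nrm2 => x /set_mem xD; rewrite e.
Qed.

Definition h1cvg (w : nat -> R * R -> R) u g1 g2 :=
  [/\ cvg2 leb2 (disc r) w u, cvg2 leb2 (disc r) (fun n x => 'D_e1 (w n) x) g1 &
      cvg2 leb2 (disc r) (fun n x => 'D_e2 (w n) x) g2].

Lemma smooth_sq w : smooth w -> [/\ sq w, sq (fun x => 'D_e1 w x) & sq (fun x => 'D_e2 w x)].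
Proof.
move=> /smooth_C1[_ c c1 c2].
exact: And3 (continuous_sqint2 r0 c) (continuous_sqint2 r0 c1) (continuous_sqint2 r0 c2).
Qed.

Lemma H1_cvgP (w : nat -> R * R -> R) u : (forall n, smooth (w n)) -> H1 (disc r) u ->
  H1_cvg (disc r) w u <-> h1cvg w u (wD (disc r) e1 u) (wD (disc r) e2 u).
Proof.
move=> sw hu; have [s0 s1 s2 _ _] := H1_sq hu.
have w0 n : sq (w n) by have [] := smooth_sq (sw n).
have w1 n : sq (fun x => 'D_e1 (w n) x) by have [] := smooth_sq (sw n).
have w2 n : sq (fun x => 'D_e2 (w n) x) by have [] := smooth_sq (sw n).
split=> -[a b c].
  exact: And3 ((L2dist_cvgP w0 s0).1 a) ((L2dist_cvgP w1 s1).1 b) ((L2dist_cvgP w2 s2).1 c).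
exact: And3 ((L2dist_cvgP w0 s0).2 a) ((L2dist_cvgP w1 s1).2 b) ((L2dist_cvgP w2 s2).2 c).
Qed.

(** Contracting by [lseq n < 1] keeps the kernels inside the disc, so the approximation holds up to
    the boundary without extending [u]. The factor [lseq n] on the derivatives tends to 1. *)
Theorem smooth_dense_H1 u : H1 (disc r) u ->
  h1cvg (smoothing u) u (wD (disc r) e1 u) (wD (disc r) e2 u).
Proof.
move=> hu; have [s0 s1 s2 d1 d2] := H1_sq hu; split.
- exact: smoothing_cvg.
- apply: (@eq_cvg2 (fun n x => lseq n * smoothing (wD (disc r) e1 u) n x)).
    by move=> n x xD; rewrite (deriv_smoothing1 n s0 d1 xD).
  apply: scaled_cvg2 => //; [exact: lseq_cvg|by move=> n; exact: sqint_smoothing|exact: smoothing_cvg].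
- apply: (@eq_cvg2 (fun n x => lseq n * smoothing (wD (disc r) e2 u) n x)).
    by move=> n x xD; rewrite (deriv_smoothing2 n s0 d2 xD).
  apply: scaled_cvg2 => //; [exact: lseq_cvg|by move=> n; exact: sqint_smoothing|exact: smoothing_cvg].
Qed.
End Sobolev.

(** * Traces and Green's formula *)

Section Traces.
Context {R : realType}.
Notation P := (measurableTypeR R * measurableTypeR R)%type.
Variables (r : R) (r0 : 0 < r).
Let mD : measurable (disc r : set P) := measurable_disc r0.
Implicit Types (f g u v w phi F G : R * R -> R) (x : R * R) (i : bool).
Notation sq f := (sqint leb2 (disc r) f).
Notation nrm f := (nrm2 leb2 (disc r) f).
Notation ipd f g := (ip leb2 (disc r) f g).

(** The coordinate is indexed by a boolean, [true] for the first, so that one statement covers both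
    directions. *)
Definition ax i : R * R := if i then e1 else e2.
Definition co i x : R := if i then x.1 else x.2.

Lemma C1_ax F : C1 F -> forall i, (forall x, derivable F x (ax i)) /\ continuous (fun x => 'D_(ax i) F x).
Proof. by case=> d c c1 c2 [|]; split; [move=> x; exact: (d x).1|exact: c1|move=> x; exact: (d x).2|exact: c2]. Qed.

Lemma C1_continuous (F : R * R -> R) : C1 F -> continuous F.
Proof. by case. Qed.

Lemma C1_co i : C1 (co i).
Proof. by case: i; [exact: C1_fst|exact: C1_snd]. Qed.

Lemma derive_co i x : 'D_(ax i) (co i) x = 1.
Proof. by case: i; [have [] := derive_fst x|have [] := derive_snd x]. Qed.

Lemma C1_sq F : C1 F -> sq F.
Proof. by move=> h; exact: continuous_sqint2 (C1_continuous h). Qed.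

Lemma C1_sqD F i : C1 F -> sq (fun x => 'D_(ax i) F x).
Proof. by move=> h; exact: (continuous_sqint2 r0 (C1_ax h i).2). Qed.

Lemma divergence_ax F i : C1 F ->
  \int[leb2]_(x in disc r) 'D_(ax i) F x = circle_int r (fun x => co i x / r * F x).
Proof. by case: i => h; [exact: divergence_e1|exact: divergence_e2]. Qed.

Lemma derive_axM F G i x : C1 F -> C1 G ->
  'D_(ax i) (fun y => F y * G y) x = 'D_(ax i) F x * G x + F x * 'D_(ax i) G x.
Proof. by move=> hF hG; apply: deriveMR; [exact: (C1_ax hF i).1|exact: (C1_ax hG i).1]. Qed.

Lemma derive_axB F G i x : C1 F -> C1 G ->
  'D_(ax i) (fun y => F y - G y) x = 'D_(ax i) F x - 'D_(ax i) G x.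
Proof. by move=> hF hG; apply: deriveB; [exact: (C1_ax hF i).1|exact: (C1_ax hG i).1]. Qed.

Lemma green_C1 F G i : C1 F -> C1 G ->
  ipd (fun x => 'D_(ax i) F x) G + ipd F (fun x => 'D_(ax i) G x) =
  circle_int r (fun x => co i x / r * (F x * G x)).
Proof.
move=> hF hG; rewrite -divergence_ax; last exact: C1M.
rewrite /ip -RintegralD//; last 2 first.
- by apply: (sqint_mul mD); [exact: C1_sqD|exact: C1_sq].
- by apply: (sqint_mul mD); [exact: C1_sq|exact: C1_sqD].
by apply: eq_Rintegral => x _; rewrite (derive_axM i x hF hG).
Qed.

Lemma sqn_circle t : sqn (circle r t) = r ^+ 2.
Proof. by rewrite /sqn /circle /= !exprMn -mulrDr cos2Dsin2 mulr1. Qed.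

Lemma circle_boundary t : ~ disc r (circle r t).
Proof. by move/(disc_sqn r0); rewrite sqn_circle ltxx. Qed.

Lemma test_outside phi x : test_function (disc r) phi -> ~ disc r x -> phi x = 0.
Proof.
move=> [_ _ sub] nx; apply/eqP; apply: contra_notT nx => h; apply: sub.
exact: subset_closure.
Qed.

Lemma circle_int0 f : (forall t, f (circle r t) = 0) -> circle_int r f = 0.
Proof.
move=> h; rewrite /circle_int (_ : \int[leb1]_(t in _) _ = 0) ?mulr0//.
under eq_Rintegral do rewrite h.
by rewrite /Rintegral integral0.
Qed.

Lemma C1_weak f i : C1 f -> is_weak_deriv (disc r) (ax i) f (fun x => 'D_(ax i) f x).
Proof.
move=> hf; split; first by apply/(L2P r0); exact: C1_sqD.
move=> phi tp; have hp := smooth_C1 (let: And3 h _ _ := tp in h).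
have := green_C1 i hf hp; rewrite circle_int0; last first.
  by move=> t; rewrite (test_outside tp) ?mulr0//; exact: circle_boundary.
by rewrite addrC => /eqP; rewrite addr_eq0 => /eqP.
Qed.

Lemma eq_weak_deriv i u u' g : sq u -> sq u' -> nrm (fun x => u x - u' x) = 0 ->
  is_weak_deriv (disc r) (ax i) u g -> is_weak_deriv (disc r) (ax i) u' g.
Proof.
move=> hu hu' e [h1 h2]; split => // phi tp; rewrite -h2//.
have hp := smooth_C1 (let: And3 h _ _ := tp in h).
by rewrite -[RHS]/(ipd u (fun x => 'D_(ax i) phi x)) (ip_eq_of_nrm2 mD hu hu' _ e)//; exact: C1_sqD.
Qed.

Notation wd i u := (wD (disc r) (ax i) u).

Lemma H1_ax u : H1 (disc r) u <->
  sq u /\ forall i, is_weak_deriv (disc r) (ax i) u (wd i u) /\ sq (wd i u).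
Proof.
split.
  by move=> h; have [s a b c d] := H1_sq r0 h; split => [//|[|]]; [exact: conj c a|exact: conj d b].
move=> [s h]; split; first exact/(L2P r0).
  by exists (wd true u); exact: (h true).1.
by exists (wd false u); exact: (h false).1.
Qed.

(** [wD] is a chosen representative, so a weak derivative is identified with a classical one only up
    to a null set. Allowing [u] to differ from [f] on a null set makes the lemma applicable a second
    time, to the chosen first derivatives. *)
Lemma H1_null u f : C1 f -> sq u -> nrm (fun x => u x - f x) = 0 ->
  H1 (disc r) u /\ forall i, nrm (fun x => wd i u x - 'D_(ax i) f x) = 0.
Proof.
move=> hf hu e; have hf2 := C1_sq hf.
have h i : is_weak_deriv (disc r) (ax i) u (fun x => 'D_(ax i) f x).
  by apply: (eq_weak_deriv hf2 hu _ (C1_weak i hf)); rewrite nrm2_subC.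
have k i := wDP r0 (h i).
split; last by move=> i; exact: (k i).2.
by apply/H1_ax; split => // i; split; [exact: (k i).1|apply/(L2P r0); have [[]] := k i].
Qed.

Lemma nrm_subrr f : nrm (fun x => f x - f x) = 0.
Proof.
rewrite /nrm2; under eq_Rintegral do rewrite subrr expr0n /=.
by rewrite /Rintegral integral0.
Qed.

Notation arc := (`[0, 2 * pi]%classic : set (measurableTypeR R)).
Let mI : measurable arc := measurable_itv _.
Notation sqc f := (sqint leb1 arc (fun t => f (circle r t))).
Notation nrmc f := (nrm2 leb1 arc (fun t => f (circle r t))).

Lemma circle_L2P g : circle_L2 r g <-> sqc g.
Proof. exact: (Lfun2P leb1 mI (g \o circle r)). Qed.

Lemma circle_L2dist_cvgP (w : nat -> R * R -> R) g : (forall n, sqc (w n)) -> sqc g ->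
  (circle_L2dist r (w n) g @[n --> \oo] --> 0%E) <->
  cvg2 leb1 arc (fun n t => w n (circle r t)) (fun t => g (circle r t)).
Proof. exact: (@Lnorm2_cvgP _ _ _ leb1 arc mI (fun n t => w n (circle r t)) (fun t => g (circle r t))). Qed.

Lemma continuous_sqc f : continuous f -> sqc f.
Proof.
move=> cf; have c := continuous_circle (r := r) cf; split.
  by apply: measurable_funTS; exact: continuous_measurable_fun.
by apply: continuous_integrable1; exact: contX.
Qed.

(* Divergence theorem for the field [x_i w^2]. *)
Lemma trace_ineq1 i w : C1 w ->
  circle_int r (fun x => co i x / r * (co i x * (w x * w x))) <=
  2 * nrm w + r ^+ 2 * nrm (fun x => 'D_(ax i) w x).
Proof.
move=> hw; have hw2 := C1M hw hw; have hc := C1_co i.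
rewrite -(divergence_ax i (C1M hc hw2)).
have s0 := C1_sq hw; have s1 := C1_sqD i hw.
have s0' : leb2.-integrable (disc r : set P) (EFin \o (fun x => 2 * w x ^+ 2)).
  have := integrableZl mD 2 s0.2; apply: eq_integrable => //= x _.
have s1' : leb2.-integrable (disc r : set P) (EFin \o (fun x => r ^+ 2 * ('D_(ax i) w x) ^+ 2)).
  have := integrableZl mD (r ^+ 2) s1.2; apply: eq_integrable => //= x _.
have -> : 2 * nrm w = \int[leb2]_(x in disc r) (2 * w x ^+ 2) by rewrite RintegralZl//; exact: s0.2.
have -> : r ^+ 2 * nrm (fun x => 'D_(ax i) w x) = \int[leb2]_(x in disc r) (r ^+ 2 * ('D_(ax i) w x) ^+ 2).
  by rewrite RintegralZl//; exact: s1.2.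
rewrite -RintegralD//; apply: le_Rintegral => //.
- exact: (continuous_integrable2 r0 (C1_ax (C1M hc hw2) i).2).
- have := integrableD mD s0' s1'; apply: eq_integrable => //= x _.
move=> x /(disc_sqn r0) xD; rewrite (derive_axM i x hc hw2) derive_co (derive_axM i x hw hw).
have : co i x ^+ 2 <= r ^+ 2.
  apply: le_trans (ltW xD); rewrite /sqn /co; case: (i); rewrite ?lerDl ?lerDr sqr_ge0//.
move: (w x) ('D_(ax i) w x) (co i x) (r ^+ 2) => a b c d cd.
(* The integrand is [a^2 + 2 * a * b * c <= 2 * a^2 + c^2 * b^2], and [c^2 <= r^2] on the disc. *)
have h1 : 0 <= (a - c * b) ^+ 2 by exact: sqr_ge0.
have h2 : c ^+ 2 * b ^+ 2 <= d * b ^+ 2 by apply: ler_wpM2r => //; exact: sqr_ge0.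
by move: h1; rewrite sqrrB exprMn mul1r; move: h2; rewrite !expr2; nra.
Qed.

Let trace_sum (N c1 c2 a b : R) : c1 <= 2 * N + a -> c2 <= 2 * N + b -> c1 + c2 <= 4 * N + a + b.
Proof. by move=> *; lra. Qed.

Let diff_sum (q A B C a1 a2 a3 b1 b2 b3 : R) : 0 <= q -> A <= 2 * B + 2 * C ->
  a1 <= 2 * a2 + 2 * a3 -> b1 <= 2 * b2 + 2 * b3 ->
  4 * A + q * a1 + q * b1 <= 2 * (4 * B + q * a2 + q * b2) + 2 * (4 * C + q * a3 + q * b3).
Proof. by move=> q0 h1 /(ler_wpM2l q0) h2 /(ler_wpM2l q0) h3; rewrite !mulrDr !(mulrCA q) in h2 h3; lra. Qed.

(** The position vector has normal component [r] on the circle, so adding the two coordinate fields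
    recovers the full boundary norm. *)
Lemma trace_ineq w : C1 w -> r ^+ 2 * nrmc w <=
  4 * nrm w + r ^+ 2 * nrm (fun x => 'D_(ax true) w x) + r ^+ 2 * nrm (fun x => 'D_(ax false) w x).
Proof.
move=> hw; have cw := C1_continuous hw.
have c i : continuous (fun t => co i (circle r t) / r * (co i (circle r t) * (w (circle r t) * w (circle r t)))).
  apply: (@continuous_circle _ r (fun x => co i x / r * (co i x * (w x * w x)))).
  have ci := C1_continuous (C1_co i).
  by apply: contM; [apply: contM => //; exact: cont_cst|apply: contM => //; exact: contM].
have -> : r ^+ 2 * nrmc w = circle_int r (fun x => co true x / r * (co true x * (w x * w x))) +
    circle_int r (fun x => co false x / r * (co false x * (w x * w x))).
  rewrite /circle_int -mulrDr -RintegralD//; [|exact: continuous_integrable1..].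
  rewrite expr2 -mulrA; congr (_ * _); rewrite /nrm2 -RintegralZl//; last first.
    by apply: continuous_integrable1; apply: contX; exact: (continuous_circle (r := r) cw).
  apply: eq_Rintegral => t _ /=; have := sqn_circle t; rewrite /sqn /=.
  move: (w _) (r * cos t) (r * sin t) => a b e h.
  transitivity (r ^+ 2 / r * a ^+ 2); first by rewrite expr2 mulfK// gt_eqF.
  by rewrite -h; ring.
exact: trace_sum (trace_ineq1 true hw) (trace_ineq1 false hw).
Qed.

Let sub_le f g h : sq f -> sq g -> sq h -> nrm (fun x => f x - g x) <=
  2 * nrm (fun x => f x - h x) + 2 * nrm (fun x => g x - h x).
Proof.
move=> hf hg hh; have := nrm2_sub_le mD hf hg hh.
by rewrite [X in _ <= _ + 2 * X -> _]nrm2_subC.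
Qed.

Let h1_zero (a b c q : R) : a = 0 -> b = 0 -> c = 0 -> 4 * a + q * b + q * c = 0.
Proof. by move=> -> -> ->; rewrite !mulr0 !addr0. Qed.

Let quarter (q a b : R) : a <= q / 4 -> b <= q / 4 -> 2 * a + 2 * b <= q.
Proof. by move=> *; lra. Qed.

Let cvg0Z (s : nat -> R) c : s n @[n --> \oo] --> (0 : R) -> c * s n @[n --> \oo] --> (0 : R).
Proof. by move=> h; have := @cvgMl_tmp _ _ _ _ _ c _ h; rewrite mulr0; apply. Qed.

Let cvg0D (s t : nat -> R) : s n @[n --> \oo] --> (0 : R) -> t n @[n --> \oo] --> (0 : R) ->
  s n + t n @[n --> \oo] --> (0 : R).
Proof. by move=> h k; have := cvgD h k; rewrite addr0; apply. Qed.

Let le_cvg0 (a : R) (s : nat -> R) : s n @[n --> \oo] --> (0 : R) -> (forall n, a <= s n) -> a <= 0.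
Proof.
move=> h ge; rewrite leNgt; apply/negP => a0.
have /cvgrPdist_lt/(_ _ a0) [N _ /(_ N (leqnn N))] := h; rewrite /= sub0r normrN.
by rewrite ltNge (le_trans (ge N) (ler_norm _)).
Qed.

(** The squared [H1] distance, weighted as in [trace_ineq] so that it bounds differences of boundary
    values directly. *)
Definition h1dist w u (g : bool -> R * R -> R) := 4 * nrm (fun x => w x - u x) +
  r ^+ 2 * nrm (fun x => 'D_(ax true) w x - g true x) +
  r ^+ 2 * nrm (fun x => 'D_(ax false) w x - g false x).

Lemma nrmc_diff_le w w' u (g : bool -> R * R -> R) : C1 w -> C1 w' -> sq u -> (forall i, sq (g i)) ->
  r ^+ 2 * nrmc (fun x => w x - w' x) <= 2 * h1dist w u g + 2 * h1dist w' u g.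
Proof.
move=> hw hw' hu hg; apply: le_trans (trace_ineq (C1B hw hw')) _.
have e i : nrm (fun x => 'D_(ax i) (fun y => w y - w' y) x) =
    nrm (fun x => 'D_(ax i) w x - 'D_(ax i) w' x).
  by apply: eq_nrm2 => x _; rewrite (derive_axB i x hw hw').
rewrite !e; apply: diff_sum; first exact: sqr_ge0.
- exact: sub_le (C1_sq hw) (C1_sq hw') hu.
- exact: sub_le (C1_sqD true hw) (C1_sqD true hw') (hg true).
- exact: sub_le (C1_sqD false hw) (C1_sqD false hw') (hg false).
Qed.

Lemma h1dist_cvg (w : nat -> R * R -> R) u (g : bool -> R * R -> R) : h1cvg r w u (g true) (g false) ->
  h1dist (w n) u g @[n --> \oo] --> (0 : R).
Proof.
move=> [a b c].
exact: cvg0D (cvg0D (cvg0Z 4 a) (cvg0Z (r ^+ 2) b)) (cvg0Z (r ^+ 2) c).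
Qed.

Lemma is_traceP v g : H1 (disc r) v -> is_trace r v g <-> sqc g /\
  exists w : nat -> R * R -> R, [/\ forall n, smooth (w n), h1cvg r w v (wd true v) (wd false v) &
    cvg2 leb1 arc (fun n t => w n (circle r t)) (fun t => g (circle r t))].
Proof.
move=> hv; split=> [[/circle_L2P hg [w [sw a b]]]|[hg [w [sw a b]]]].
  have sc n : sqc (w n) by apply: continuous_sqc; exact: (sw n 0%N).
  split => //; exists w; split => //; first exact: (H1_cvgP r0 sw hv).1 a.
  exact: (circle_L2dist_cvgP sc hg).1 b.
have sc n : sqc (w n) by apply: continuous_sqc; exact: (sw n 0%N).
split; first exact/circle_L2P.
exists w; split => //; first exact: (H1_cvgP r0 sw hv).2 a.
exact: (circle_L2dist_cvgP sc hg).2 b.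
Qed.

(** By the trace inequality the restrictions of the smoothings are Cauchy in [L2] of the circle.
    Completeness provides a trace, hence the chosen one is a trace too. *)
Theorem is_trace_trace v : H1 (disc r) v -> is_trace r v (trace r v).
Proof.
move=> hv; have [sv sd] := (H1_ax v).1 hv.
pose w := smoothing r v; pose g i := wd i v.
have sw n : smooth (w n) by exact: smooth_smoothing.
have hw : h1cvg r w v (g true) (g false) := smooth_dense_H1 r0 hv.
have sc n : sqc (w n) by apply: continuous_sqc; exact: (sw n 0%N).
have ca e : 0 < e -> exists N, forall m n, (N <= m)%N -> (N <= n)%N ->
    nrm2 leb1 arc (fun t => w m (circle r t) - w n (circle r t)) <= e.
  move=> e0; have r2 : 0 < r ^+ 2 by rewrite exprn_gt0.
  have e4 : 0 < r ^+ 2 * e / 4 by rewrite divr_gt0// mulr_gt0.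
  have /cvgrPdist_le/(_ _ e4) [N _ hN] := h1dist_cvg hw.
  have small n : (N <= n)%N -> h1dist (w n) v g <= r ^+ 2 * e / 4.
    by move=> /hN; rewrite sub0r normrN; exact: le_trans (ler_norm _).
  exists N => m n Nm Nn; rewrite -(ler_pM2l r2).
  apply: le_trans (nrmc_diff_le (smooth_C1 (sw m)) (smooth_C1 (sw n)) sv (fun i => (sd i).2)) _.
  exact: quarter (small _ Nm) (small _ Nn).
have [K [h1 h2]] := sqint_complete mI sc ca.
pose gg x := fine (limn_esup (fun n => (w (K n) x)%:E)).
have : is_trace r v gg by apply/(is_traceP _ hv); split => //; exists w.
by move=> h; exact: (xgetPex (cst 0) (ex_intro (fun g => [set g | is_trace r v g] g) gg h)).
Qed.

(** The function [f] itself is at [h1dist] 0 from [u], so the trace inequality compares its boundary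
    values with those of any sequence that defines the trace. *)
Lemma trace_null u f : C1 f -> sq u -> nrm (fun x => u x - f x) = 0 ->
  nrmc (fun x => trace r u x - f x) = 0.
Proof.
move=> hf su e; have [hu hd] := H1_null hf su e.
have /(is_traceP _ hu) [sg [w [sw hw cw]]] := is_trace_trace hu.
have [_ sd] := (H1_ax u).1 hu; pose g i := wd i u.
have d0 : h1dist f u g = 0.
  have e' : nrm (fun x => f x - u x) = 0 by rewrite nrm2_subC.
  have hd' i : nrm (fun x => 'D_(ax i) f x - g i x) = 0 by rewrite nrm2_subC; exact: hd.
  exact: h1_zero e' (hd' true) (hd' false).
have sf := continuous_sqc (C1_continuous hf).
have sc n : sqc (w n) by apply: continuous_sqc; exact: (sw n 0%N).
have r2 : 0 < r ^+ 2 by rewrite exprn_gt0.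
have lim : 2 * (2 * (r ^- 2) * h1dist (w n) u g) + 2 * nrmc (fun x => w n x - trace r u x)
   @[n --> \oo] --> (0 : R).
  exact: cvg0D (cvg0Z 2 (cvg0Z (2 * r ^- 2) (h1dist_cvg hw))) (cvg0Z 2 cw).
apply/eqP; rewrite eq_le nrm2_ge0 andbT.
apply: (le_cvg0 lim) => n.
have := nrm2_sub_le mI sg sf (sc n); rewrite [X in _ <= 2 * X + _ -> _]nrm2_subC.
move=> h; apply: (le_trans h); rewrite addrC lerD2r ler_pM2l//.
have := nrmc_diff_le (smooth_C1 (sw n)) hf su (fun i => (sd i).2); rewrite -/g d0 mulr0 addr0.
by rewrite -ler_pdivlMl// mulrCA mulrA.
Qed.

(** [green_C1] along the smooth sequence that defines the trace of [q]. With [W] fixed, every term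
    is a pairing that is continuous in [L2]. *)
Theorem green W q i : C1 W -> H1 (disc r) q ->
  ipd (fun x => 'D_(ax i) W x) q + ipd W (wd i q) =
  circle_int r (fun x => co i x / r * W x * trace r q x).
Proof.
move=> hW hq; have [sq_ sd] := (H1_ax q).1 hq.
have /(is_traceP _ hq) [sg [w [sw [w0 w1 w2] cw]]] := is_trace_trace hq.
have hw n := smooth_C1 (sw n); have sc n : sqc (w n) by apply: continuous_sqc; exact: (sw n 0%N).
have wi : cvg2 leb2 (disc r) (fun n x => 'D_(ax i) (w n) x) (wd i q) by case: (i); [exact: w1|exact: w2].
have sb : sqc (fun x => co i x / r * W x).
  apply: (@continuous_sqc (fun x => co i x / r * W x)); apply: contM; last exact: C1_continuous.
  by apply: contM; [exact: C1_continuous (C1_co i)|exact: cont_cst].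
have l1 := cvg2_ip mD (fun n => C1_sq (hw n)) sq_ (C1_sqD i hW) w0.
have l2 := cvg2_ip mD (fun n => C1_sqD i (hw n)) (sd i).2 (C1_sq hW) wi.
have l3 := cvg2_ip mI sc sg sb cw.
have l4 := cvgD l1 l2; have l5 := @cvgMl_tmp _ _ _ _ _ r _ l3.
have e : (fun n => r * ip leb1 arc (fun t => w n (circle r t)) (fun t => co i (circle r t) / r * W (circle r t))) =
   (fun n => ipd (w n) (fun x => 'D_(ax i) W x) + ipd (fun x => 'D_(ax i) (w n) x) W).
  apply/funext => n; rewrite [RHS]addrC -[X in _ + X]/(ipd (w n) (fun x => 'D_(ax i) W x)) (green_C1 i (hw n) hW).
  by rewrite /circle_int /ip; congr (_ * _); apply: eq_Rintegral => t _; ring.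
rewrite [X in X + _](ipC leb2) [X in _ + X](ipC leb2); rewrite e in l5.
rewrite (cvg_unique _ (l4 _) (l5 _))//; rewrite /circle_int; congr (_ * _).
by apply: eq_Rintegral => t _; rewrite mulrC.
Qed.

Let lup (n : nat) : R := 1 + n.+2%:R^-1.

Let lup_ge n : 2^-1 <= lup n.
Proof. by have [h _] := @n2_bounds R n; rewrite /lup; move: (n.+2%:R^-1) h => q h; lra. Qed.

Let lup_cvg : lup n @[n --> \oo] --> (1 : R).
Proof.
have h : lup n @[n --> \oo] --> (1 + 0 : R) by apply: cvgD (@cvg_n2 R); exact: cvg_cst.
by move: h; rewrite addr0; apply.
Qed.

Let push u n := mol r u (kseq r n) (kseq r n) (lup n).

(** A disc containing the support of [push u n]: where it does not vanish, [lup n * x] lies in a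
    square of half side [eseq r n] around a point of the disc. *)
Let rho n := (r + 2 * eseq r n) / lup n.

Lemma rho_bounds n : 0 < rho n /\ rho n < r.
Proof.
have [h h'] := @n2_bounds R n; have e0 := eseq_gt0 r0 n.
have l0 : 0 < lup n by rewrite /lup; move: (n.+2%:R^-1) h => q h; lra.
split; first by rewrite divr_gt0// addr_gt0// mulr_gt0.
rewrite ltr_pdivrMr// /eseq /lup; move: (n.+2%:R^-1) h => q h.
have : 0 < r * q by rewrite mulr_gt0.
by move=> hq; lra.
Qed.

Lemma stretch_box (l e : R) x y : 0 < l -> 0 < e -> disc r y -> `|l * x.1 - y.1| <= e ->
  `|l * x.2 - y.2| <= e -> cdisc ((r + 2 * e) / l) x.
Proof.
move=> l0 e0 /(disc_sqn r0) yD; rewrite !ler_norml => /andP[a1 a2] /andP[b1 b2].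
have rl : 0 < (r + 2 * e) / l by rewrite divr_gt0// addr_gt0// mulr_gt0.
apply/(cdisc_sqn rl); rewrite exprMn exprVn ler_pdivlMr ?exprn_gt0//.
have bd (s t : R) : s ^+ 2 + t ^+ 2 < r ^+ 2 -> - r < s < r.
  move=> h; rewrite -ltr_norml -(@ltr_pXn2r _ 2)// ?nnegrE ?(ltW r0)// real_normK ?num_real//.
  by have := sqr_ge0 t; lra.
move: yD; rewrite /sqn => yD.
have /andP[c1 c2] := bd _ _ yD; have /andP[d1 d2] : - r < y.2 < r by apply: (bd _ y.1); rewrite addrC.
have sq_le (s t : R) : - e <= l * s - t -> l * s - t <= e -> - r < t -> t < r ->
    (l * s) ^+ 2 <= t ^+ 2 + 2 * (r * e) + e ^+ 2.
  move=> h1 h2 h3 h4; set d := l * s - t; have -> : l * s = t + d by rewrite /d; ring.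
  have q1 : d ^+ 2 <= e ^+ 2 by rewrite /d in h1 h2 *; nra.
  have q2 : t * d <= r * e by rewrite /d in h1 h2 *; nra.
  by rewrite sqrrD -mulr_natl; lra.
have s1 := sq_le _ _ a1 a2 c1 c2; have s2 := sq_le _ _ b1 b2 d1 d2.
have e2 : 0 <= e ^+ 2 by rewrite exprn_ge0// ltW.
rewrite mulrDl -!exprMn ![_ * l]mulrC.
have -> : (r + 2 * e) ^+ 2 = r ^+ 2 + 4 * (r * e) + 4 * e ^+ 2 by ring.
move: s1 s2 yD e2; move: (r * e) (e ^+ 2) (r ^+ 2) (y.1 ^+ 2) (y.2 ^+ 2) ((l * x.1) ^+ 2) ((l * x.2) ^+ 2).
by move=> *; lra.
Qed.

Lemma test_push u n : sq u -> test_function (disc r) (push u n).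
Proof.
move=> hu; have [kk _ _] := kseqP r0 n; have [rho0 rhor] := rho_bounds n.
have sub : closure [set x | push u n x != 0] `<=` cdisc (rho n).
  have clK := closed_cdisc rho0.
  apply: (subset_trans (closureS _ : _ `<=` closure (cdisc (rho n)))); last first.
    by move: clK; rewrite closure_id => <-.
  move=> x /= hx; apply: contrapT => nx; move: hx; rewrite /push /mol.
  have -> : \int[leb2]_(y in disc r) (u y * tensor (kseq r n) (kseq r n) (lup n) x y) = 0; last by rewrite eqxx.
  transitivity (\int[leb2]_(y in disc r) (cst 0 y : R)); last by rewrite /Rintegral integral0.
  apply: eq_Rintegral => y /set_mem yD; rewrite /tensor.
  have [h1|h1] := leP (eseq r n) `|lup n * x.1 - y.1|; first by rewrite (kk.2 _ h1) mul0r mulr0.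
  have [h2|h2] := leP (eseq r n) `|lup n * x.2 - y.2|; first by rewrite (kk.2 _ h2) !mulr0.
  exfalso; apply: nx; apply: (@stretch_box _ _ _ y _ (eseq_gt0 r0 n) yD (ltW h1) (ltW h2)).
  by apply: lt_le_trans (lup_ge n); rewrite invr_gt0.
split.
- exact: (smooth_mol r0 (lup n) kk kk (sqint_integrable r0 hu)).
- by apply: (subclosed_compact _ (compact_cdisc rho0)) => //; exact: closed_closure.
- by move=> x /sub; rewrite /cdisc /disc /= => h; exact: le_lt_trans h rhor.
Qed.

(** Here the kernel may cross the circle and is no test function; the boundary term disappears
    because [z] vanishes on the circle. *)
Lemma deriv_push z n i x : C1 z -> (forall t, z (circle r t) = 0) ->
  'D_(ax i) (push z n) x = lup n * push (fun y => 'D_(ax i) z y) n x.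
Proof.
move=> hz z0; have [kk _ _] := kseqP r0 n; have iz := sqint_integrable r0 (C1_sq hz).
have ct : C1 (tensor (kseq r n) (kseq r n) (lup n) x) := smooth_C1 (smooth_tensor (lup n) x kk kk).
have := green_C1 i hz ct; rewrite circle_int0; last by move=> t; rewrite z0 mul0r mulr0.
move=> /eqP; rewrite addr_eq0 => /eqP h.
have key : push (fun y => 'D_(ax i) z y) n x =
    ipd z (fun y => -1 * 'D_(ax i) (tensor (kseq r n) (kseq r n) (lup n) x) y).
  by rewrite (ipZr mD (-1) (C1_sqD i ct) (C1_sq hz)) mulN1r -h.
rewrite key; case: (i) => {h key}.
  rewrite /ax (mol_derive1 r0 (lup n) x kk kk iz).2; apply: (@f_equal _ _ (fun t => lup n * t)).

  by apply: eq_Rintegral => y _; rewrite (derive_tensor (lup n) x y kk kk).1 mulN1r opprK.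
rewrite /ax (mol_derive2 r0 (lup n) x kk kk iz).2; apply: (@f_equal _ _ (fun t => lup n * t)).
by apply: eq_Rintegral => y _; rewrite (derive_tensor (lup n) x y kk kk).2 mulN1r opprK.
Qed.

(** The approximating test functions are the dilated mollifications. Their derivatives converge
    because, by [deriv_push], they are scaled mollifications of the derivatives of [z]. *)
Theorem H10_C1 z : C1 z -> (forall t, z (circle r t) = 0) -> H10 (disc r) z.
Proof.
move=> hz z0; have sz := C1_sq hz; have [hz1 hd] := H1_null hz sz (nrm_subrr z).
split => //; exists (push z); first by move=> n; exact: test_push.
have sw n : smooth (push z n) by have [] := test_push n sz.
have mc u : sq u -> cvg2 leb2 (disc r) (push u) u.
  exact: (mollifier_cvg r0 lup_ge lup_cvg (eseq_gt0 r0) (@eseq_cvg R r) (kseqP r0)).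
have sm u n : sq u -> sq (push u n) by exact: (sqint_mol r0 lup_ge (eseq_gt0 r0) (kseqP r0)).
have [_ sd] := (H1_ax z).1 hz1.
have cd i : cvg2 leb2 (disc r) (fun n x => 'D_(ax i) (push z n) x) (wd i z).
  have c : cvg2 leb2 (disc r) (fun n x => 'D_(ax i) (push z n) x) (fun x => 'D_(ax i) z x).
    apply: (@eq_cvg2 _ r (fun n x => lup n * push (fun y => 'D_(ax i) z y) n x)).
      by move=> n x _; rewrite (deriv_push n i x hz z0).
    apply: (scaled_cvg2 r0 lup_cvg) => [n||]; [exact: sm (C1_sqD i hz)|exact: C1_sqD|exact: mc (C1_sqD i hz)].
  rewrite /cvg2; have lim := cvg0Z 2 c.
  apply: (@squeeze_cvgr _ _ _ _ (cst 0) _ _ _ _ _ lim); last exact: cvg_cst.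
  apply: nearW => n /=; rewrite nrm2_ge0 /=.
  have := nrm2_sub_le mD (C1_sqD i (smooth_C1 (sw n))) (sd i).2 (C1_sqD i hz).
  by rewrite [X in _ + 2 * X]nrm2_subC hd mulr0 addr0.
apply/(H1_cvgP r0 sw hz1); split; [exact: mc|exact: cd true|exact: cd false].
Qed.
End Traces.

(** * The linear radial problem *)

HB.lock Definition avg (R : realType) (f : R -> R) (s : R) : R := if s == 0 then f 0 else prim f s / s.
(** The function [u = mint f] vanishes at 0 and solves [4 * (s * u')' = f], the radial Poisson
    equation in [s = |x|^2]. *)
HB.lock Definition mint (R : realType) (f : R -> R) (s : R) : R := prim (avg f) s / 4.

Section Averages.
Context {R : realType}.
Implicit Types (f g F : R -> R) (s t a b x : R).

(** The identities for [prim], and through it for [avg] and [mint], are verified by differentiating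
    a candidate. *)
Lemma prim_unique F f : (forall x : R, is_derive x 1 F (f x)) -> continuous f -> F 0 = 0 ->
  forall x, prim f x = F x.
Proof.
move=> dF cf F0 x; pose D t := prim f t - F t.
have dD t : is_derive t 1 D (f t - f t) by exact: is_deriveBR (is_derive_prim t cf) (dF t).
have D0 : D 0 = 0 by rewrite /D prim0 F0 subrr.
have : D x = 0; last by move/eqP; rewrite subr_eq0 => /eqP.
have [x0|x0] := leP 0 x.
  by have [c _] := mean_value x0 dD; rewrite D0 subr0 subrr mul0r.
by have [c _] := mean_value (ltW x0) dD; rewrite D0 subrr mul0r sub0r => /eqP; rewrite oppr_eq0 => /eqP.
Qed.

Lemma primD f g s : continuous f -> continuous g -> prim (fun t => f t + g t) s = prim f s + prim g s.
Proof.
move=> cf cg; apply: (@prim_unique (fun s => prim f s + prim g s)).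
- by move=> x; exact: is_deriveDR (is_derive_prim x cf) (is_derive_prim x cg).
- exact: contD.
- by rewrite !prim0 addr0.
Qed.

Lemma primZ c f s : continuous f -> prim (fun t => c * f t) s = c * prim f s.
Proof.
move=> cf; apply: (@prim_unique (fun s => c * prim f s) (fun t => c * f t)).
- by move=> x; exact: is_deriveZR (is_derive_prim x cf).
- exact: contZ.
- by rewrite prim0 mulr0.
Qed.

Lemma prim_cst c s : prim (fun=> c) s = c * s.
Proof.
apply: (@prim_unique (fun s => c * s)) => [x||]; [|exact: cont_cst|by rewrite mulr0].
by have := is_deriveZR c (is_derive_idR x); rewrite mulr1.
Qed.

Lemma prim_scale l f s : l != 0 -> continuous f -> prim (fun t => f (l * t)) s = l^-1 * prim f (l * s).
Proof.
move=> l0 cf; apply: (@prim_unique (fun s => l^-1 * prim f (l * s)) (fun t => f (l * t))).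
- move=> x; have d := is_deriveZR l (is_derive_idR x).
  have := is_deriveZR l^-1 (@is_derive_compR R (prim f) (fun t => l * t) x _ _ (is_derive_prim (l * x) cf) d).
  by rewrite mulr1 [f _ * l]mulrC mulrA mulVf// mul1r.
- by apply: cont_comp cf; apply: contZ; exact: cont_id.
- by rewrite mulr0 prim0 mulr0.
Qed.

Lemma prim_le f g s : continuous f -> continuous g -> 0 <= s ->
  (forall t, 0 <= t <= s -> f t <= g t) -> prim f s <= prim g s.
Proof.
move=> cf cg s0 h; have := @derive_ge0_le R (fun x => prim g x - prim f x) (fun x => g x - f x) 0 s s0.
rewrite !prim0 subrr subr_ge0; apply.
  by move=> x; exact: is_deriveBR (is_derive_prim x cg) (is_derive_prim x cf).
by move=> x hx; rewrite subr_ge0 h.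
Qed.

Lemma prim_ge0 f s : continuous f -> 0 <= s -> (forall t, 0 <= t <= s -> 0 <= f t) -> 0 <= prim f s.
Proof.
move=> cf s0 h; have c0 : continuous (fun _ : R => 0 : R) by exact: cont_cst.
by have := prim_le c0 cf s0 h; rewrite prim_cst mul0r.
Qed.

Lemma avg0 f : avg f 0 = f 0.
Proof. by rewrite avg.unlock eqxx. Qed.

Lemma mint0 f : mint f 0 = 0.
Proof. by rewrite mint.unlock prim0 mul0r. Qed.

Lemma avgE f s : s != 0 -> avg f s = prim f s / s.
Proof. by rewrite avg.unlock => /negPf ->. Qed.

Lemma mul_avg f s : s * avg f s = prim f s.
Proof.
by rewrite avg.unlock; have [->|s0] := eqVneq s 0; rewrite ?mul0r ?prim0// mulrC divfK.
Qed.

Lemma avg_value f s : continuous f -> exists2 c, `|c| <= `|s| & avg f s = f c.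
Proof.
move=> cf; rewrite avg.unlock; have [->|s0] := eqVneq s 0; first by exists 0.
have [s1|s1] := leP 0 s.
  have [c /andP[c0 cs]] := mean_value s1 (fun x => is_derive_prim x cf).
  by rewrite prim0 !subr0 => ->; exists c; [rewrite !ger0_norm|rewrite mulfK].
have [c /andP[c0 cs]] := mean_value (ltW s1) (fun x => is_derive_prim x cf).
rewrite prim0 !sub0r mulrN => /oppr_inj ->; exists c; last by rewrite mulfK.
by rewrite !ler0_norm ?lerN2// ltW.
Qed.

Lemma continuous_avg f : continuous f -> continuous (avg f).
Proof.
move=> cf s; have [->|s0] := eqVneq s 0.
  rewrite /continuous_at avg0; apply/cvgrPdist_le => e e0.
  have /cvgrPdist_le/(_ _ e0) := cf 0; rewrite near_nbhs => /nbhs_ballP[d d0 hd].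
  apply/nbhs_ballP; exists d => // t; rewrite /ball /= sub0r normrN => td.
  by have [c ct ->] := avg_value t cf; apply: hd; rewrite /ball /= sub0r normrN; exact: le_lt_trans td.
have c : (fun t => prim f t / t) @ s --> prim f s / s.
  by apply: cvgM; [exact: continuous_prim|apply: cvgV => //; exact: cvg_id].
rewrite /continuous_at avgE//; apply: cvg_trans c; apply: near_eq_cvg.
near=> t; rewrite avgE//; near: t.
exact: (open_neq s0).
Unshelve. all: end_near. Qed.

Lemma is_derive_mint f s : continuous f -> is_derive s 1 (mint f) (avg f s / 4).
Proof.
move=> cf; have := is_deriveZR 4^-1 (is_derive_prim s (continuous_avg cf)).
rewrite mulrC; congr is_derive; by apply/funext => t; rewrite mint.unlock mulrC.
Qed.

Lemma continuous_mint f : continuous f -> continuous (mint f).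
Proof. by move=> cf; exact: is_derive_continuous (fun s => is_derive_mint s cf). Qed.

Lemma is_derive_avg f s : s != 0 -> continuous f -> is_derive s 1 (avg f) ((f s - avg f s) / s).
Proof.
move=> s0 cf; have dp := is_derive_prim s cf.
have dV : is_derive s 1 (fun t : R => t^-1) (- s ^- 2 * 1).
  exact: (@is_deriveV R (fun t => t) s 1 1 s0 (is_derive_idR s)).
have d := is_deriveMR dp dV.
have -> : (f s - avg f s) / s = f s * s^-1 + prim f s * (- s ^- 2 * 1).
  by rewrite -(mul_avg f s) mulr1 mulrN expr2 invfM; field.
have [d1 d2] := d; apply: DeriveDef.
  apply: near_eq_derivable d1 => //; near=> t; rewrite avgE//; near: t; exact: open_neq.
rewrite -d2; apply: near_eq_derive => //; near=> t; rewrite avgE//; near: t; exact: open_neq.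
Unshelve. all: end_near. Qed.

Lemma avgD f g s : continuous f -> continuous g -> avg (fun t => f t + g t) s = avg f s + avg g s.
Proof. by move=> cf cg; rewrite avg.unlock; case: ifP => // _; rewrite primD// mulrDl. Qed.

Lemma avgZ c f s : continuous f -> avg (fun t => c * f t) s = c * avg f s.
Proof. by move=> cf; rewrite avg.unlock; case: ifP => // _; rewrite primZ// mulrA. Qed.

Lemma avg_cst c s : avg (fun=> c) s = c.
Proof. by rewrite avg.unlock; case: ifP => [//|/negbT s0]; rewrite prim_cst mulfK. Qed.

Lemma avg_le f g s : continuous f -> continuous g -> 0 <= s ->
  (forall t, 0 <= t <= s -> f t <= g t) -> avg f s <= avg g s.
Proof.
move=> cf cg s0 h; rewrite avg.unlock; case: ifP => [_|/negbT sn0]; first by rewrite h// lexx.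
by rewrite ler_wpM2r ?invr_ge0// prim_le.
Qed.

Lemma avg_ext f g s : continuous f -> continuous g -> 0 <= s ->
  (forall t, 0 <= t <= s -> f t = g t) -> avg f s = avg g s.
Proof. by move=> cf cg s0 h; apply/eqP; rewrite eq_le !avg_le// => t ht; rewrite h. Qed.

Lemma avg_scale l f s : l != 0 -> continuous f -> avg (fun t => f (l * t)) s = avg f (l * s).
Proof.
move=> l0 cf; rewrite !avg.unlock mulf_eq0 (negPf l0) /=; case: ifP => [_|_]; first by rewrite mulr0.
by rewrite prim_scale// invfM mulrA [prim _ _ / _]mulrC.
Qed.

Lemma mintD f g s : continuous f -> continuous g -> mint (fun t => f t + g t) s = mint f s + mint g s.
Proof.
move=> cf cg; have e : avg (fun t => f t + g t) = (fun t => avg f t + avg g t) by apply/funext => t; rewrite avgD.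
rewrite mint.unlock e primD; [|exact: continuous_avg..].
by rewrite mulrDl.
Qed.

Lemma mintZ c f s : continuous f -> mint (fun t => c * f t) s = c * mint f s.
Proof.
move=> cf; have e : avg (fun t => c * f t) = (fun t => c * avg f t) by apply/funext => t; rewrite avgZ.
by rewrite mint.unlock e primZ ?mulrA//; exact: continuous_avg.
Qed.

Lemma mint_cst c s : mint (fun=> c) s = c * s / 4.
Proof.
have e : avg (fun=> c) = (fun=> c) by apply/funext => t; rewrite avg_cst.
by rewrite mint.unlock e prim_cst.
Qed.

Lemma mint_le f g s : continuous f -> continuous g -> 0 <= s ->
  (forall t, 0 <= t <= s -> f t <= g t) -> mint f s <= mint g s.
Proof.
move=> cf cg s0 h; rewrite mint.unlock; apply: ler_wpM2r; first by rewrite invr_ge0.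
apply: prim_le => [||//|t /andP[t0 ts]]; [exact: continuous_avg..|].
by apply: avg_le => // u /andP[u0 ut]; apply: h; rewrite u0 (le_trans ut).
Qed.

Lemma mint_ext f g s : continuous f -> continuous g -> 0 <= s ->
  (forall t, 0 <= t <= s -> f t = g t) -> mint f s = mint g s.
Proof. by move=> cf cg s0 h; apply/le_anti/andP; split; apply: mint_le => [//|//|//|t ht]; rewrite h. Qed.

Lemma mint_scale l f s : l != 0 -> continuous f -> mint (fun t => f (l * t)) s = l^-1 * mint f (l * s).
Proof.
move=> l0 cf; have e : avg (fun t => f (l * t)) = (fun t => avg f (l * t)) by apply/funext => t; rewrite avg_scale.
by rewrite mint.unlock e prim_scale ?mulrA//; exact: continuous_avg.
Qed.

(** The mean over [[0, s]] is the mean over [[0, t]] of [f] with its argument contracted by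
    [s / t <= 1]; the two integrands are then compared pointwise. *)
Lemma avg_nondecr f s t : continuous f -> (forall a b, 0 <= a -> a <= b -> f a <= f b) ->
  0 <= s -> s <= t -> avg f s <= avg f t.
Proof.
move=> cf nf; rewrite le_eqVlt => /orP[/eqP <-|s0] st.
  rewrite avg0 -[leLHS](avg_cst _ t); apply: avg_le => //; first exact: cont_cst.
  by move=> u /andP[u0 _]; exact: nf.
pose l := s / t; have t0 : 0 < t by exact: lt_le_trans st.
have l0 : l != 0 by rewrite gt_eqF// divr_gt0.
have -> : s = l * t by rewrite /l divfK// gt_eqF.
rewrite -avg_scale//; apply: avg_le => [|//||u /andP[u0 _]]; [|exact: ltW|].
  by apply: cont_comp cf; apply: contZ; exact: cont_id.
have l1 : 0 <= l by rewrite divr_ge0// ltW.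
apply: nf; first exact: mulr_ge0.
by rewrite ler_piMl// /l ler_pdivrMr// mul1r.
Qed.

(** Integration by parts: [s * mint f] has derivative [mint f + prim f / 4]. For [f >= 0] and
    [s >= 0] it exhibits the difference as a mean of nonnegative values. *)
Lemma mint_sub_avg f s : continuous f -> mint f s - avg (mint f) s = avg (fun t => prim f t / 4) s.
Proof.
move=> cf; have cm := continuous_mint cf; have cp := continuous_prim cf.
have cp4 : continuous (fun t => prim f t / 4) by apply: contM => //; exact: cont_cst.
have [->|s0] := eqVneq s 0; first by rewrite !avg0 subrr prim0 mul0r.
have d t : is_derive t 1 (fun t => t * mint f t - prim (mint f) t) (prim f t / 4).
  have := is_deriveBR (is_deriveMR (is_derive_idR t) (is_derive_mint t cf)) (is_derive_prim t cm).
  by rewrite mul1r mulrA mul_avg addrC addKr.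
have z : 0 * mint f 0 - prim (mint f) 0 = 0 by rewrite prim0 mul0r subrr.
have e := prim_unique d cp4 z s.
have h1 := mul_avg (mint f) s; have h2 := mul_avg (fun t => prim f t / 4) s.
by apply: (mulfI s0); rewrite mulrBr h1 h2 e.
Qed.

Lemma mint_nondecr f a b : continuous f -> (forall t, 0 <= t -> 0 <= f t) -> 0 <= a -> a <= b -> mint f a <= mint f b.
Proof.
move=> cf f0 a0 ab; apply: (derive_ge0_le ab (fun x => is_derive_mint x cf)) => x /andP[ax _].
rewrite divr_ge0// -[leLHS](avg_cst 0 x) avg_le//; [exact: cont_cst|exact: le_trans ax|].
by move=> t /andP[t0 _]; exact: f0.
Qed.

Lemma prim_nondecr f a b : continuous f -> (forall t, 0 <= t -> 0 <= f t) -> 0 <= a -> a <= b -> prim f a <= prim f b.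
Proof.
move=> cf f0 a0 ab; apply: (derive_ge0_le ab (fun x => is_derive_prim x cf)) => x /andP[ax _].
by apply: f0; exact: le_trans ax.
Qed.
End Averages.

(** * Radial vector fields and potentials *)

Section RadialFields.
Context {R : realType}.
Implicit Types (g : R -> R) (s t a b : R) (x : R * R).

(** The derivative of [avg g] away from 0. It may be unbounded near 0 but only occurs with a factor
    [x_i * x_j], at most [s] in modulus; at [s = 0] division by zero makes it 0. *)
Definition avg_slope g s := (g s - avg g s) / s.

Lemma is_derive_sqadd a b : is_derive a 1 (fun t : R => t ^+ 2 + b ^+ 2) (2 * a).
Proof.
have := is_deriveDR (is_deriveMR (is_derive_idR a) (is_derive_idR a)) (is_derive_cstR (b ^+ 2) a).
by rewrite mul1r mulr1 addr0 -mulr2n mulr_natl.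
Qed.

(** This settles the origin, where [avg g] itself need not be differentiable. *)
Lemma is_derive_mulid g : continuous g -> is_derive (0 : R) 1 (fun t => t * g t) (g 0).
Proof.
move=> cg; have l : (fun h : R => h^-1 *: ((h *: 1 + 0) * g (h *: 1 + 0) - 0 * g 0)) @ 0^' --> g 0.
  have c : g @ 0^' --> g 0 by apply: cvg_within_filter; exact: cg.
  apply: cvg_trans c; apply: near_eq_cvg; near=> h.
  rewrite mul0r subr0 addr0 [h *: 1]mulr1 -[RHS]/(h^-1 * (h * g h)) mulKf//; near: h.
  exact: nbhs_dnbhs_neq.
by apply: DeriveDef; [apply: cvgP l|exact: cvg_lim l].
Unshelve. all: end_near. Qed.

Lemma rad_field1 g a b : continuous g -> is_derive a 1 (fun t : R => t * avg g (t ^+ 2 + b ^+ 2))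
  (avg g (a ^+ 2 + b ^+ 2) + 2 * (a * a * avg_slope g (a ^+ 2 + b ^+ 2))).
Proof.
move=> cg; have [/eqP|s0] := eqVneq (a ^+ 2 + b ^+ 2) 0.
  rewrite paddr_eq0 ?sqr_ge0// !sqrf_eq0 => /andP[/eqP -> /eqP ->].
  have c : continuous (fun t : R => avg g (t ^+ 2 + 0 ^+ 2)).
    apply: cont_comp (continuous_avg cg); apply: contD; last exact: cont_cst.
    by apply: contX; exact: cont_id.
  by have := is_derive_mulid c; rewrite !mul0r mulr0 addr0.
have d := @is_derive_compR R (avg g) (fun t => t ^+ 2 + b ^+ 2) a _ _ (is_derive_avg s0 cg) (is_derive_sqadd a b).
have := is_deriveMR (is_derive_idR a) d; rewrite mul1r; congr is_derive.
by rewrite /avg_slope; ring.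
Qed.

Lemma rad_field2 g a b : continuous g -> is_derive a 1 (fun t : R => b * avg g (t ^+ 2 + b ^+ 2))
  (2 * (a * b * avg_slope g (a ^+ 2 + b ^+ 2))).
Proof.
move=> cg; have [/eqP|s0] := eqVneq (a ^+ 2 + b ^+ 2) 0.
  rewrite paddr_eq0 ?sqr_ge0// !sqrf_eq0 => /andP[/eqP -> /eqP ->].
  have := is_derive_cstR 0 (0 : R); rewrite !mul0r mulr0; congr is_derive.
  by apply/funext => t; rewrite mul0r.
have d := @is_derive_compR R (avg g) (fun t => t ^+ 2 + b ^+ 2) a _ _ (is_derive_avg s0 cg) (is_derive_sqadd a b).
have := is_deriveZR b d; congr is_derive.
by rewrite /avg_slope; ring.
Qed.

Lemma derive_rad_field g i j x : continuous g ->
  derivable (fun x => co i x * avg g (sqn x)) x (ax j) /\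
  'D_(ax j) (fun x => co i x * avg g (sqn x)) x =
    (if i == j then avg g (sqn x) else 0) + 2 * (co i x * co j x * avg_slope g (sqn x)).
Proof.
move=> cg; case: x => a b; case: i; case: j; rewrite /ax /co /sqn /=.
- by rewrite derivable_e1E derive_e1E; have [d e] := rad_field1 a b cg.
- rewrite derivable_e2E derive_e2E; have := rad_field2 b a cg.
  have -> : (fun t => a * avg g (t ^+ 2 + a ^+ 2)) = (fun t => a * avg g (a ^+ 2 + t ^+ 2)).
    by apply/funext => t; rewrite addrC.
  by move=> [d e]; split => //; rewrite add0r addrC [a * b]mulrC.
- rewrite derivable_e1E derive_e1E; have [d e] := rad_field2 a b cg; split => //.
  by rewrite add0r [b * a]mulrC.
- rewrite derivable_e2E derive_e2E; have := rad_field1 b a cg.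
  have -> : (fun t => t * avg g (t ^+ 2 + a ^+ 2)) = (fun t => t * avg g (a ^+ 2 + t ^+ 2)).
    by apply/funext => t; rewrite addrC.
  by rewrite [b ^+ 2 + _]addrC => -[d e]; split.
Qed.

Lemma continuous_rad g : continuous g -> continuous (fun x : R * R => g (sqn x)).
Proof. by move=> cg; apply: cont_comp cg; exact: continuous_sqn. Qed.

Lemma co_mul_le i j x : `|co i x * co j x| <= sqn x.
Proof.
case: x => a b; rewrite /sqn /co ler_norml; apply/andP; split; case: i; case: j => /=;
 have := sqr_ge0 (a + b); have := sqr_ge0 (a - b); have := sqr_ge0 a; have := sqr_ge0 b; nra.
Qed.

(** At the origin [|x_i * x_j| <= s] bounds the expression by [|g s - avg g s|], which tends to
    0. *)
Lemma continuous_slope g i j : continuous g ->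
  continuous (fun x => co i x * co j x * avg_slope g (sqn x)).
Proof.
move=> cg x0; have cG : continuous (fun x : R * R => g (sqn x) - avg g (sqn x)).
  by apply: contB; apply: continuous_rad => //; exact: continuous_avg.
have cc k : continuous (co k) by exact: C1_continuous (C1_co k).
have [x00|x00] := eqVneq (sqn x0) 0; last first.
  apply: cvgM; first by apply: cvgM; exact: cc.
  by apply: cvgM; [exact: cG|apply: cvgV => //; exact: continuous_sqn].
rewrite /continuous_at [X in _ --> X](_ : _ = 0); last by rewrite /avg_slope x00 invr0 !mulr0.
have bd (x : R * R) : `|co i x * co j x * avg_slope g (sqn x)| <= `|g (sqn x) - avg g (sqn x)|.
  have [s0|s0] := eqVneq (sqn x) 0; first by rewrite /avg_slope s0 invr0 !mulr0 normr0.
  rewrite /avg_slope mulrCA normrM ler_piMr// normrM normfV (ger0_norm (sqn_ge0 x)).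
  rewrite ler_pdivrMr ?lt0r ?s0 ?sqn_ge0// mul1r; exact: co_mul_le.
have lim : (fun x : R * R => `|g (sqn x) - avg g (sqn x)|) @ x0 --> (0 : R).
  have h := cvg_norm (cG x0); rewrite x00 avg0 subrr normr0 in h; exact: h.
apply/norm_cvg0P; apply: (squeeze_cvgr _ (cvg_cst (0 : R)) lim).
by apply: nearW => x; rewrite normr_ge0 /=; exact: bd.
Qed.

Lemma C1_rad_field g i : continuous g -> C1 (fun x => co i x * avg g (sqn x)).
Proof.
move=> cg; have ca := continuous_avg cg; have cd j : continuous (fun x => 'D_(ax j) (fun x => co i x * avg g (sqn x)) x).
  have c : continuous (fun x => (if i == j then avg g (sqn x) else 0) + 2 * (co i x * co j x * avg_slope g (sqn x))).
    apply: contD; last by apply: contZ; exact: continuous_slope.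
    by case: (i == j); [exact: continuous_rad|exact: cont_cst].
  by apply: eq_continuous2 c => x; rewrite (derive_rad_field i j x cg).2.
split; [|  |exact: (cd true)|exact: (cd false)].
  by move=> x; split; [exact: (derive_rad_field i true x cg).1|exact: (derive_rad_field i false x cg).1].
by apply: contM; [exact: C1_continuous (C1_co i)|exact: continuous_rad].
Qed.

(** In terms of [s] the divergence is [2 * avg g + 2 * s * (avg g)'], and [(s * avg g)' = g]. *)
Lemma div_rad_field g x : continuous g ->
  'D_(ax true) (fun x => co true x * avg g (sqn x)) x +
  'D_(ax false) (fun x => co false x * avg g (sqn x)) x = 2 * g (sqn x).
Proof.
move=> cg; rewrite (derive_rad_field true true x cg).2 (derive_rad_field false false x cg).2 /=.
have [s0|s0] := eqVneq (sqn x) 0.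
  by rewrite /avg_slope s0 invr0 !mulr0 !addr0 avg0; ring.
have : sqn x * avg_slope g (sqn x) = g (sqn x) - avg g (sqn x) by rewrite /avg_slope mulrC divfK.
rewrite {1}/sqn; move: (avg_slope _ _) (avg _ _) (g _) (x.1) (x.2) => e a c y z h.
have -> : c = (y ^+ 2 + z ^+ 2) * e + a by rewrite h subrK.
by ring.
Qed.

Lemma derive_rad_potential g c i x : continuous g ->
  derivable (fun x => c + mint g (sqn x)) x (ax i) /\
  'D_(ax i) (fun x => c + mint g (sqn x)) x = 2^-1 * (co i x * avg g (sqn x)).
Proof.
move=> cg; have d a b : is_derive a 1 (fun t => c + mint g (t ^+ 2 + b ^+ 2)) (2^-1 * (a * avg g (a ^+ 2 + b ^+ 2))).
  have d1 := @is_derive_compR R (mint g) (fun t => t ^+ 2 + b ^+ 2) a _ _ (is_derive_mint _ cg) (is_derive_sqadd a b).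
  have := is_deriveDR (is_derive_cstR c a) d1; rewrite add0r; congr is_derive.
  by field.
case: x => a b; case: i; rewrite /ax /co /sqn /=.
  by rewrite derivable_e1E derive_e1E; have [] := d a b.
rewrite derivable_e2E derive_e2E; have := d b a.
have -> : (fun t => c + mint g (t ^+ 2 + a ^+ 2)) = (fun t => c + mint g (a ^+ 2 + t ^+ 2)).
  by apply/funext => t; rewrite [t ^+ 2 + _]addrC.
by rewrite [b ^+ 2 + _]addrC => -[].
Qed.

Lemma C1_rad_potential g c : continuous g -> C1 (fun x => c + mint g (sqn x)).
Proof.
move=> cg; have ca := continuous_avg cg; have cm := continuous_mint cg.
have cd i : continuous (fun x => 'D_(ax i) (fun x => c + mint g (sqn x)) x).
  have h : continuous (fun x => 2^-1 * (co i x * avg g (sqn x))).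
    by apply: contZ; apply: contM; [exact: C1_continuous (C1_co i)|exact: continuous_rad].
  by apply: eq_continuous2 h => x; rewrite (derive_rad_potential c i x cg).2.
split; [|  |exact: (cd true)|exact: (cd false)].
  by move=> x; split; [exact: (derive_rad_potential c true x cg).1|exact: (derive_rad_potential c false x cg).1].
by apply: contD; [exact: cont_cst|exact: continuous_rad].
Qed.

Lemma C1_rad_flux g i : continuous g -> C1 (fun x => 2^-1 * (co i x * avg g (sqn x))).
Proof.
move=> cg; apply: C1M (C1_rad_field i cg).
have c0 : continuous (fun _ : R => 0 : R) by exact: cont_cst.
by have := C1_rad_potential (2^-1) c0; congr C1; apply/funext => x; rewrite mint_cst mul0r mul0r addr0.
Qed.

Lemma div_rad_flux g x : continuous g ->
  'D_(ax true) (fun x => 2^-1 * (co true x * avg g (sqn x))) x +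
  'D_(ax false) (fun x => 2^-1 * (co false x * avg g (sqn x))) x = g (sqn x).
Proof.
move=> cg; have e i : 'D_(ax i) (fun x => 2^-1 * (co i x * avg g (sqn x))) x =
    2^-1 * 'D_(ax i) (fun x => co i x * avg g (sqn x)) x.
  exact: (deriveZ 2^-1 ((C1_ax (C1_rad_field i cg) i).1 x)).
by rewrite !e -mulrDr div_rad_field// mulrA mulVf ?mul1r// pnatr_eq0.
Qed.
End RadialFields.

Section BoundedMultiplier.
Context {d} {T : measurableType d} {R : realType}.
Variables (mu : {measure set T -> \bar R}) (D : set T) (mD : measurable D).

Lemma sqintM_bounded (h k : T -> R) (M : R) : measurable_fun D h ->
  (forall x, D x -> `|h x| <= M) -> sqint mu D k ->
  sqint mu D (fun x => h x * k x) /\ nrm2 mu D (fun x => h x * k x) <= M ^+ 2 * nrm2 mu D k.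
Proof.
move=> mh hM [mk ik]; have i2 := integrableZl mD (M ^+ 2) ik.
have le x : D x -> (h x * k x) ^+ 2 <= M ^+ 2 * k x ^+ 2.
  move=> xD; rewrite exprMn ler_wpM2r ?sqr_ge0//.
  by rewrite -[h x ^+ 2]real_normK ?num_real// ler_pXn2r ?nnegrE ?hM// (le_trans _ (hM _ xD)).
have s : sqint mu D (fun x => h x * k x).
  split; first exact: measurable_funM.
  apply: le_integrable i2 => //.
    by apply/measurable_EFinP; apply: measurable_funX; exact: measurable_funM.
  by move=> x xD; rewrite /= lee_fin !ger0_norm ?sqr_ge0 ?le// mulr_ge0// sqr_ge0.
split => //; rewrite /nrm2 -RintegralZl//; apply: le_Rintegral => //; exact: s.2.
Qed.

End BoundedMultiplier.

(** * The linear Steklov problem with radial right-hand side *)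

Section LinearSteklov.
Context {R : realType}.
Notation P := (measurableTypeR R * measurableTypeR R)%type.
Variables (r : R) (r0 : 0 < r).
Let mD : measurable (disc r : set P) := measurable_disc r0.
Implicit Types (f u v w phi : R * R -> R) (x : R * R) (i : bool) (g G H : R -> R).
Notation sq f := (sqint leb2 (disc r) f).
Notation nrm f := (nrm2 leb2 (disc r) f).
Notation ipd f g := (ip leb2 (disc r) f g).
Notation wd i u := (wD (disc r) (ax i) u).
Notation arc := (`[0, 2 * pi]%classic : set (measurableTypeR R)).
Let mI : measurable arc := measurable_itv _.
Notation sqc f := (sqint leb1 arc (fun t => f (circle r t))).
Notation nrmc f := (nrm2 leb1 arc (fun t => f (circle r t))).
Notation S := (r ^+ 2).

Lemma fine_arc : fine (leb1 arc) = 2 * pi :> R.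
Proof.
have p := @pi_gt0 R; have -> : leb1 arc = (@lebesgue_measure R) `[0, 2 * pi]%classic by [].
by rewrite lebesgue_measure_itv /= lte_fin mulr_gt0//= subr0.
Qed.

Lemma circle_int_cst (c : R) : circle_int r (fun=> c) = r * (c * (2 * pi)).
Proof. by rewrite /circle_int Rintegral_cst// fine_arc. Qed.

Lemma eq_circle_int f f' : (forall t, f (circle r t) = f' (circle r t)) -> circle_int r f = circle_int r f'.
Proof. by move=> e; rewrite /circle_int; congr (_ * _); apply: eq_Rintegral => t _; rewrite e. Qed.

(** Polar coordinates by the divergence theorem: [H (sqn x)] is the divergence of the field
    [x * avg H / 2], whose flux through the circle is [pi * S * avg H S]. *)
Lemma radial_integral H : continuous H ->
  \int[leb2]_(x in disc r) H (sqn x) = pi * prim H S.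
Proof.
move=> cH; have hF i := C1_rad_flux i cH.
transitivity (\int[leb2]_(x in disc r) 'D_(ax true) (fun x => 2^-1 * (co true x * avg H (sqn x))) x +
    \int[leb2]_(x in disc r) 'D_(ax false) (fun x => 2^-1 * (co false x * avg H (sqn x))) x).
  rewrite -RintegralD//.
  - by apply: eq_Rintegral => x _; rewrite div_rad_flux.
  - exact: (continuous_integrable2 r0 (C1_ax (hF true) true).2).
  - exact: (continuous_integrable2 r0 (C1_ax (hF false) false).2).
rewrite (divergence_ax r0 true (hF true)) (divergence_ax r0 false (hF false)).
rewrite /circle_int -mulrDr -RintegralD//; last 2 first.
- apply: continuous_integrable1; apply: (@continuous_circle _ r (fun x => co true x / r * (2^-1 * (co true x * avg H (sqn x))))).
  apply: contM; last exact: C1_continuous (hF true).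
  by apply: contM; [exact: C1_continuous (C1_co true)|exact: cont_cst].
- apply: continuous_integrable1; apply: (@continuous_circle _ r (fun x => co false x / r * (2^-1 * (co false x * avg H (sqn x))))).
  apply: contM; last exact: C1_continuous (hF false).
  by apply: contM; [exact: C1_continuous (C1_co false)|exact: cont_cst].
transitivity (circle_int r (fun=> r / 2 * avg H S)).
  rewrite /circle_int; congr (_ * _); apply: eq_Rintegral => t _; rewrite !sqn_circle /co /=.
  have := cos2Dsin2 t; move: (cos t) (sin t) (avg H S) => a b c h.
  transitivity (r / 2 * c * (a ^+ 2 + b ^+ 2)); last by rewrite h mulr1.
  by field; rewrite gt_eqF.
by rewrite circle_int_cst -(mul_avg H S); field.
Qed.

(** Each test function approximating [phi] is integrated by parts against [F i] without boundary
    term, and both sides pass to the limit. *)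
Lemma flux_H10 phi (F : bool -> R * R -> R) : (forall i, C1 (F i)) -> H10 (disc r) phi ->
  ipd (F true) (wd true phi) + ipd (F false) (wd false phi) =
  - ipd (fun x => 'D_(ax true) (F true) x + 'D_(ax false) (F false) x) phi.
Proof.
move=> hF [hphi [w tw hw]]; have sw n : smooth (w n) by have [] := tw n.
have [s0 sd] := (H1_ax r0 phi).1 hphi.
have [c0 c1 c2] := (H1_cvgP r0 sw hphi).1 hw.
have sF i : sq (F i) by exact: C1_sq.
have sG i : sq (fun x => 'D_(ax i) (F i) x) by exact: C1_sqD.
have hwn n := smooth_C1 (sw n).
have t i n : ipd (fun x => 'D_(ax i) (w n) x) (F i) = - ipd (w n) (fun x => 'D_(ax i) (F i) x).
  have [_ h] := C1_weak r0 i (hF i); have := h _ (tw n).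
  move=> e; apply: etrans (ipC _ _ _ _) _; apply: etrans e _; congr (- _); exact: ipC.
have lim i : cvg2 leb2 (disc r) (fun n x => 'D_(ax i) (w n) x) (wd i phi) ->
    ipd (F i) (wd i phi) = - ipd (fun x => 'D_(ax i) (F i) x) phi.
  move=> c; apply: etrans (ipC _ _ _ _) _; apply: etrans (congr1 -%R (ipC _ _ _ _)).
  have l1 := cvg2_ip mD (fun n => C1_sqD r0 i (hwn n)) (sd i).2 (sF i) c.
  have l2 := cvg2_ip mD (fun n => C1_sq r0 (hwn n)) s0 (sG i) c0.
  have l3 := cvgN l2.
  have e : (fun n => ipd (fun x => 'D_(ax i) (w n) x) (F i)) = (fun n => - ipd (w n) (fun x => 'D_(ax i) (F i) x)).
    by apply/funext => n; exact: t.
  by rewrite e in l1; exact: (cvg_unique _ l1 (l3 _)).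
rewrite (lim true c1) (lim false c2) (ipDl mD (sG true) (sG false) s0).
by rewrite opprD.
Qed.

Variables (sigma : R) (hsigma : -1 < sigma).
(* On the circle [u_n = r / 2 * avg V S] when [V = Delta u], so that the second boundary
   condition is [V S = bcoef * avg V S]. *)
Definition bcoef : R := (1 - sigma) / 2.

Lemma bcoef_lt1 : bcoef < 1.
Proof. by rewrite /bcoef ltr_pdivrMr//; move: hsigma => h; lra. Qed.

(** The constant [c] for which [V = c + mint G] satisfies [V S = bcoef * avg V S]: a linear equation
    with leading coefficient [1 - bcoef]. *)
Definition vcst G : R := (bcoef * avg (mint G) S - mint G S) / (1 - bcoef).
Definition vsol G s : R := vcst G + mint G s.
Definition usol G s : R := mint (vsol G) s - mint (vsol G) S.
Definition zsol G x : R := usol G (sqn x).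

Lemma continuous_vsol G : continuous G -> continuous (vsol G).
Proof. by move=> cG; apply: contD; [exact: cont_cst|exact: continuous_mint]. Qed.

Lemma continuous_usol G : continuous G -> continuous (usol G).
Proof. by move=> cG; apply: contB; [exact: continuous_mint (continuous_vsol cG)|exact: cont_cst]. Qed.

Lemma vsol_boundary G : continuous G -> vsol G S = bcoef * avg (vsol G) S.
Proof.
move=> cG; have cm := continuous_mint cG.
have c0 : continuous (fun _ : R => vcst G) by exact: cont_cst.
rewrite /vsol (avgD _ c0 cm) avg_cst /vcst.
have : 1 - bcoef != 0 by rewrite gt_eqF// subr_gt0 bcoef_lt1.
by move: bcoef (avg _ _) (mint _ _) => k a b hk; field.
Qed.

Lemma C1_zsol G : continuous G -> C1 (zsol G).
Proof.
move=> cG; have := C1_rad_potential (- mint (vsol G) S) (continuous_vsol cG).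
by congr C1; apply/funext => x; rewrite addrC.
Qed.

Lemma derive_zsol G i x : continuous G -> 'D_(ax i) (zsol G) x = 2^-1 * (co i x * avg (vsol G) (sqn x)).
Proof.
move=> cG; rewrite -(derive_rad_potential (- mint (vsol G) S) i x (continuous_vsol cG)).2.
by congr ('D_(ax i) _ x); apply/funext => y; rewrite /zsol /usol addrC.
Qed.

Lemma zsol_circle G t : zsol G (circle r t) = 0.
Proof. by rewrite /zsol sqn_circle /usol subrr. Qed.

Lemma C1_dzsol G i : continuous G -> C1 (fun x => 'D_(ax i) (zsol G) x).
Proof.
move=> cG; have := C1_rad_flux i (continuous_vsol cG).
by congr C1; apply/funext => x; rewrite derive_zsol.
Qed.

Lemma wD_zsol G : continuous G -> H1 (disc r) (zsol G) /\
  forall i, nrm (fun x => wd i (zsol G) x - 'D_(ax i) (zsol G) x) = 0.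
Proof. by move=> cG; have h := C1_zsol cG; exact: (H1_null r0 h (C1_sq r0 h) (nrm_subrr r (zsol G))). Qed.

Lemma wD2_zsol G j : continuous G -> H1 (disc r) (wd j (zsol G)) /\
  forall i, nrm (fun x => wd i (wd j (zsol G)) x - 'D_(ax i) (fun y => 'D_(ax j) (zsol G) y) x) = 0.
Proof.
move=> cG; have [h e] := wD_zsol cG; have [_ sd] := (H1_ax r0 _).1 h.
exact: (H1_null r0 (C1_dzsol j cG) (sd j).2 (e j)).
Qed.

Lemma H2_zsol G : continuous G -> H2 (disc r) (zsol G).
Proof. by move=> cG; split; [exact: (wD_zsol cG).1|exact: (wD2_zsol true cG).1|exact: (wD2_zsol false cG).1]. Qed.

Lemma H10_zsol G : continuous G -> H10 (disc r) (zsol G).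
Proof. by move=> cG; apply: (H10_C1 r0 (C1_zsol cG)) => t; exact: zsol_circle. Qed.

Lemma sq_wlap phi : H2 (disc r) phi -> sq (wlaplacian (disc r) phi).
Proof.
move=> [_ h1 h2]; apply: (sqintD mD).
  exact: (((H1_ax r0 (wd true phi)).1 h1).2 true).2.
exact: (((H1_ax r0 (wd false phi)).1 h2).2 false).2.
Qed.

Lemma laplacian_zsol G x : continuous G ->
  'D_(ax true) (fun y => 'D_(ax true) (zsol G) y) x + 'D_(ax false) (fun y => 'D_(ax false) (zsol G) y) x
  = vsol G (sqn x).
Proof.
move=> cG; rewrite -(div_rad_flux x (continuous_vsol cG)).
by congr ('D_(ax true) _ x + 'D_(ax false) _ x); apply/funext => y; rewrite derive_zsol.
Qed.

Let zero_sum (n a b : R) : 0 <= n -> n <= 2 * a + 2 * b -> a = 0 -> b = 0 -> n = 0.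
Proof. by move=> n0 + a0 b0; rewrite a0 b0 mulr0 addr0 => ?; apply/eqP; rewrite eq_le n0 andbT. Qed.

Lemma wlap_zsol G : continuous G ->
  nrm (fun x => wlaplacian (disc r) (zsol G) x - vsol G (sqn x)) = 0.
Proof.
move=> cG; have [_ h1 h2] := H2_zsol cG.
have s1 := (((H1_ax r0 (wd true (zsol G))).1 h1).2 true).2.
have s2 := (((H1_ax r0 (wd false (zsol G))).1 h2).2 false).2.
have d1 := C1_sqD r0 true (C1_dzsol true cG); have d2 := C1_sqD r0 false (C1_dzsol false cG).
have h := nrm2D_le mD (sqintB mD s1 d1) (sqintB mD s2 d2).
have z := zero_sum (nrm2_ge0 _ _ _) h ((wD2_zsol true cG).2 true) ((wD2_zsol false cG).2 false).
apply: etrans z; apply: eq_nrm2 => x _.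
rewrite -(laplacian_zsol x cG) /wlaplacian.
by rewrite opprD addrACA.
Qed.

Definition nd_part phi i x : R := co i x / r * trace r (wd i phi) x.

Lemma normal_derivE phi x : normal_deriv r phi x = nd_part phi true x + nd_part phi false x.
Proof. by []. Qed.

Lemma continuous_co_r i : continuous (fun x => co i x / r).
Proof. by apply: contM; [exact: C1_continuous (C1_co i)|exact: cont_cst]. Qed.

Lemma circle_multiplier i (k : R * R -> R) : sqc k ->
  exists2 M, sqc (fun x => co i x / r * k x) & nrmc (fun x => co i x / r * k x) <= M * nrmc k.
Proof.
move=> sk; have [M _ hM] := cdisc_bounded r0 (@continuous_co_r i).
have mh : measurable_fun arc (fun t => co i (circle r t) / r).
  apply: measurable_funTS; apply: continuous_measurable_fun.
  exact: (@continuous_circle _ r (fun x => co i x / r) (@continuous_co_r i)).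
have hb t : arc t -> `|co i (circle r t) / r| <= M.
  by move=> _; apply: hM; apply/(cdisc_sqn r0); rewrite sqn_circle.
have [h1 h2] := sqintM_bounded mI mh hb sk.
by exists (M ^+ 2).
Qed.

Lemma sqc_trace u : H1 (disc r) u -> sqc (trace r u).
Proof. by move=> hu; have [] := (is_traceP r0 _ hu).1 (is_trace_trace r0 hu). Qed.

Lemma H2_ax phi i : H2 (disc r) phi -> H1 (disc r) (wd i phi).
Proof. by case: i => -[a b c]; [exact: b|exact: c]. Qed.

Lemma sqc_nd_part phi i : H2 (disc r) phi -> sqc (nd_part phi i).
Proof. by move=> h; have [M] := circle_multiplier i (sqc_trace (H2_ax i h)). Qed.

Lemma sqc_nd phi : H2 (disc r) phi -> sqc (normal_deriv r phi).
Proof. by move=> h; exact: (sqintD mI (sqc_nd_part true h) (sqc_nd_part false h)). Qed.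

Let nd_alg (a b c u v : R) : a ^+ 2 + b ^+ 2 = 1 ->
  r * a / r * u + r * b / r * v - r / 2 * c =
  r * a / r * (u - 2^-1 * (r * a * c)) + r * b / r * (v - 2^-1 * (r * b * c)).
Proof.
move=> hab; have -> : r / 2 * c = r / 2 * c * (a ^+ 2 + b ^+ 2) by rewrite hab mulr1.
by field; rewrite gt_eqF.
Qed.

(** The gradient of [zsol G] is [x * avg V / 2], whose normal component is constant on the circle;
    [trace_null] carries this over to the chosen traces. *)
Lemma nd_zsol G : continuous G ->
  nrmc (fun x => normal_deriv r (zsol G) x - r / 2 * avg (vsol G) S) = 0.
Proof.
move=> cG; have hz := H2_zsol cG.
have sd i : sqc (fun x => 'D_(ax i) (zsol G) x).
  exact: (@continuous_sqc _ r (fun x => 'D_(ax i) (zsol G) x) (C1_continuous (C1_dzsol i cG))).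
have tn i : nrmc (fun x => trace r (wd i (zsol G)) x - 'D_(ax i) (zsol G) x) = 0.
  have [_ e] := wD_zsol cG; apply: (trace_null r0 (C1_dzsol i cG)); last exact: e.
  exact: ((H1_ax r0 _).1 (H2_ax i hz)).1.
have sk i := sqintB mI (sqc_trace (H2_ax i hz)) (sd i).
have [M1 s1 n1] := @circle_multiplier true (fun x => trace r (wd true (zsol G)) x - 'D_(ax true) (zsol G) x) (sk true).
have [M2 s2 n2] := @circle_multiplier false (fun x => trace r (wd false (zsol G)) x - 'D_(ax false) (zsol G) x) (sk false).
have z1 : nrmc (fun x => co true x / r * (trace r (wd true (zsol G)) x - 'D_(ax true) (zsol G) x)) = 0.
  by apply/eqP; rewrite eq_le nrm2_ge0 andbT; apply: le_trans n1 _; rewrite tn mulr0.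
have z2 : nrmc (fun x => co false x / r * (trace r (wd false (zsol G)) x - 'D_(ax false) (zsol G) x)) = 0.
  by apply/eqP; rewrite eq_le nrm2_ge0 andbT; apply: le_trans n2 _; rewrite tn mulr0.
have z := zero_sum (nrm2_ge0 _ _ _) (nrm2D_le mI s1 s2) z1 z2.
apply: etrans z; apply: eq_nrm2 => t _.
rewrite normal_derivE /nd_part !derive_zsol// sqn_circle /co /=.
exact: nd_alg (cos2Dsin2 t).
Qed.

Let form_alg (a1 a2 b1 b2 n1 n2 N c v I : R) : a1 + b1 = r * (v * n1) -> a2 + b2 = r * (v * n2) ->
  N = n1 + n2 -> a1 + a2 = - I -> v = (1 - sigma) / 2 * c ->
  b1 + b2 - (1 - sigma) * (r * (r^-1 * (r / 2 * c * N))) = I.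
Proof.
move=> h1 h2 hN h3 hv.
have -> : r * (r^-1 * (r / 2 * c * N)) = r / 2 * c * N by rewrite mulrA mulfV ?mul1r// gt_eqF.
have -> : (1 - sigma) * (r / 2 * c * N) = r * (v * N) by rewrite hv; field.
have : r * (v * N) = r * (v * n1) + r * (v * n2) by rewrite hN; ring.
by lra.
Qed.

(** Green's formula moves one derivative from [phi] to [V = Delta (zsol G)]. Its boundary term
    cancels the curvature term because [V S = bcoef * avg V S]; the remaining integral of the two
    gradients becomes that of [G * phi] because [phi] is in [H10] and [Delta V = G]. *)
Theorem zsol_weak G phi : continuous G -> H2 (disc r) phi -> H10 (disc r) phi ->
  \int[leb2]_(x in disc r) (wlaplacian (disc r) (zsol G) x * wlaplacian (disc r) phi x)
  - (1 - sigma) * circle_int r (fun x => r^-1 * normal_deriv r (zsol G) x * normal_deriv r phi x)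
  = \int[leb2]_(x in disc r) (G (sqn x) * phi x).
Proof.
move=> cG hphi h0; pose V x := vsol G (sqn x); have cv := continuous_vsol cG.
have hz := H2_zsol cG; have C1V : C1 V := C1_rad_potential (vcst G) cG.
have sV : sq V := C1_sq r0 C1V.
have dV i x : 'D_(ax i) V x = 2^-1 * (co i x * avg G (sqn x)) := (derive_rad_potential (vcst G) i x cG).2.
have hp i := H2_ax i hphi.
have s2 i : sq (wd i (wd i phi)) := (((H1_ax r0 (wd i phi)).1 (hp i)).2 i).2.
have sn := sqc_nd hphi; have sz := sqc_nd hz; have snp i := sqc_nd_part i hphi.
have s1 : sqint leb1 arc (fun=> 1 : R).
  by apply: (@continuous_sqc _ r (fun=> 1)); exact: cont_cst.
pose N := ip leb1 arc (fun=> 1) (fun t => normal_deriv r phi (circle r t)).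
have cst_ip (c : R) (k : R * R -> R) : sqc k ->
    ip leb1 arc (fun=> c) (fun t => k (circle r t)) = c * ip leb1 arc (fun=> 1) (fun t => k (circle r t)).
  move=> sk; rewrite -(ipZl mI c s1 sk); congr ip; apply/funext => t; by rewrite mulr1.
have -> : \int[leb2]_(x in disc r) (wlaplacian (disc r) (zsol G) x * wlaplacian (disc r) phi x) =
    ipd V (wlaplacian (disc r) phi).
  exact: (ip_eq_of_nrm2 mD (sq_wlap hz) sV (sq_wlap hphi) (wlap_zsol cG)).
have -> : ipd V (wlaplacian (disc r) phi) = ipd V (wd true (wd true phi)) + ipd V (wd false (wd false phi)).
  exact: (ipDr mD (s2 true) (s2 false) sV).
have gr i := green r0 i C1V (hp i).
have ci i : circle_int r (fun x => co i x / r * V x * trace r (wd i phi) x) =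
    r * (vsol G S * ip leb1 arc (fun=> 1) (fun t => nd_part phi i (circle r t))).
  rewrite -cst_ip// /circle_int /ip; congr (_ * _); apply: eq_Rintegral => t _.
  by rewrite /V sqn_circle /nd_part; ring.
have NE : N = ip leb1 arc (fun=> 1) (fun t => nd_part phi true (circle r t)) +
    ip leb1 arc (fun=> 1) (fun t => nd_part phi false (circle r t)).
  exact: (ipDr mI (snp true) (snp false) s1).
have fl := flux_H10 (fun i => C1_rad_flux i cG) h0.
have flE : ipd (fun x => 'D_(ax true) V x) (wd true phi) + ipd (fun x => 'D_(ax false) V x) (wd false phi) =
    - \int[leb2]_(x in disc r) (G (sqn x) * phi x).
  have eV i : ipd (fun x => 'D_(ax i) V x) (wd i phi) = ipd (fun x => 2^-1 * (co i x * avg G (sqn x))) (wd i phi).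
    by apply: eq_Rintegral => x _; rewrite dV.
  apply: etrans (f_equal2 +%R (eV true) (eV false)) _; apply: etrans fl _; congr (- _); apply: eq_Rintegral => x _; by rewrite div_rad_flux.
pose c0 := r / 2 * avg (vsol G) S.
have sc0 : sqint leb1 arc (fun=> c0) by apply: (@continuous_sqc _ r (fun=> c0)); exact: cont_cst.
have nn : ip leb1 arc (fun t => normal_deriv r (zsol G) (circle r t)) (fun t => normal_deriv r phi (circle r t)) = c0 * N.
  exact: etrans (ip_eq_of_nrm2 mI sz sc0 sn (nd_zsol cG)) (cst_ip c0 _ sn).
have cE : circle_int r (fun x => r^-1 * normal_deriv r (zsol G) x * normal_deriv r phi x) = r * (r^-1 * (c0 * N)).
  by rewrite -nn -(ipZl mI r^-1 sz sn).
rewrite cE; exact: form_alg (etrans (gr true) (ci true)) (etrans (gr false) (ci false)) NE flE (vsol_boundary cG).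
Qed.
End LinearSteklov.

(** * The power nonlinearity *)

Section PositivePower.
Context {R : realType}.
Variables (p : R) (p0 : 0 < p).
Implicit Types (x y : R).

(** Extending the nonlinearity by 0 to negative values keeps it continuous and monotone on the line,
    so that solutions may be followed past their zeros. *)
Definition ppow x : R := Num.max x 0 `^ p.

Lemma ppow_ge0 x : 0 <= ppow x.
Proof. exact: powR_ge0. Qed.

Lemma ppowE x : 0 <= x -> ppow x = x `^ p.
Proof. by move=> x0; rewrite /ppow max_l. Qed.

Lemma ppow_gt0 x : 0 < x -> 0 < ppow x.
Proof. by move=> x0; rewrite ppowE ?ltW// powR_gt0. Qed.

Lemma ppow_le x y : x <= y -> ppow x <= ppow y.
Proof.
move=> xy; apply: ge0_ler_powR; rewrite ?nnegrE ?le_max ?lexx ?orbT// ?(ltW p0)//.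
by rewrite -le_max ge_max !le_max xy lexx !orbT.
Qed.

Lemma continuous_maxr (c : R) : continuous (fun x : R => Num.max x c).
Proof.
have -> : (fun x : R => Num.max x c) = (fun x => (x + c + `|x - c|) / 2).
  by apply/funext => x; rewrite maxr_absE.
apply: contM; last exact: cont_cst.
apply: contD; first by apply: contD; [exact: cont_id|exact: cont_cst].
move=> x; apply: cvg_norm; apply: cvgB; [exact: cvg_id|exact: cvg_cst].
Qed.

Lemma continuous_minr (c : R) : continuous (fun x : R => Num.min x c).
Proof.
have -> : (fun x : R => Num.min x c) = (fun x => - Num.max (- x) (- c)).
  by apply/funext => x; rewrite oppr_max !opprK.
apply: contN; have h := @cont_comp R R R (fun x => - x) _ (contN (@cont_id R)) (@continuous_maxr (- c)).
exact: h.
Qed.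

Lemma continuous_ppow : continuous ppow.
Proof.
move=> x; have cm := @continuous_maxr 0 x.
have [x0|x0] := ltP 0 x.
  apply: (@continuous_comp _ _ _ (fun x => Num.max x 0) (fun y => y `^ p)) => //.
  rewrite max_l ?ltW//; apply: differentiable_continuous; apply/derivable1_diffP.
  by apply: derivable_powR; rewrite in_itv /= x0.
rewrite /continuous_at {2}/ppow max_r// powR0 ?gt_eqF//.
apply/cvgrPdist_lt => e e0; have d0 : 0 < e `^ p^-1 by exact: powR_gt0.
rewrite /continuous_at max_r// in cm.
have /cvgrPdist_lt/(_ _ d0) h := cm; near=> t.
rewrite sub0r normrN ger0_norm ?ppow_ge0//.
have -> : e = (e `^ p^-1) `^ p by rewrite -powRrM mulVf ?gt_eqF// powRr1// ltW.
apply: gt0_ltr_powR; rewrite ?nnegrE ?powR_ge0 ?le_max ?lexx ?orbT//.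
have : `|0 - Num.max t 0| < e `^ p^-1 by near: t.
by rewrite sub0r normrN; exact: le_lt_trans (ler_norm _).
Unshelve. all: end_near. Qed.

Lemma ppow_nonlinearity x : 0 < x -> `|x| `^ (p - 1) * x = ppow x.
Proof. by move=> x0; rewrite gtr0_norm// mulrC mulr_powRB1 ?ltW// ppowE ?ltW. Qed.
End PositivePower.

(** * Radial solutions on the disc and their profiles *)

Section RadialProfiles.
Context {R : realType}.
Notation P := (measurableTypeR R * measurableTypeR R)%type.
Variables (r : R) (r0 : 0 < r) (p : R) (p0 : 0 < p) (sigma : R) (hsigma : -1 < sigma).
Notation S := (r ^+ 2).
Implicit Types (v : R * R -> R) (x : R * R) (h g f : R -> R) (s t a b : R).
Let mD : measurable (disc r : set P) := measurable_disc r0.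

Let S0 : 0 < S. Proof. by rewrite exprn_gt0. Qed.

Definition clampS s : R := Num.min (Num.max s 0) S.

Lemma clampS_bounds s : 0 <= clampS s <= S.
Proof. by rewrite /clampS le_min le_max lexx orbT (ltW S0) ge_min lexx orbT. Qed.

Lemma clampSE s : 0 <= s <= S -> clampS s = s.
Proof. by move=> /andP[h1 h2]; rewrite /clampS max_l// min_l. Qed.

Lemma continuous_clampS : continuous clampS.
Proof. exact: cont_comp (@continuous_maxr R 0) (@continuous_minr R S). Qed.

(** A radius parametrised by the squared norm. Clamping keeps it inside the closed disc, so a
    profile is continuous on the whole line although the solution is continuous only within that
    disc. *)
Definition ray s : R * R := (Num.sqrt (clampS s), 0).

Lemma sqn_ray s : sqn (ray s) = clampS s.
Proof.
rewrite /sqn /ray /= expr0n /= addr0 sqr_sqrtr//.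
by have /andP[] := clampS_bounds s.
Qed.

Lemma cdisc_ray s : cdisc r (ray s).
Proof. by apply/(cdisc_sqn r0); rewrite sqn_ray; have /andP[] := clampS_bounds s. Qed.

Lemma continuous_ray : continuous ray.
Proof.
apply: cont_pair; last exact: cont_cst.
by apply: cont_comp continuous_clampS _; exact: sqrt_continuous.
Qed.

Lemma cdisc_clamp x : cdisc r x -> clampS (sqn x) = sqn x.
Proof. by move/(cdisc_sqn r0) => h; rewrite clampSE// sqn_ge0. Qed.

Lemma radial_profile v : {within cdisc r, continuous v} -> radial r v ->
  continuous (fun s => v (ray s)) /\ forall x, cdisc r x -> v x = v (ray (sqn x)).
Proof.
move=> cv rv; split.
  move=> s; have /subspace_continuousP/(_ _ (cdisc_ray s)) hv := cv.
  apply: cvg_trans hv => U /= hU.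
  have h := @continuous_ray s _ hU; change (\forall t \near s, U (v (ray t))).
  near=> t; have : cdisc r (ray t) -> U (v (ray t)) by near: t; exact: h.
  by apply; exact: cdisc_ray.
move=> x xD; apply: rv => //; first exact: cdisc_ray.
by rewrite /enorm -!/(sqn _) sqn_ray cdisc_clamp.
Unshelve. all: end_near. Qed.

Lemma prim_eq0 f b : continuous f -> 0 < b -> (forall t, 0 <= t -> 0 <= f t) -> prim f b = 0 ->
  forall t, 0 <= t <= b -> f t = 0.
Proof.
move=> cf b0 f0 pb t /andP[t0 tb]; apply/eqP; apply: contraT => ft.
have c0 : 0 < f t / 2 by rewrite divr_gt0// lt0r ft f0.
have /cvgrPdist_lt/(_ _ c0) := cf t; rewrite near_nbhs => /nbhs_ballP[d d0 hd].
pose a := Num.max 0 (t - d / 2); pose c := Num.min b (t + d / 2).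
have d2 : 0 < d / 2 by rewrite divr_gt0.
have ac : a < c.
  by rewrite /a /c gt_max !lt_min b0 /=; apply/andP; split; [|apply/andP; split]; move: d0 d2 => /= d0 d2; lra.
have a0 : 0 <= a by rewrite /a le_max lexx.
have cb : c <= b by rewrite /c ge_min lexx.
have hf (x : R) : a <= x <= c -> 0 <= f x - f t / 2.
  move=> /andP[ax xc]; have : `|t - x| < d.
    have : t - d / 2 <= x by apply: le_trans ax; rewrite /a le_max lexx orbT.
    have : x <= t + d / 2 by apply: le_trans xc _; rewrite /c ge_min lexx orbT.
    by move: d0 => /= d0 h1 h2; rewrite ltr_norml; apply/andP; split; lra.
  by move/hd => /=; rewrite ltr_norml => /andP[_]; lra.
have := @derive_ge0_le R (fun x : R => prim f x - f t / 2 * x) (fun x : R => f x - f t / 2) a c (ltW ac) _ hf.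
have pa : 0 <= prim f a by apply: prim_ge0 => [//|//|u /andP[u0 _]]; exact: f0.
have pc : prim f c <= 0 by rewrite -pb; apply: prim_nondecr => //; exact: le_trans (ltW ac).
move=> H; have : prim f a - f t / 2 * a <= prim f c - f t / 2 * c.
  apply: H => x; have := is_deriveBR (is_derive_prim x cf) (is_deriveZR (f t / 2) (is_derive_idR x)).
  by rewrite mulr1.
have : 0 < f t / 2 * (c - a) by rewrite mulr_gt0// subr_gt0.
by move: (prim f a) (prim f c) pa pc (f t / 2) => A B ? ? C; nra.
Qed.

Lemma form_sym u w : 
  \int[leb2]_(x in disc r) (wlaplacian (disc r) u x * wlaplacian (disc r) w x)
  - (1 - sigma) * circle_int r (fun x => r^-1 * normal_deriv r u x * normal_deriv r w x) =
  \int[leb2]_(x in disc r) (wlaplacian (disc r) w x * wlaplacian (disc r) u x)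
  - (1 - sigma) * circle_int r (fun x => r^-1 * normal_deriv r w x * normal_deriv r u x).
Proof.
apply: (f_equal2 (fun a b => a - (1 - sigma) * b)); first exact: (ipC leb2).
by apply: eq_circle_int => t; exact: mulrAC.
Qed.

(* With [g := f - zF], testing both equations with the linear solution for [g] gives
   [\int g (v - zF) = 0] by the symmetry of the form, that is [\int g^2 = 0]. *)
Theorem profile_of_solution v : positive_radial_solution r r^-1 sigma p v ->
  exists f, [/\ continuous f, forall x, cdisc r x -> v x = f (sqn x),
    forall s, 0 <= s < S -> 0 < f s &
    forall s, 0 <= s <= S -> f s = usol r sigma (fun t => ppow p (f t)) s].
Proof.
move=> [[hv h0v wv] cv pv rv]; have [cf fE] := radial_profile cv rv.
pose f s := v (ray s); have fE' x : cdisc r x -> v x = f (sqn x) := fE x.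
exists f; pose F t := ppow p (f t).
have cF : continuous F := cont_comp cf (continuous_ppow p0).
have fpos s : 0 <= s < S -> 0 < f s.
  move=> /andP[s0 s1]; apply: pv; apply/(disc_sqn r0).
  by rewrite sqn_ray clampSE// s0 ltW.
split => // s hs.
pose zF := usol r sigma F; have czF : continuous zF by exact: continuous_usol.
pose g t := f t - zF t; have cg : continuous g by apply: contB.
have rhs phi : \int[leb2]_(x in disc r) (`|v x| `^ (p - 1) * v x * phi x) =
    \int[leb2]_(x in disc r) (F (sqn x) * phi x).
  apply: eq_Rintegral => x /set_mem xD; have xC := disc_cdisc xD.
  by rewrite ppow_nonlinearity ?pv// /F -fE'.
have hg := H2_zsol r0 sigma cg; have h0g := H10_zsol r0 sigma cg.
have hF := H2_zsol r0 sigma cF; have h0F := H10_zsol r0 sigma cF.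
have e1' := wv _ hg h0g; rewrite rhs in e1'.
have e2' := zsol_weak r0 hsigma cg hv h0v.
have e3 := zsol_weak r0 hsigma cF hg h0g.
have e4 := zsol_weak r0 hsigma cg hF h0F.
have e5 : \int[leb2]_(x in disc r) (g (sqn x) * v x) = \int[leb2]_(x in disc r) (g (sqn x) * zsol r sigma F x).
  exact: etrans (esym e2') (etrans (form_sym _ _) (etrans e1' (etrans (esym e3) (etrans (form_sym _ _) e4)))).
have cgs := continuous_rad cg.
have e6 : \int[leb2]_(x in disc r) (fun t => g t * g t) (sqn x) = 0.
  transitivity (\int[leb2]_(x in disc r) (g (sqn x) * v x) - \int[leb2]_(x in disc r) (g (sqn x) * zsol r sigma F x)); last by rewrite e5 subrr.
  rewrite -RintegralB//.
  - by apply: eq_Rintegral => x /set_mem xD; rewrite -mulrBr /zsol -/zF (fE' _ (disc_cdisc xD)).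
  - apply: (@sqint_mul _ _ _ leb2 (disc r) mD (fun x => g (sqn x)) v); first exact: continuous_sqint2.
    by have [h _ _] := hv; have [] := (H1_ax r0 v).1 h.
  - apply: continuous_integrable2 => //; apply: contM => //.
    exact: continuous_rad czF.
have e8 := etrans (esym (radial_integral r0 (contM cg cg))) e6.
have e7 : prim (fun t => g t * g t) S = 0.
  by apply/eqP; move/eqP: e8; rewrite mulf_eq0 (gt_eqF (pi_gt0 R)).
have g2 t : 0 <= t -> 0 <= g t * g t by move=> _; exact: sqr_ge0.
have /eqP : g s * g s = 0 := prim_eq0 (contM cg cg) S0 g2 e7 hs.
by rewrite mulf_eq0 orbb subr_eq0 => /eqP.
Qed.

(** The solution is given as the explicit [usol], for which regularity and the weak equation are
    available everywhere; it agrees with [f] on the disc. *)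
Theorem solution_of_profile f : continuous f -> (forall s, 0 <= s < S -> 0 < f s) ->
  (forall s, 0 <= s <= S -> f s = usol r sigma (fun t => ppow p (f t)) s) ->
  positive_radial_solution r r^-1 sigma p (fun x => usol r sigma (fun t => ppow p (f t)) (sqn x)).
Proof.
move=> cf f0 fE; pose F t := ppow p (f t); have cF : continuous F := cont_comp cf (continuous_ppow p0).
have fD x : disc r x -> 0 <= sqn x < S by move/(disc_sqn r0) => h; rewrite sqn_ge0.
have uE x : disc r x -> usol r sigma F (sqn x) = f (sqn x).
  by move/fD/andP => [a b]; rewrite fE// a ltW.
have C1z := C1_zsol r sigma cF.
split.
- split; [exact: (H2_zsol r0 sigma cF)|exact: (H10_zsol r0 sigma cF)|].
  move=> phi hphi h0; rewrite (zsol_weak r0 hsigma cF hphi h0).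
  apply: eq_Rintegral => x /set_mem xD; rewrite -/F uE//.
  by rewrite ppow_nonlinearity// f0// fD.
- apply: continuous_subspaceT; exact: (C1_continuous C1z).
- by move=> x xD; rewrite -/F uE// f0// fD.
- move=> x y xD yD e; congr (usol _ _ _ _).
  have := congr1 (fun t => t ^+ 2) e; rewrite /enorm !sqr_sqrtr//; exact: sqn_ge0.
Qed.
End RadialProfiles.

(** * The initial value problem for radial profiles *)

Section Comparison.
Context {R : realType}.
Implicit Types (f g d U : R -> R) (s t a b L x y : R).

Lemma first_zero d L : continuous d -> 0 < d 0 -> 0 <= L -> d L <= 0 ->
  exists s, [/\ 0 < s <= L, d s = 0 & forall t, 0 <= t -> t < s -> 0 < d t].
Proof.
move=> cd d0 L0 dL; pose A := [set t | 0 <= t <= L /\ d t <= 0].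
have AL : A L by split => //; rewrite L0 lexx.
have lbA : lbound A 0 by move=> t [/andP[]].
have hA : has_inf A by split; [exists L|exists 0].
pose s := inf A.
have s0 : 0 <= s by apply: lb_le_inf => //; exists L.
have sL : s <= L by apply: ge_inf => //; exists 0.
have below t : 0 <= t -> t < s -> 0 < d t.
  move=> t0 ts; rewrite ltNge; apply/negP => dt.
  have : s <= t by apply: ge_inf; [exists 0|split; rewrite ?t0 ?(le_trans (ltW ts))].
  by rewrite leNgt ts.
have ds : d s <= 0.
  rewrite leNgt; apply/negP => dpos.
  have /cvgrPdist_lt/(_ _ dpos) := cd s; rewrite near_nbhs => /nbhs_ballP[e /= e0 he].
  have [t [tL dt] ts] := inf_adherent e0 hA.
  have st : s <= t by apply: ge_inf; [exists 0|].
  have : `|s - t| < e by rewrite distrC ger0_norm ?subr_ge0// ltrBlDl.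
  by move/he => /=; rewrite ltr_norml => /andP[_]; move: dt; lra.
exists s; split => //.
- rewrite sL andbT lt0r s0 andbT; apply/eqP => se; move: ds d0; rewrite se; lra.
- apply/eqP; rewrite eq_le ds /= leNgt; apply/negP => dneg.
  have nd : 0 < - d s by rewrite oppr_gt0.
  have /cvgrPdist_lt/(_ _ nd) := cd s; rewrite near_nbhs => /nbhs_ballP[e /= e0 he].
  have sp : 0 < s by rewrite lt0r s0 andbT; apply/eqP => se; move: ds d0; rewrite se; lra.
  pose t := Num.max 0 (s - e / 2).
  have ts : t < s by rewrite /t gt_max sp /=; move: e0; lra.
  have t0 : 0 <= t by rewrite /t le_max lexx.
  have := below t t0 ts.
  have : `|s - t| < e.
    rewrite ger0_norm ?subr_ge0 ?ltW//.
    have : s - e / 2 <= t by rewrite /t le_max lexx orbT.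
    by move: e0; lra.
  by move/he => /=; rewrite ltr_norml => /andP[]; lra.
Qed.

Definition Kop g s := mint (mint g) s.
(** For [V = - 4 * b + mint g] the boundary condition [V s = k * avg V s] reads
    [Pop k g s = 4 * b * (1 - k)]. *)
Definition Pop (k : R) g s := mint g s - k * avg (mint g) s.

Lemma continuous_Kop g : continuous g -> continuous (Kop g).
Proof. by move=> cg; exact: continuous_mint (continuous_mint cg). Qed.

Lemma continuous_Pop k g : continuous g -> continuous (Pop k g).
Proof.
move=> cg; have cm := continuous_mint cg; apply: contB => //.
by apply: contZ; exact: continuous_avg.
Qed.

Lemma Kop_le f g s : continuous f -> continuous g -> 0 <= s ->
  (forall t, 0 <= t <= s -> f t <= g t) -> Kop f s <= Kop g s.
Proof.
move=> cf cg s0 h; apply: mint_le => [||//|t /andP[t0 ts]]; [exact: continuous_mint..|].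
by apply: mint_le => // u /andP[u0 ut]; apply: h; rewrite u0 (le_trans ut).
Qed.

Lemma Kop_ext f g s : continuous f -> continuous g -> 0 <= s ->
  (forall t, 0 <= t <= s -> f t = g t) -> Kop f s = Kop g s.
Proof. by move=> cf cg s0 h; apply/le_anti/andP; split; apply: Kop_le => [//|//|//|t ht]; rewrite h. Qed.

Lemma KopZ c g s : continuous g -> Kop (fun t => c * g t) s = c * Kop g s.
Proof.
move=> cg; have e : mint (fun t => c * g t) = (fun t => c * mint g t) by apply/funext => t; exact: mintZ.
by rewrite /Kop e mintZ//; exact: continuous_mint.
Qed.

Lemma KopB f g s : continuous f -> continuous g -> Kop (fun t => f t - g t) s = Kop f s - Kop g s.
Proof.
move=> cf cg; have cn : continuous (fun t => -1 * g t) by exact: contZ.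
have e : (fun t => f t - g t) = (fun t => f t + -1 * g t) by apply/funext => t; rewrite mulN1r.
have e2 : mint (fun t => f t + -1 * g t) = (fun t => mint f t + mint (fun t => -1 * g t) t).
  by apply/funext => t; exact: mintD.
rewrite e -(mulN1r (Kop g s)) -KopZ// /Kop e2 mintD//; exact: continuous_mint.
Qed.

Lemma Kop_avg g s : continuous g -> Kop g s = s * (avg (avg (mint g)) s / 4).
Proof. by move=> cg; rewrite mulrA mul_avg /Kop {1}mint.unlock. Qed.

Lemma Pop_ext k f g s : continuous f -> continuous g -> 0 <= s ->
  (forall t, 0 <= t <= s -> f t = g t) -> Pop k f s = Pop k g s.
Proof.
move=> cf cg s0 h; have e : avg (mint f) s = avg (mint g) s.
  apply: avg_ext => [||//|t /andP[t0 ts]]; [exact: continuous_mint..|].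
  by apply: mint_ext => // u /andP[u0 ut]; apply: h; rewrite u0 (le_trans ut).
rewrite /Pop.
rewrite e.
have e2 := mint_ext cf cg s0 h.
rewrite e2.
by [].
Qed.

(** For [0 <= k < 1] both coefficients are nonnegative and both terms are monotone in [g >= 0] and
    in [s]. For [k < 0] the definition of [Pop] already has this shape. These are the two cases of
    the sign and monotonicity lemmas. *)
Lemma PopE k g s : continuous g ->
  Pop k g s = (1 - k) * mint g s + k * avg (fun t => prim g t / 4) s.
Proof. by move=> cg; rewrite -mint_sub_avg// /Pop; ring. Qed.

Lemma PopB k f g s : continuous f -> continuous g -> Pop k (fun t => f t - g t) s = Pop k f s - Pop k g s.
Proof.
move=> cf cg; have cn : continuous (fun t => -1 * g t) by exact: contZ.
have e : (fun t => f t - g t) = (fun t => f t + -1 * g t) by apply/funext => t; rewrite mulN1r.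
have e2 : mint (fun t => f t + -1 * g t) = (fun t => mint f t + -1 * mint g t).
  by apply/funext => t; rewrite mintD// mintZ.
have cm := continuous_mint cf; have cm' := continuous_mint cg.
have cm2 : continuous (fun t => -1 * mint g t) by exact: contZ.
rewrite e.
rewrite /Pop.
rewrite e2.
rewrite (avgD _ cm cm2).
rewrite (avgZ _ _ cm').
move: (mint f s) (mint g s) (avg (mint f) s) (avg (mint g) s) => A B C D.
by ring.
Qed.

Lemma Pop_ge0 k g s : k < 1 -> continuous g -> 0 <= s -> (forall t, 0 <= t <= s -> 0 <= g t) ->
  0 <= Pop k g s.
Proof.
move=> k1 cg s0 g0; have cz : continuous (fun _ : R => 0 : R) by exact: cont_cst.
have mg t : 0 <= t <= s -> 0 <= mint g t.
  move=> /andP[t0 ts]; have := mint_le cz cg t0; rewrite mint_cst !mul0r; apply.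
  by move=> u /andP[u0 ut]; apply: g0; rewrite u0 (le_trans ut).
have ms := mg s; rewrite s0 lexx in ms; have {}ms := ms isT.
have [k0|k0] := leP 0 k.
  rewrite PopE//; apply: addr_ge0; first by rewrite mulr_ge0// subr_ge0 ltW.
  apply: mulr_ge0 => //; rewrite -[leLHS](avg_cst 0 s); apply: avg_le => //.
    by apply: contM; [exact: continuous_prim|exact: cont_cst].
  move=> t /andP[t0 ts]; rewrite divr_ge0// prim_ge0// => u /andP[u0 ut].
  by apply: g0; rewrite u0 (le_trans ut).
rewrite /Pop -mulNr; apply: addr_ge0 => //; apply: mulr_ge0; first by rewrite oppr_ge0 ltW.
by rewrite -[leLHS](avg_cst 0 s); apply: avg_le => //; exact: continuous_mint.
Qed.

Lemma Pop_nondecr k g a b : k < 1 -> continuous g -> (forall t, 0 <= t -> 0 <= g t) ->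
  0 <= a -> a <= b -> Pop k g a <= Pop k g b.
Proof.
move=> k1 cg g0 a0 ab; have m1 := mint_nondecr cg g0 a0 ab.
have [k0|k0] := leP 0 k.
  rewrite !PopE//; apply: lerD; first by rewrite ler_wpM2l// subr_ge0 ltW.
  rewrite ler_wpM2l//; apply: avg_nondecr => //.
    by apply: contM; [exact: continuous_prim|exact: cont_cst].
  by move=> c d c0 cd; rewrite ler_wpM2r ?invr_ge0//; exact: prim_nondecr.
rewrite /Pop -!mulNr; apply: lerD => //; rewrite ler_wpM2l ?oppr_ge0 ?(ltW k0)//.
apply: avg_nondecr => //; first exact: continuous_mint.
by move=> c d c0 cd; exact: mint_nondecr.
Qed.

(* [ivp] is the radial equation with the Laplacian integrated twice; the slope
   parameter [b] is minus a quarter of the Laplacian at the origin. *)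
Definition ivp f a b L U := continuous U /\ forall s, 0 <= s <= L ->
  U s = a - b * s + Kop (fun t => f (U t)) s.

(* [U2 - U1 = s * d s] with [d] continuous and [d 0 = b1 - b2 > 0]; at a first zero of [d] the
   nonlinear term would still be nonnegative. *)
Lemma ivp_compare f a b1 b2 L U1 U2 : continuous f -> (forall x y, x <= y -> f x <= f y) ->
  ivp f a b1 L U1 -> ivp f a b2 L U2 -> b2 < b1 -> forall s, 0 < s <= L -> U1 s < U2 s.
Proof.
move=> cf nf [c1 h1] [c2 h2] b12.
pose F1 t := f (U1 t); pose F2 t := f (U2 t).
have cF1 : continuous F1 := cont_comp c1 cf; have cF2 : continuous F2 := cont_comp c2 cf.
pose E t := F2 t - F1 t; have cE : continuous E by exact: contB.
pose d t := (b1 - b2) + avg (avg (mint E)) t / 4.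
have cd : continuous d.
  apply: contD; first exact: cont_cst; apply: contM; last exact: cont_cst.
  by apply: continuous_avg; apply: continuous_avg; exact: continuous_mint.
have dE s : 0 <= s <= L -> U2 s - U1 s = s * d s.
  by move=> hs; rewrite h1// h2// /d mulrDr -Kop_avg// KopB//; ring.
have d0 : 0 < d 0 by rewrite /d !avg0 mint0 mul0r addr0 subr_gt0.
move=> s /andP[s0 sL]; rewrite -subr_gt0 dE ?(ltW s0)//; apply: mulr_gt0 => //.
rewrite ltNge; apply/negP => ds; have [t [/andP[t0 ts] dt below]] := first_zero cd d0 (ltW s0) ds.
have Epos u : 0 <= u <= t -> 0 <= E u.
  move=> /andP[u0 ut]; rewrite /E subr_ge0; apply: nf; rewrite -subr_ge0 dE; last first.
    by rewrite u0 (le_trans ut)// (le_trans ts).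
  move: ut; rewrite le_eqVlt => /predU1P[->|ut]; first by rewrite dt mulr0.
  by rewrite mulr_ge0// ltW// below.
have : 0 <= avg (avg (mint E)) t.
  have cz : continuous (fun _ : R => 0 : R) by exact: cont_cst.
  rewrite -[leLHS](avg_cst 0 t); apply: avg_le => [//||//|u /andP[u0 ut]].
  - by apply: continuous_avg; exact: continuous_mint.
  - exact: ltW.
  rewrite -[leLHS](avg_cst 0 u); apply: avg_le => [//||//|v /andP[v0 vu]]; first exact: continuous_mint.
  have := mint_le cz cE v0; rewrite mint_cst !mul0r; apply => w /andP[w0 wv].
  by apply: Epos; rewrite w0 (le_trans wv)// (le_trans vu).
by move: dt; rewrite /d; move: b12; lra.
Qed.

Lemma mint_exp (C : R) s : 0 < C -> 0 <= s -> mint (fun t => expR (C * t)) s <= (4 * C)^-1 * expR (C * s).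
Proof.
move=> C0 s0; have ce : continuous (fun t : R => expR (C * t)).
  by apply: cont_comp (@continuous_expR R); apply: contZ; exact: cont_id.
have de (x : R) : is_derive x 1 (fun t => (4 * C)^-1 * expR (C * t)) (expR (C * x) / 4).
  have d1 := @is_derive_compR R (@expR R) (fun t => C * t) x _ _ (is_derive_expR (C * x)) (is_deriveZR C (is_derive_idR x)).
  have := is_deriveZR (4 * C)^-1 d1; congr is_derive.
  by field; rewrite gt_eqF.
have H := @derive_ge0_le R (fun x => (4 * C)^-1 * expR (C * x) - mint (fun t => expR (C * t)) x)
  (fun x => expR (C * x) / 4 - avg (fun t => expR (C * t)) x / 4) 0 s s0.
rewrite -subr_ge0; apply: le_trans (H _ _).
- by rewrite mulr0 expR0 mulr1 mint0 subr0 invr_ge0 mulr_ge0// ltW.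
- by move=> x; exact: is_deriveBR (de x) (is_derive_mint x ce).
- move=> x /andP[x0 _]; rewrite -mulrBl divr_ge0// subr_ge0 -[leRHS](avg_cst (expR (C * x)) x).
  apply: avg_le => [//||//|t /andP[_ tx]]; first exact: cont_cst.
  by rewrite ler_expR ler_pM2l.
Qed.

Lemma Kop_exp (C : R) s : 0 < C -> 0 <= s -> Kop (fun t => expR (C * t)) s <= (4 * C)^-1 ^+ 2 * expR (C * s).
Proof.
move=> C0 s0; have ce : continuous (fun t : R => expR (C * t)).
  by apply: cont_comp (@continuous_expR R); apply: contZ; exact: cont_id.
have c4 : continuous (fun t : R => (4 * C)^-1 * expR (C * t)) by exact: contZ.
apply: (@le_trans _ _ (mint (fun t => (4 * C)^-1 * expR (C * t)) s)).
  by apply: mint_le => [||//|t /andP[t0 _]]; [exact: continuous_mint|exact: c4|exact: mint_exp].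
rewrite mintZ// expr2 -mulrA ler_wpM2l ?invr_ge0 ?mulr_ge0 ?(ltW C0)//; exact: mint_exp.
Qed.

(* [C * Kop] is a contraction for the sup norm with weight [expR (- (C * s))]. *)
Lemma ivp_unique f a b L C U1 U2 : continuous f -> 1 <= C -> 0 <= L ->
  ivp f a b L U1 -> ivp f a b L U2 ->
  (forall s, 0 <= s <= L -> `|f (U2 s) - f (U1 s)| <= C * `|U2 s - U1 s|) ->
  forall s, 0 <= s <= L -> U1 s = U2 s.
Proof.
move=> cf C1 L0 [c1 h1] [c2 h2] lip.
have C0 : 0 < C by exact: lt_le_trans C1.
pose F1 t := f (U1 t); pose F2 t := f (U2 t).
have cF1 : continuous F1 := cont_comp c1 cf; have cF2 : continuous F2 := cont_comp c2 cf.
pose E t := F2 t - F1 t; have cE : continuous E by exact: contB.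
have ce : continuous (fun t : R => expR (C * t)).
  by apply: cont_comp (@continuous_expR R); apply: contZ; exact: cont_id.
pose D t := `|U2 t - U1 t|.
have cD : continuous D by move=> t; apply: cvg_norm; exact: (contB c2 c1).
pose w t := D t * expR (- (C * t)).
have cw : continuous w.
  apply: contM => //; apply: cont_comp (@continuous_expR R).
  by apply: contN; apply: contZ; exact: cont_id.
have [m mL wm] := EVT_max L0 (continuous_subspaceT cw).
have DE t : D t = w t * expR (C * t) by rewrite /w -mulrA -expRD addNr expR0 mulr1.
have Dle t : 0 <= t <= L -> D t <= w m * expR (C * t).
  by move=> ht; rewrite DE ler_wpM2r ?expR_ge0// wm// in_itv.
have Ele t : 0 <= t <= L -> `|E t| <= C * w m * expR (C * t).
  move=> ht; apply: le_trans (lip t ht) _; rewrite -mulrA ler_wpM2l ?(ltW C0)//; exact: Dle.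
have m0 : 0 <= m <= L by move: mL; rewrite in_itv.
have /andP[m00 m0L] := m0.
have cCe c : continuous (fun t => c * expR (C * t)) by exact: contZ.
have wm0 : 0 <= w m by rewrite /w /D mulr_ge0 ?expR_ge0.
have Kle : `|Kop E m| <= C * w m * ((4 * C)^-1 ^+ 2 * expR (C * m)).
  have ub : Kop E m <= C * w m * Kop (fun t => expR (C * t)) m.
    rewrite -KopZ//; apply: Kop_le => [//|//|//|t /andP[t0 tm]].
    by apply: le_trans (ler_norm _) (Ele _ _); rewrite t0 (le_trans tm).
  have lb : - (C * w m) * Kop (fun t => expR (C * t)) m <= Kop E m.
    rewrite -KopZ//; apply: Kop_le => [//|//|//|t /andP[t0 tm]].
    rewrite mulNr; have : `|E t| <= C * w m * expR (C * t) by apply: Ele; rewrite t0 (le_trans tm).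
    by rewrite ler_norml => /andP[].
  have Cw : 0 <= C * w m by rewrite mulr_ge0// ltW.
  have ke := ler_wpM2l Cw (Kop_exp C0 m00).
  by rewrite ler_norml; apply/andP; split; move: ub lb ke; rewrite mulNr; lra.
have De : D m = `|Kop E m|.
  by rewrite /D h1// h2// KopB//; congr `|_|; ring.
have wle : w m <= C * w m * (4 * C)^-1 ^+ 2.
  by have := Kle; rewrite -De DE mulrA ler_pM2r ?expR_gt0.
have wz : w m = 0.
  apply/eqP; rewrite eq_le wm0 andbT; apply: contraTT wle; rewrite -!ltNge => wp.
  have -> : C * w m * (4 * C)^-1 ^+ 2 = w m * (16 * C)^-1 by field; rewrite gt_eqF.
  rewrite gtr_pMr// invf_lt1 ?mulr_gt0//; move: C1; lra.
move=> s hs; apply/eqP; rewrite eq_sym -subr_eq0 -normr_eq0 eq_le normr_ge0 andbT.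
by apply: le_trans (Dle s hs) _; rewrite wz mul0r.
Qed.

(** For [p < 1] the power is not Lipschitz at 0, but it suffices that one argument stays above [m]:
    either the other is above [m / 2] and the mean value theorem applies, or the two are at least
    [m / 2] apart. *)
Lemma ppow_lipschitz p m M : 0 < p -> 0 < m -> m <= M -> exists2 C, 1 <= C &
  forall x y, m <= x <= M -> y <= M -> `|ppow p x - ppow p y| <= C * `|x - y|.
Proof.
move=> p0 m0 mM; have M0 : 0 < M by exact: lt_le_trans mM.
have m2 : 0 < m / 2 by rewrite divr_gt0.
(* The sum of the powers at both ends bounds [z ^ (p - 1)] on [[m / 2, M]] whether [p - 1] is
   positive or negative. *)
pose C1 := p * ((m / 2) `^ (p - 1) + M `^ (p - 1)); pose C2 := M `^ p / (m / 2).
have C10 : 0 <= C1 by rewrite mulr_ge0 ?(ltW p0)// addr_ge0// powR_ge0.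
have C20 : 0 <= C2 by rewrite divr_ge0 ?powR_ge0// ltW.
exists (1 + C1 + C2); first by lra.
have dp (z : R) : 0 < z -> is_derive z 1 (fun x => x `^ p) (p * z `^ (p - 1)).
  move=> z0; have z1 : z \in `]0, +oo[ by rewrite in_itv /= z0.
  apply: DeriveDef; first exact: derivable_powR.
  by rewrite -derive1E powR_derive1.
have db z : m / 2 <= z <= M -> p * z `^ (p - 1) <= C1.
  move=> /andP[mz zM]; rewrite /C1 ler_pM2l//; have z0 : 0 < z by exact: lt_le_trans mz.
  have [q0|q0] := leP 0 (p - 1).
    apply: (@le_trans _ _ (M `^ (p - 1))); last by rewrite lerDr powR_ge0.
    by apply: ge0_ler_powR => //; rewrite nnegrE ltW.
  apply: (@le_trans _ _ ((m / 2) `^ (p - 1))); last by rewrite lerDl powR_ge0.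
  rewrite -[p - 1]opprK ![_ `^ (- - _)]powRN lef_pV2 ?posrE ?powR_gt0//.
  by apply: ge0_ler_powR => //; [rewrite oppr_ge0 ltW|rewrite nnegrE ltW|rewrite nnegrE ltW].
have near_ x y : m / 2 <= y -> y <= x -> x <= M -> `|ppow p x - ppow p y| <= C1 * `|x - y|.
  move=> my yx xM; have y0 : 0 < y by exact: lt_le_trans my.
  rewrite !ppowE ?(ltW y0) ?(ltW (lt_le_trans y0 yx))//.
  have [->|xy] := eqVneq y x; first by rewrite !subrr normr0 mulr0.
  have lt_yx : y < x by rewrite lt_neqAle xy yx.
  have H1 z : z \in `]y, x[ -> is_derive z 1 (fun x => x `^ p) (p * z `^ (p - 1)).
    by rewrite in_itv /= => /andP[yz _]; apply: dp; exact: lt_trans yz.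
  have H2 : {within `[y, x], continuous (fun x => x `^ p)}.
    apply: derivable_within_continuous => z; rewrite in_itv /= => /andP[yz _].
    by have [] := dp z (lt_le_trans y0 yz).
  have [c cxy ->] := MVT lt_yx H1 H2.
  move: cxy; rewrite in_itv /= => /andP[yc cx].
  rewrite normrM ler_wpM2r// ger0_norm ?mulr_ge0 ?powR_ge0 ?(ltW p0)//.
  by apply: db; rewrite (le_trans my (ltW yc)) (le_trans (ltW cx)).
move=> x y /andP[mx xM] yM; have n0 := normr_ge0 (x - y).
have [my|my] := leP (m / 2) y.
  apply: (@le_trans _ _ (C1 * `|x - y|)); last by rewrite ler_wpM2r//; lra.
  have [yx|xy] := leP y x; first exact: near_.
  rewrite distrC [`|x - y|]distrC; apply: near_ => //; last exact: ltW.
  by apply: le_trans mx; lra.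
apply: (@le_trans _ _ (C2 * `|x - y|)); last by rewrite ler_wpM2r//; lra.
have xy : m / 2 <= `|x - y| by apply: le_trans (ler_norm _); lra.
apply: (@le_trans _ _ (C2 * (m / 2))); last by rewrite ler_wpM2l.
rewrite /C2 divfK ?gt_eqF// ger0_norm.
  rewrite -[M `^ p]ppowE ?(ltW M0)//; apply: le_trans (ppow_le p0 xM).
  by rewrite gerBl ppow_ge0.
by rewrite subr_ge0; apply: ppow_le => //; lra.
Qed.
End Comparison.

(** * Uniqueness and scaling of profiles *)

Section Profiles.
Context {R : realType}.
Variables (p : R) (p0 : 0 < p) (k : R) (k1 : k < 1).
Implicit Types (f g d U : R -> R) (s t a b l m L S x y : R).

Let cpp : continuous (ppow p) := continuous_ppow p0.

Definition profile a b S U :=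
  [/\ ivp (ppow p) a b S U, forall s, 0 <= s -> s < S -> 0 < U s, U S = 0 &
      Pop k (fun t => ppow p (U t)) S = 4 * b * (1 - k)].

Lemma continuous_ppowU U : continuous U -> continuous (fun t => ppow p (U t)).
Proof. by move=> cU; exact: cont_comp cU cpp. Qed.

Lemma ivp_sub f a b L L' U : L' <= L -> ivp f a b L U -> ivp f a b L' U.
Proof.
by move=> le [cU h]; split => // s /andP[s0 sL]; apply: h; rewrite s0 (le_trans sL).
Qed.

Lemma ivp0 f a b L U : 0 <= L -> ivp f a b L U -> U 0 = a.
Proof. by move=> L0 [_ h]; rewrite h ?lexx// mulr0 subr0 /Kop mint0 addr0. Qed.

(** The larger [b] has the smaller solution. If that solution lived at least as long, it would be
    negative at the zero of the other; if it ended earlier, sign and monotonicity of [Pop] would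
    force its value [4 * b * (1 - k)] not to exceed that of the smaller [b]. *)
Lemma profile_slope a b1 b2 S1 S2 U1 U2 : 0 < S1 -> 0 < S2 ->
  profile a b1 S1 U1 -> profile a b2 S2 U2 -> b1 <= b2.
Proof.
move=> S10 S20 [i1 u1 z1 q1] [i2 u2 z2 q2]; rewrite leNgt; apply/negP => b12.
have c1 := continuous_ppowU i1.1; have c2 := continuous_ppowU i2.1.
have cmp L : L <= S1 -> L <= S2 -> forall s, 0 < s <= L -> U1 s < U2 s.
  move=> l1 l2; apply: (ivp_compare cpp (@ppow_le R p p0) (ivp_sub l1 i1) (ivp_sub l2 i2) b12).
have [S21|S12] := leP S2 S1.
  have := cmp S2 S21 (lexx _) S2; rewrite S20 lexx z2 => /(_ isT).
  apply/negP; rewrite -leNgt; move: S21; rewrite le_eqVlt => /predU1P[->|lt]; first by rewrite z1.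
  by rewrite ltW// u1// ltW.
have := cmp S1 (lexx _) (ltW S12).
have S1ge := ltW S10.
move=> lt12; have E0 : 0 <= Pop k (fun t => ppow p (U2 t) - ppow p (U1 t)) S1.
  apply: Pop_ge0 => //; first exact: contB.
  move=> t /andP[t0 ts]; rewrite subr_ge0; apply: ppow_le => //.
  move: t0; rewrite le_eqVlt => /predU1P[<-|t0]; last by rewrite ltW// lt12// t0.
  by rewrite (ivp0 S1ge i1) (ivp0 (ltW S20) i2).
rewrite PopB// subr_ge0 q1 in E0.
have := Pop_nondecr k1 c2 (fun t _ => ppow_ge0 p (U2 t)) S1ge (ltW S12).
rewrite q2; have k0 : 0 < 1 - k by rewrite subr_gt0.
have : b2 * (1 - k) < b1 * (1 - k) by rewrite ltr_pM2r.
by move: E0; rewrite -!mulrA; lra.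
Qed.

Lemma eq_at_end d S : continuous d -> 0 < S -> (forall t, 0 <= t -> t < S -> d t = 0) -> d S = 0.
Proof.
move=> cd S0 h; apply/eqP; apply: contraT => dS.
have n0 : 0 < `|d S| by rewrite normr_gt0.
have /cvgrPdist_lt/(_ _ n0) := cd S; rewrite near_nbhs => /nbhs_ballP[e /= e0 he].
pose t := Num.max 0 (S - e / 2).
have tS : t < S by rewrite /t gt_max S0 /=; move: e0; lra.
have t0 : 0 <= t by rewrite /t le_max lexx.
have : `|S - t| < e.
  rewrite ger0_norm ?subr_ge0 ?ltW//; have : S - e / 2 <= t by rewrite /t le_max lexx orbT.
  by move: e0; lra.
by move/he => /=; rewrite (h t t0 tS) subr0 ltxx.
Qed.

(** On the compact interval [U1] has a positive minimum, so [ppow_lipschitz] provides the Lipschitz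
    bound along the two solutions. *)
Lemma ivp_unique_pos a b L U1 U2 : 0 <= L -> ivp (ppow p) a b L U1 -> ivp (ppow p) a b L U2 ->
  (forall s, 0 <= s <= L -> 0 < U1 s) -> forall s, 0 <= s <= L -> U1 s = U2 s.
Proof.
move=> L0 i1 i2 u1.
have [t0 tL mU] := EVT_min L0 (continuous_subspaceT i1.1).
have [t1 tL1 M1] := EVT_max L0 (continuous_subspaceT i1.1).
have [t2 tL2 M2] := EVT_max L0 (continuous_subspaceT i2.1).
have m0 : 0 < U1 t0 by apply: u1; move: tL; rewrite in_itv.
pose M := Num.max (U1 t1) (U2 t2).
have mM : U1 t0 <= M by rewrite /M le_max M1.
have [C C1 hC] := ppow_lipschitz p0 m0 mM.
apply: (ivp_unique cpp C1 L0 i1 i2) => s hs; rewrite distrC [`|U2 s - U1 s|]distrC.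
have sI : s \in `[0, L] by rewrite in_itv.
by apply: hC; rewrite /M ?mU ?le_max ?M1 ?M2 ?orbT.
Qed.

(** A profile vanishes at its end, where the Lipschitz bound is lost. Uniqueness is therefore
    applied on [[0, s]] with [s < S1], and continuity gives the end point. *)
Lemma profile_eq_le a b S1 S2 U1 U2 : 0 < S1 -> S1 <= S2 ->
  profile a b S1 U1 -> profile a b S2 U2 -> S1 = S2 /\ forall s, 0 <= s <= S1 -> U1 s = U2 s.
Proof.
move=> S10 S12 [i1 u1 z1 q1] [i2 u2 z2 q2].
have e s : 0 <= s -> s < S1 -> U1 s - U2 s = 0.
  move=> s0 sS; apply/eqP; rewrite subr_eq0; apply/eqP.
  apply: (ivp_unique_pos s0 (ivp_sub (ltW sS) i1) (ivp_sub (le_trans (ltW sS) S12) i2)); last by rewrite s0 lexx.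
  by move=> t /andP[t0 ts]; apply: u1 => //; exact: le_lt_trans sS.
have eS := eq_at_end (contB i1.1 i2.1) S10 e.
have U2S : U2 S1 = 0 by move/eqP: eS; rewrite z1 sub0r oppr_eq0 => /eqP.
split.
  apply/eqP; rewrite eq_le S12 /= leNgt; apply/negP => lt.
  by have := u2 S1 (ltW S10) lt; rewrite U2S ltxx.
move=> s /andP[s0]; rewrite le_eqVlt => /predU1P[->|sS]; first by rewrite z1 U2S.
by apply/eqP; rewrite -subr_eq0; apply/eqP; exact: e.
Qed.

Lemma profile_unique a b1 b2 S1 S2 U1 U2 : 0 < S1 -> 0 < S2 ->
  profile a b1 S1 U1 -> profile a b2 S2 U2 -> S1 = S2 /\ forall s, 0 <= s <= S1 -> U1 s = U2 s.
Proof.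
move=> S10 S20 h1 h2; have e : b1 = b2.
  by apply/le_anti/andP; split; [exact: (profile_slope S10 S20 h1 h2)|exact: (profile_slope S20 S10 h2 h1)].
subst b2; have [le|/ltW le] := leP S1 S2; first exact: profile_eq_le h1 h2.
have [eS eU] := profile_eq_le S20 le h2 h1; split => // s hs; rewrite eU// eS//.
Qed.

Lemma mint_mulscale c l f s : l != 0 -> continuous f ->
  mint (fun t => c * f (l * t)) s = c * (l^-1 * mint f (l * s)).
Proof.
move=> l0 cf; have cl : continuous (fun t => f (l * t)) by apply: cont_comp cf; apply: contZ; exact: cont_id.
by rewrite mintZ// mint_scale.
Qed.

(* [u] solves [Delta^2 u = u^p] iff [m * u (sqrt l * x)] does, when [m ^ (p - 1) = l ^ 2]. *)
Lemma profile_scale a b S U l m : 0 < l -> 0 < m -> m `^ (p - 1) = l ^+ 2 ->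
  profile a b S U -> profile (m * a) (m * l * b) (S / l) (fun s => m * U (l * s)).
Proof.
move=> l0 m0 ml [[cU iU] u z q]; have ln0 : l != 0 by rewrite gt_eqF.
have cl f : continuous f -> continuous (fun t => f (l * t)).
  by move=> cf; apply: cont_comp cf; apply: contZ; exact: cont_id.
pose F t := ppow p (U t); have cF : continuous F := continuous_ppowU cU.
have mp : m `^ p = m * l ^+ 2 by rewrite -ml mulr_powRB1// ltW.
have FE : (fun t => ppow p (m * U (l * t))) = (fun t => m * l ^+ 2 * F (l * t)).
  apply/funext => t; rewrite /F -mp /ppow -powRM ?(ltW m0) ?le_max ?lexx ?orbT//.
  by congr (_ `^ _); rewrite maxr_pMr ?mulr0// ltW.
have cm := continuous_mint cF.
have mE : mint (fun t => m * l ^+ 2 * F (l * t)) = (fun t => m * l * mint F (l * t)).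
  by apply/funext => t; rewrite mint_mulscale//; field.
have lS s : 0 <= s <= S / l -> 0 <= l * s <= S.
  by move=> /andP[s0 sS]; rewrite mulr_ge0 ?(ltW l0)//= mulrC -ler_pdivlMr.
split.
- split; first by apply: contZ; exact: cl.
  move=> s hs; rewrite FE /Kop mE mint_mulscale// iU ?lS//; rewrite /Kop -/F.
  by field.
- move=> s s0 sS; apply: mulr_gt0 => //; apply: u; first by rewrite mulr_ge0// ltW.
  by rewrite mulrC -ltr_pdivlMr.
- by rewrite [l * _]mulrC divfK// z mulr0.
- rewrite FE /Pop mE avgZ; last exact: cl.
  have e : l * (S / l) = S by rewrite mulrC divfK.
  rewrite avg_scale// e; move: q; rewrite /Pop -/F => q.
  transitivity (m * l * (4 * b * (1 - k))); last by ring.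
  by rewrite -q; ring.
Qed.

(** Both profiles are scaled to initial value 1. Their scaled lengths then agree, and since the
    lengths were equal before scaling so are the scales, which for [p != 1] determine the initial
    values. *)
Lemma profile_unique_fixed a1 a2 b1 b2 S U1 U2 : p != 1 -> 0 < S -> 0 < a1 -> 0 < a2 ->
  profile a1 b1 S U1 -> profile a2 b2 S U2 -> forall s, 0 <= s <= S -> U1 s = U2 s.
Proof.
move=> p1 S0 a10 a20 h1 h2.
(* With amplitude [m = 1 / a], the dilation [l = m ^ q] satisfies [m ^ (p - 1) = l ^+ 2]. *)
pose q := (p - 1) / 2; have q0 : q != 0 by rewrite mulf_neq0 ?subr_eq0// invr_neq0// pnatr_eq0.
have sq a : 0 < a -> (a^-1) `^ (p - 1) = ((a^-1) `^ q) ^+ 2.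
  by move=> a0; rewrite -powR_mulrn ?powR_ge0// -powRrM; congr (_ `^ _); rewrite /q; field.
have l0 a : 0 < a -> 0 < (a^-1) `^ q by move=> a0; rewrite powR_gt0// invr_gt0.
have i0 a : 0 < a -> 0 < a^-1 by move=> a0; rewrite invr_gt0.
have g1 := profile_scale (l0 _ a10) (i0 _ a10) (sq _ a10) h1.
have g2 := profile_scale (l0 _ a20) (i0 _ a20) (sq _ a20) h2.
rewrite mulVf ?gt_eqF// in g1; rewrite mulVf ?gt_eqF// in g2.
have [eS eU] := profile_unique (divr_gt0 S0 (l0 _ a10)) (divr_gt0 S0 (l0 _ a20)) g1 g2.
have el : (a1^-1) `^ q = (a2^-1) `^ q.
  by move/(mulfI (lt0r_neq0 S0))/invr_inj : eS.
have em : a1^-1 = a2^-1.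
  have e := congr1 (fun x => x `^ q^-1) el; move: e => /=.
  by rewrite -!powRrM mulfV// !powRr1// invr_ge0 ltW.
move=> s /andP[s0 sS]; have lp := l0 _ a10.
have := eU (s / (a1^-1 `^ q)); rewrite -el -em ![_ * (s / _)]mulrC divfK ?gt_eqF//.
move=> h; apply: (mulfI (lt0r_neq0 (i0 _ a10))); apply: h.
by rewrite divr_ge0 ?(ltW lp)//= ler_pM2r// invr_gt0.
Qed.

Lemma profile_rescale b L S U : p != 1 -> 0 < L -> 0 < S -> profile 1 b L U ->
  exists m c, 0 < m /\ profile m c S (fun s => m * U (L / S * s)).
Proof.
move=> p1 L0 S0 h; pose l := L / S; have l0 : 0 < l by rewrite divr_gt0.
have pn : p - 1 != 0 by rewrite subr_eq0.
(* The dilation [L / S] is fixed by the lengths; this amplitude solves [m ^ (p - 1) = l ^+ 2]. *)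
pose m := l `^ (2 / (p - 1)); have m0 : 0 < m by rewrite powR_gt0.
have ml : m `^ (p - 1) = l ^+ 2.
  by rewrite /m -powRrM divfK// powR_mulrn// ltW.
have := profile_scale l0 m0 ml h.
have -> : L / l = S by rewrite /l invfM invrK mulrA mulfV ?mul1r// gt_eqF.
by rewrite mulr1 => g; exists m, (m * l * b).
Qed.
End Profiles.

(** * Profiles and the explicit linear solution *)

Section ProfileEquation.
Context {R : realType}.
Variables (r : R) (r0 : 0 < r) (p : R) (p0 : 0 < p) (sigma : R) (hsigma : -1 < sigma).
Notation S := (r ^+ 2).
Notation k := (bcoef sigma).
Implicit Types (f U : R -> R).

Let S0 : 0 < S. Proof. by rewrite exprn_gt0. Qed.
Let k0 : 0 < 1 - k. Proof. by rewrite subr_gt0 bcoef_lt1. Qed.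

Lemma mint_vsol (G : R -> R) s : continuous G ->
  mint (vsol r sigma G) s = vcst r sigma G / 4 * s + Kop G s.
Proof.
move=> cG; have cm := continuous_mint cG.
have cc : continuous (fun _ : R => vcst r sigma G) by exact: cont_cst.
have e : vsol r sigma G = (fun t => (fun _ : R => vcst r sigma G) t + mint G t) by [].
by rewrite e mintD// mint_cst /Kop; field.
Qed.

(** The Laplacian [vcst + mint F] takes the value [vcst] at the origin, whence the parameter
    [b = - vcst / 4]. *)
Lemma profile_of_usol f : continuous f -> (forall s, 0 <= s < S -> 0 < f s) ->
  (forall s, 0 <= s <= S -> f s = usol r sigma (fun t => ppow p (f t)) s) ->
  profile p k (f 0) (- vcst r sigma (fun t => ppow p (f t)) / 4) S f.
Proof.
move=> cf f0 fE; pose F t := ppow p (f t); have cF : continuous F := continuous_ppowU p0 cf.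
have zS : 0 <= (0 : R) <= S by rewrite lexx ltW.
split.
- split => // s hs; rewrite (fE s hs) (fE 0 zS) -/F /usol !mint_vsol// /Kop mint0; ring.
- by move=> s s0 sS; apply: f0; rewrite s0.
- by rewrite fE ?lexx ?ltW// /usol subrr.
- rewrite -/F /vcst /Pop; move: (mint F S) (avg _ _) => A B.
  by field; rewrite gt_eqF.
Qed.

Lemma usol_of_profile a b U : profile p k a b S U ->
  (forall s, 0 <= s < S -> 0 < U s) /\
  forall s, 0 <= s <= S -> U s = usol r sigma (fun t => ppow p (U t)) s.
Proof.
move=> [[cU iU] u z q]; split; first by move=> s /andP[s0 sS]; exact: u.
pose F t := ppow p (U t); have cF : continuous F := continuous_ppowU p0 cU.
have vE : vcst r sigma F = - 4 * b.
  move: q; rewrite -/F /vcst /Pop => q; apply: (mulIf (lt0r_neq0 k0)).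
  by rewrite divfK ?gt_eqF//; move: q; rewrite mulNr mulNr => <-; ring.
have SS : 0 <= S <= S by rewrite lexx ltW.
move=> s hs; rewrite -/F /usol !mint_vsol// vE.
have := iU S SS; rewrite z -/F => e; rewrite (iU s hs) -/F.
have -> : a = b * S - Kop F S by move: e; move: (Kop F S) (b * S) => A B; lra.
by field.
Qed.
End ProfileEquation.

(** * Pointwise limits under the integral operators *)

Section PointwiseLimits.
Context {R : realType}.
Implicit Types (g U : R -> R) (s t a b L C : R).
Notation mu := (@lebesgue_measure R).

Lemma cvg_ge (a : nat -> R) l C : a n @[n --> \oo] --> l -> (\forall n \near \oo, C <= a n) -> C <= l.
Proof.
move=> h ge; rewrite -(cvg_lim _ h)//; apply: limr_ge; [exact: cvgP h|exact: ge].
Qed.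

Lemma cvg_le (a : nat -> R) l C : a n @[n --> \oo] --> l -> (\forall n \near \oo, a n <= C) -> l <= C.
Proof.
move=> h le; rewrite -(cvg_lim _ h)//; apply: limr_le; [exact: cvgP h|exact: le].
Qed.

Lemma locally_lipschitz_continuous g :
  (forall s, exists2 C, 0 <= C & forall t, `|s - t| < 1 -> `|g s - g t| <= C * `|s - t|) -> continuous g.
Proof.
move=> h s; have [C C0 hC] := h s; apply/cvgrPdist_le => e e0.
have C1 : 0 < C + 1 by lra.
apply/nbhs_ballP; exists (Num.min 1 (e / (C + 1))); first by rewrite /= lt_min ltr01 divr_gt0.
move=> t; rewrite /ball /= lt_min => /andP[t1 te]; apply: le_trans (hC t t1) _.
have := ltW te; rewrite ler_pdivlMr// mulrC; apply: le_trans.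
by rewrite ler_wpM2r//; lra.
Qed.

Lemma continuous_sqint1 g a b : continuous g -> sqint mu `[a, b] g.
Proof.
move=> cg; split; first by apply: measurable_funTS; exact: continuous_measurable_fun.
by apply: continuous_integrable1; exact: contX.
Qed.

Section Sequence.
Variables (g_ : nat -> R -> R) (g : R -> R) (C L : R).
Hypotheses (cg_ : forall n, continuous (g_ n)) (cg : continuous g).
Hypothesis (bd_ : forall n t, 0 <= t <= L -> `|g_ n t| <= C) (bd : forall t, 0 <= t <= L -> `|g t| <= C).
Hypothesis (lim : forall t, 0 <= t <= L -> g_ n t @[n --> \oo] --> g t).

Lemma prim_cvg s : 0 <= s <= L -> prim (g_ n) s @[n --> \oo] --> prim g s.
Proof.
move=> /andP[s0 sL]; have mD : measurable (`[0, s]%classic : set (measurableTypeR R)) by exact: measurable_itv.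
have c1 : continuous (fun _ : R => 1 : R) by exact: cont_cst.
have sub t : `[0, s]%classic t -> 0 <= t <= L.
  by rewrite /= in_itv /= => /andP[-> ts]; rewrite (le_trans ts).
have cv : cvg2 mu `[0, s] g_ g.
  apply: (@cvg2_dominated _ _ _ mu `[0, s]%classic mD g_ g (fun=> C + C)).
  - by move=> n; apply: measurable_funTS; exact: continuous_measurable_fun.
  - by apply: measurable_funTS; exact: continuous_measurable_fun.
  - by apply: aeW => t /sub; exact: lim.
  - by apply: continuous_sqint1; exact: cont_cst.
  - move=> n t /sub ht; apply: le_trans (ler_normB _ _) _; apply: lerD; [exact: bd_|exact: bd].
(* [prim f s] is the pairing of [f] with 1, so convergence in [L2] of the interval is enough. *)
have pE f : continuous f -> prim f s = ip mu `[0, s] f (fun=> 1).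
  move=> cf; rewrite /ip -[LHS]subr0 -[X in _ - X](prim0 f) -Rintegral_prim//.
  by apply: eq_Rintegral => t _; rewrite mulr1.
have := cvg2_ip mD (fun n => continuous_sqint1 0 s (@cg_ n)) (continuous_sqint1 0 s cg) (continuous_sqint1 0 s c1) cv.
rewrite -pE//.
have -> : (fun n => ip mu `[0, s] (g_ n) (fun=> 1)) = (fun n => prim (g_ n) s).
  by apply/funext => n; rewrite pE//; exact: cg_.
exact.
Qed.

Lemma avg_cvg s : 0 <= s <= L -> avg (g_ n) s @[n --> \oo] --> avg g s.
Proof.
move=> hs; have [s0|s0] := eqVneq s 0.
  rewrite s0 avg0; have -> : (fun n => avg (g_ n) 0) = (fun n => g_ n 0) by apply/funext => n; exact: avg0.
  by apply: lim; rewrite lexx /=; move: hs; rewrite s0 lexx.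
rewrite avgE//; have -> : (fun n => avg (g_ n) s) = (fun n => prim (g_ n) s / s) by apply/funext => n; exact: avgE.
by apply: cvgM; [exact: prim_cvg|exact: cvg_cst].
Qed.
End Sequence.

Lemma avg_bound g C L : continuous g -> (forall t, 0 <= t <= L -> `|g t| <= C) ->
  forall s, 0 <= s <= L -> `|avg g s| <= C.
Proof.
move=> cg bd s /andP[s0 sL]; have cc (c : R) : continuous (fun _ : R => c) by exact: cont_cst.
have h t : 0 <= t <= s -> - C <= g t /\ g t <= C.
  by move=> /andP[t0 ts]; have := bd t; rewrite t0 (le_trans ts)// => /(_ isT); rewrite ler_norml => /andP.
rewrite ler_norml -[in X in X && _](avg_cst (- C) s) -[X in _ && (_ <= X)](avg_cst C s).
by apply/andP; split; apply: avg_le => [//|//|//|t /h[]].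
Qed.

Lemma mint_bound g C L : continuous g -> (forall t, 0 <= t <= L -> `|g t| <= C) ->
  forall s, 0 <= s <= L -> `|mint g s| <= C * L / 4.
Proof.
move=> cg bd s /andP[s0 sL]; have cc (c : R) : continuous (fun _ : R => c) by exact: cont_cst.
have C0 : 0 <= C by apply: le_trans (bd 0 _); rewrite ?normr_ge0// lexx (le_trans s0 sL).
have h t : 0 <= t <= s -> - C <= g t /\ g t <= C.
  by move=> /andP[t0 ts]; have := bd t; rewrite t0 (le_trans ts)// => /(_ isT); rewrite ler_norml => /andP.
apply: (@le_trans _ _ (C * s / 4)); last by rewrite ler_pM2r// ler_wpM2l.
rewrite ler_norml -!mulNr -!mint_cst.
by apply/andP; split; apply: mint_le => [//|//|//|t /h[]].
Qed.

Lemma mint_cvg (g_ : nat -> R -> R) g C L : (forall n, continuous (g_ n)) -> continuous g ->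
  (forall n t, 0 <= t <= L -> `|g_ n t| <= C) -> (forall t, 0 <= t <= L -> `|g t| <= C) ->
  (forall t, 0 <= t <= L -> g_ n t @[n --> \oo] --> g t) ->
  forall s, 0 <= s <= L -> mint (g_ n) s @[n --> \oo] --> mint g s.
Proof.
move=> cg_ cg bd_ bd lim s hs.
have := prim_cvg (fun n => continuous_avg (cg_ n)) (continuous_avg cg)
  (fun n => avg_bound (cg_ n) (bd_ n)) (avg_bound cg bd) (avg_cvg cg_ cg bd_ bd lim) hs.
move=> h; rewrite mint.unlock; apply: cvgM; [exact: h|exact: cvg_cst].
Qed.

Lemma Kop_cvg (g_ : nat -> R -> R) g C L : (forall n, continuous (g_ n)) -> continuous g ->
  (forall n t, 0 <= t <= L -> `|g_ n t| <= C) -> (forall t, 0 <= t <= L -> `|g t| <= C) ->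
  (forall t, 0 <= t <= L -> g_ n t @[n --> \oo] --> g t) ->
  forall s, 0 <= s <= L -> Kop (g_ n) s @[n --> \oo] --> Kop g s.
Proof.
move=> cg_ cg bd_ bd lim; rewrite /Kop.
exact: mint_cvg (fun n => continuous_mint (cg_ n)) (continuous_mint cg)
  (fun n => mint_bound (cg_ n) (bd_ n)) (mint_bound cg bd) (mint_cvg cg_ cg bd_ bd lim).
Qed.

Lemma Pop_cvg k (g_ : nat -> R -> R) g C L : (forall n, continuous (g_ n)) -> continuous g ->
  (forall n t, 0 <= t <= L -> `|g_ n t| <= C) -> (forall t, 0 <= t <= L -> `|g t| <= C) ->
  (forall t, 0 <= t <= L -> g_ n t @[n --> \oo] --> g t) ->
  forall s, 0 <= s <= L -> Pop k (g_ n) s @[n --> \oo] --> Pop k g s.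
Proof.
move=> cg_ cg bd_ bd lim s hs; have ml := mint_cvg cg_ cg bd_ bd lim.
have h : avg (mint (g_ n)) s @[n --> \oo] --> avg (mint g) s.
  apply: (@avg_cvg (fun n => mint (g_ n)) (mint g) (C * L / 4) L) => //.
  - by move=> n; exact: continuous_mint.
  - exact: continuous_mint.
  - by move=> n; exact: (mint_bound (cg_ n) (bd_ n)).
  - exact: (mint_bound cg bd).
apply: cvgB; first exact: ml.
by apply: cvgM; [exact: cvg_cst|exact: h].
Qed.
End PointwiseLimits.

(** * Global solutions for a bounded monotone nonlinearity *)

Section Solutions.
Context {R : realType}.
Variables (f : R -> R) (cf : continuous f) (nf : forall x y, x <= y -> f x <= f y).
Hypothesis (f01 : forall x, 0 <= f x <= 1).
Implicit Types (g U : R -> R) (s t a b L C : R).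

Let cfU U : continuous U -> continuous (fun t => f (U t)).
Proof. by move=> cU; exact: cont_comp cU cf. Qed.

Let f_bounded U t : `|f (U t)| <= 1.
Proof. by have /andP[h1 h2] := f01 (U t); rewrite ger0_norm. Qed.

Definition sol b U := continuous U /\ forall s, 0 <= s ->
  U s = 1 - b * s + Kop (fun t => f (U t)) s.

Lemma sol_ivp b U L : sol b U -> ivp f 1 b L U.
Proof. by move=> [cU h]; split => // s /andP[s0 _]; exact: h. Qed.

(** The derivative of [Kop g] is [avg (mint g) / 4], and [0 <= g <= 1] gives [0 <= mint g <= L / 4]
    on [[0, L]]. *)
Lemma Kop_slope g s t L : continuous g -> (forall x, 0 <= g x <= 1) -> 0 <= s -> s <= t -> t <= L ->
  0 <= Kop g t - Kop g s <= L / 16 * (t - s).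
Proof.
move=> cg g01 s0 st tL; have cm := continuous_mint cg.
have cc (c : R) : continuous (fun _ : R => c) by exact: cont_cst.
have m0 x : 0 <= x -> 0 <= mint g x.
  move=> x0; have := mint_le (cc 0) cg x0; rewrite mint_cst !mul0r; apply.
  by move=> u _; have /andP[] := g01 u.
have m1 x : 0 <= x -> x <= L -> mint g x <= L / 4.
  move=> x0 xL; have := mint_le cg (cc 1) x0; rewrite mint_cst mul1r => h.
  apply: le_trans (h _) _; last by rewrite ler_pM2r.
  by move=> u _; have /andP[] := g01 u.
have a0 x : 0 <= x -> 0 <= avg (mint g) x.
  by move=> x0; rewrite -[leLHS](avg_cst 0 x); apply: avg_le => [//|//|//|u /andP[u0 _]]; exact: m0.
have a1 x : 0 <= x -> x <= L -> avg (mint g) x <= L / 4.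
  move=> x0 xL; rewrite -[leRHS](avg_cst (L / 4) x); apply: avg_le => [//|//|//|u /andP[u0 ux]].
  by apply: m1 => //; exact: le_trans xL.
have d x := is_derive_mint x cm; apply/andP; split.
  rewrite subr_ge0; apply: (derive_ge0_le st d) => x /andP[sx _].
  by rewrite divr_ge0// a0// (le_trans s0).
have := @derive_ge0_le R (fun x => L / 16 * x - Kop g x) (fun x => L / 16 - avg (mint g) x / 4) s t st.
move=> H; have : L / 16 * s - Kop g s <= L / 16 * t - Kop g t; last by rewrite mulrBr; lra.
apply: H => [x|x /andP[sx xt]].
  by have := is_deriveBR (is_deriveZR (L / 16) (is_derive_idR x)) (d x); rewrite mulr1.
by have := a1 x (le_trans s0 sx) (le_trans xt tL); lra.
Qed.

(** Two sequences serve two limits: [v_ n = u_ n.+1] for Picard iteration, [v_ = u_] when the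
    parameter varies. Pointwise convergence suffices, because [u s + b * s] is a limit of the
    functions [1 + Kop], whose slopes are bounded by [Kop_slope]; this makes the limit
    continuous. *)
Lemma limit_sol (u_ v_ : nat -> R -> R) (b_ : nat -> R) u b : (forall n, continuous (u_ n)) ->
  (forall n s, 0 <= s -> v_ n s = 1 - b_ n * s + Kop (fun t => f (u_ n t)) s) ->
  b_ n @[n --> \oo] --> b ->
  (forall s, 0 <= s -> u_ n s @[n --> \oo] --> u s) ->
  (forall s, 0 <= s -> v_ n s @[n --> \oo] --> u s) ->
  sol b (fun s => u (Num.max s 0)).
Proof.
move=> cu_ hv b1 ul vl; pose h s := u s + b * s.
have hl s : 0 <= s -> Kop (fun t => f (u_ n t)) s @[n --> \oo] --> h s - 1.
  move=> s0; have -> : (fun n => Kop (fun t => f (u_ n t)) s) = (fun n => v_ n s + b_ n * s - 1).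
    by apply/funext => n; rewrite hv//; ring.
  apply: cvgB; last exact: cvg_cst; apply: cvgD; first exact: vl.
  by apply: cvgM => //; exact: cvg_cst.
have hs s t L : 0 <= s -> s <= t -> t <= L -> 0 <= h t - h s <= L / 16 * (t - s).
  move=> s0 st tL; have l1 : Kop (fun x => f (u_ n x)) t - Kop (fun x => f (u_ n x)) s @[n --> \oo] --> h t - 1 - (h s - 1).
    exact: (cvgB (hl t (le_trans s0 st)) (hl s s0)).
  have e : h t - 1 - (h s - 1) = h t - h s by ring.
  have bd n := Kop_slope (cfU (cu_ n)) (fun x => f01 (u_ n x)) s0 st tL.
  rewrite -e; apply/andP; split.
    by apply: (cvg_ge l1); apply: nearW => n; have /andP[] := bd n.
  by apply: (cvg_le l1); apply: nearW => n; have /andP[] := bd n.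
pose w s := u (Num.max s 0).
have cm := @continuous_maxr R 0.
have maxlip s t : `|Num.max s 0 - Num.max t 0| <= `|s - t|.
  have h1 := ler_norm (s - t); have := ler_norm (- (s - t)); rewrite normrN => h2.
  by case: (leP s 0); case: (leP t 0) => ? ?; rewrite ler_norml; apply/andP; split; lra.
have cw : continuous w.
  have -> : w = (fun s => h (Num.max s 0) - b * Num.max s 0) by apply/funext => s; rewrite /w /h addrK.
  apply: contB; last by apply: contZ.
  apply: locally_lipschitz_continuous => s; pose M := Num.max s 0 + 1.
  have s0 : 0 <= Num.max s 0 by rewrite le_max lexx orbT.
  have M0 : 0 <= M / 16 by rewrite divr_ge0// addr_ge0.
  exists (M / 16) => // t st; have t0 : 0 <= Num.max t 0 by rewrite le_max lexx orbT.
  have ml := maxlip s t; have tM : Num.max t 0 <= M.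
    by rewrite /M; move: (ltW (le_lt_trans ml st)); rewrite ler_norml => /andP[]; lra.
  have sM : Num.max s 0 <= M by rewrite /M; lra.
  apply: le_trans (ler_wpM2l M0 ml).
  have [le|/ltW le] := leP (Num.max s 0) (Num.max t 0).
    have /andP[h1 h2] := hs _ _ _ s0 le tM.
    by rewrite distrC ger0_norm// distrC ger0_norm ?subr_ge0.
  have /andP[h1 h2] := hs _ _ _ t0 le sM.
  by rewrite ger0_norm// ger0_norm ?subr_ge0.
split => // s s0; have wE t : 0 <= t -> w t = u t by move=> t0; rewrite /w max_l.
have kc : Kop (fun t => f (u_ n t)) s @[n --> \oo] --> Kop (fun t => f (w t)) s.
  apply: (@Kop_cvg _ (fun n t => f (u_ n t)) (fun t => f (w t)) 1 s) => //; last by rewrite s0 lexx.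
  - by move=> n; exact: cfU.
  - exact: cfU.
  - by move=> t /andP[t0 _]; rewrite wE//; by apply: continuous_cvg; [exact: cf|exact: ul].
have e := cvg_unique _ kc (hl s s0); rewrite -/(w s) wE//.
by rewrite e// /h; ring.
Qed.

(** Monotonicity of [f] makes the iterates increase and its boundedness makes them converge. This
    takes the place of a contraction argument for powers that are not Lipschitz at 0. *)
Fixpoint picard b n : R -> R := if n is m.+1 then
  fun s => 1 - b * Num.max s 0 + Kop (fun t => f (picard b m t)) (Num.max s 0)
  else fun s => 1 - b * Num.max s 0.

Lemma continuous_picard b n : continuous (picard b n).
Proof.
have cm := @continuous_maxr R 0.
have cl : continuous (fun s : R => 1 - b * Num.max s 0) by apply: contB; [exact: cont_cst|exact: contZ].
elim: n => [|n ih] //=; apply: contD => //.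
by apply: cont_comp cm (continuous_Kop _); exact: cfU.
Qed.

Lemma Kop_ge0_le U s : continuous U -> 0 <= s -> 0 <= Kop (fun t => f (U t)) s <= s / 16 * s.
Proof.
move=> cU s0; have := Kop_slope (cfU cU) (fun x => f01 (U x)) (lexx 0) s0 (lexx s).
by rewrite {2 4}/Kop mint0 !subr0.
Qed.

Lemma picard_le b n s : picard b n s <= picard b n.+1 s.
Proof.
elim: n s => [|n ih] s.
  rewrite /= lerDl; have s0 : 0 <= Num.max s 0 by rewrite le_max lexx orbT.
  by have /andP[] := Kop_ge0_le (@continuous_picard b 0) s0.
rewrite [leRHS]/= [leLHS]/= lerD2l; have s0 : 0 <= Num.max s 0 by rewrite le_max lexx orbT.
apply: Kop_le => [||//|t _]; [exact: cfU (@continuous_picard b n)|exact: cfU (@continuous_picard b n.+1)|].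
by apply: nf; exact: ih.
Qed.

Theorem sol_exists b : exists U, sol b U.
Proof.
pose u s := lim (picard b n s @[n --> \oo]).
have cv s : picard b n s @[n --> \oo] --> u s.
  have : cvgn (fun n => picard b n s); last exact.
  apply: nondecreasing_is_cvgn.
    by apply/nondecreasing_seqP => n; exact: picard_le.
  have s0 : 0 <= Num.max s 0 by rewrite le_max lexx orbT.
  exists (1 - b * Num.max s 0 + Num.max s 0 / 16 * Num.max s 0) => _ [n _ <-].
  apply: le_trans (picard_le b n s) _; rewrite /= lerD2l.
  by have /andP[] := Kop_ge0_le (@continuous_picard b n) s0.
exists (fun s => u (Num.max s 0)).
apply: (@limit_sol (picard b) (fun n => picard b n.+1) (fun=> b)) => //.
- exact: continuous_picard.
- by move=> n s s0 /=; rewrite max_l.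
- exact: cvg_cst.
- move=> s _; have := cv s; rewrite -(cvg_shiftS (picard b ^~ s)); exact.
Qed.

Theorem sol_limit (U_ : nat -> R -> R) (b_ : nat -> R) b : (forall n, sol (b_ n) (U_ n)) ->
  b_ n @[n --> \oo] --> b -> (forall s, 0 <= s -> cvgn (fun n => U_ n s)) ->
  exists2 U, sol b U & forall s, 0 <= s -> U_ n s @[n --> \oo] --> U s.
Proof.
move=> hs bc cv; pose u s := lim (U_ n s @[n --> \oo]).
exists (fun s => u (Num.max s 0)); last by move=> s s0; rewrite max_l//; exact: cv.
apply: (@limit_sol U_ U_ b_) => //.
- by move=> n; have [] := hs n.
- by move=> n s s0; rewrite (hs n).2.
Qed.

Lemma sol_bounds b U s : sol b U -> 0 <= s -> 1 - b * s <= U s <= 1 - b * s + s / 16 * s.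
Proof.
move=> [cU h] s0; rewrite h//; have /andP[h1 h2] := Kop_ge0_le cU s0.
by rewrite lerDl h1 lerD2l.
Qed.

Lemma sol_decay b U s t : sol b U -> 0 <= s -> s <= t -> U s - b * (t - s) <= U t.
Proof.
move=> [cU h] s0 st; rewrite !h ?(le_trans s0)//.
have /andP[h1 _] := Kop_slope (cfU cU) (fun x => f01 (U x)) s0 st (lexx t).
by rewrite mulrBr; lra.
Qed.

Lemma sol_compare b1 b2 U1 U2 s : sol b1 U1 -> sol b2 U2 -> b2 < b1 -> 0 < s -> U1 s < U2 s.
Proof.
move=> h1 h2 b12 s0; apply: (ivp_compare cf nf (sol_ivp s h1) (sol_ivp s h2) b12).
by rewrite s0 lexx.
Qed.
End Solutions.

(** * Shooting *)

Section Shooting.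
Context {R : realType}.
Variables (p : R) (p0 : 0 < p) (k : R) (k1 : k < 1).
Implicit Types (g U V : R -> R) (s t a b L C x y : R).

Let k0 : 0 < 1 - k. Proof. by rewrite subr_gt0. Qed.

Lemma prim_gt0 g b t : continuous g -> (forall t, 0 <= t -> 0 <= g t) -> 0 < b ->
  0 <= t <= b -> 0 < g t -> 0 < prim g b.
Proof.
move=> cg g0 b0 ht gt; rewrite lt0r; apply/andP; split.
  by apply/eqP => e; have := prim_eq0 cg b0 g0 e ht => gz; move: gt; rewrite gz ltxx.
by apply: prim_ge0 => [//||u /andP[u0 _]]; [exact: ltW|exact: g0].
Qed.

Lemma Pop_strict g a b : continuous g -> (forall t, 0 <= t -> 0 <= g t) -> 0 < g 0 ->
  0 <= a -> a < b -> Pop k g a < Pop k g b.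
Proof.
move=> cg g0 gp a0 ab; have b0 : 0 < b by exact: le_lt_trans ab.
have avgp c : 0 <= c -> 0 < avg g c.
  rewrite le_eqVlt => /predU1P[<-|c0]; first by rewrite avg0.
  rewrite avgE ?gt_eqF// divr_gt0//; apply: (@prim_gt0 g c 0) => //; by rewrite lexx ltW.
have m1 : mint g a < mint g b.
  have [c /andP[ac cb] e] := mean_value (ltW ab) (fun x => is_derive_mint x cg).
  rewrite -subr_gt0 e mulr_gt0 ?subr_gt0// divr_gt0// avgp//; exact: le_trans ac.
have [k00|k00] := leP 0 k.
  rewrite !PopE//; apply: ltr_leD; first by rewrite ltr_pM2l.
  rewrite ler_wpM2l//; apply: avg_nondecr => //; last exact: ltW.
    by apply: contM; [exact: continuous_prim|exact: cont_cst].
  by move=> c d c0 cd; rewrite ler_wpM2r ?invr_ge0//; exact: prim_nondecr.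
rewrite /Pop -!mulNr; apply: ltr_leD => //; rewrite ler_wpM2l ?oppr_ge0 ?(ltW k00)//.
apply: avg_nondecr => //; [exact: continuous_mint| |exact: ltW].
by move=> c d c0 cd; exact: mint_nondecr.
Qed.

(* The power is frozen beyond [1]: a shooting solution meeting the boundary
   condition stays below its initial value [1]. *)
Definition fc x := ppow p (Num.min x 1).

Let cfc : continuous fc.
Proof. exact: cont_comp (@continuous_minr R 1) (continuous_ppow p0). Qed.

Let nfc x y : x <= y -> fc x <= fc y.
Proof. by move=> xy; apply: ppow_le => //; rewrite le_min !ge_min xy lexx !orbT. Qed.

Let fc1 : fc 1 = 1.
Proof. by rewrite /fc minxx ppowE// powR1. Qed.

Let fc01 x : 0 <= fc x <= 1.
Proof.
rewrite ppow_ge0 -[X in _ <= X]fc1 /fc minxx; apply: ppow_le => //.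
by rewrite ge_min lexx orbT.
Qed.

Let fc_ge0 x : 0 <= fc x. Proof. by have /andP[] := fc01 x. Qed.

Notation solution := (sol fc).

Let cF U : continuous U -> continuous (fun t => fc (U t)).
Proof. by move=> cU; exact: cont_comp cU cfc. Qed.

Lemma sol0 b U : solution b U -> U 0 = 1.
Proof. by move=> [_ h]; rewrite h// mulr0 subr0 /Kop mint0 addr0. Qed.

(* The boundary condition on the Laplacian holds at [s]. *)
Definition meets b U s := [/\ solution b U, 0 <= s & Pop k (fun t => fc (U t)) s = 4 * b * (1 - k)].

Lemma meets_avg b U s : meets b U s ->
  (1 - k) * (4 * b - avg (mint (fun t => fc (U t))) s) = avg (fun t => prim (fun t => fc (U t)) t / 4) s.
Proof.
move=> [hU s0 q]; rewrite -mint_sub_avg; last exact: cF hU.1.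
by move: q; rewrite /Pop; move: (mint _ s) (avg _ s) => A B; lra.
Qed.

(** With [F = fc (U)], the slope of [U] is [- b + avg (mint F) / 4], so this says that it is
    negative at [s]. The right side of [meets_avg] is positive because [F 0 = 1]. *)
Lemma meets_avg_gt0 b U s : meets b U s -> 0 < s -> avg (mint (fun t => fc (U t))) s < 4 * b.
Proof.
move=> h sp; have [hU s0 q] := h; have cFU := cF hU.1.
have e := meets_avg h.
have pp t : 0 < t -> 0 < prim (fun t => fc (U t)) t.
  move=> t0; apply: (@prim_gt0 _ t 0 cFU) => //; first by rewrite lexx ltW.
  by rewrite (sol0 hU) fc1.
have pp0 t : 0 <= t -> 0 <= prim (fun t => fc (U t)) t / 4.
  by rewrite le_eqVlt => /predU1P[<-|t0]; [rewrite prim0 mul0r|rewrite divr_ge0// ltW// pp].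
have cp4 : continuous (fun t => prim (fun t => fc (U t)) t / 4).
  by apply: contM; [exact: continuous_prim|exact: cont_cst].
have : 0 < avg (fun t => prim (fun t => fc (U t)) t / 4) s.
  rewrite avgE ?gt_eqF// divr_gt0//; apply: (@prim_gt0 _ s s cp4 pp0 sp); first by rewrite s0 lexx.
  by rewrite divr_gt0// pp.
by rewrite -e pmulr_rgt0// subr_gt0.
Qed.

Lemma sol_mean b U t t' : solution b U -> 0 <= t -> t <= t' ->
  exists2 c, t <= c <= t' & U t' - U t = (- b + avg (mint (fun t => fc (U t))) c / 4) * (t' - t).
Proof.
move=> hU t0 tt; have cm := continuous_mint (cF hU.1).
have d (x : R) : is_derive x 1 (fun x => 1 - b * x + Kop (fun t => fc (U t)) x)
    (- b + avg (mint (fun t => fc (U t))) x / 4).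
  have := is_deriveDR (is_deriveBR (is_derive_cstR 1 x) (is_deriveZR b (is_derive_idR x))) (is_derive_mint x cm).
  by rewrite mulr1 sub0r.
have [c hc e] := mean_value tt d; exists c => //.
by rewrite (hU.2 t')// ?(le_trans t0)// (hU.2 t)// e.
Qed.

Lemma mint_fc_nondecr U : continuous U -> forall a b, 0 <= a -> a <= b ->
  mint (fun t => fc (U t)) a <= mint (fun t => fc (U t)) b.
Proof. by move=> cU a b; apply: mint_nondecr; [exact: cF|move=> t _; exact: fc_ge0]. Qed.

(** The slope [- b + avg (mint F) / 4] is nondecreasing, so its negativity at the meeting point
    holds at all earlier points. *)
Lemma meets_decr b U s t t' : meets b U s -> 0 <= t -> t < t' -> t' <= s -> U t' < U t.
Proof.
move=> h t0 tt ts; have [hU s0 q] := h; have sp : 0 < s by apply: lt_le_trans ts; exact: le_lt_trans tt.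
have [c /andP[tc ct] e] := sol_mean hU t0 (ltW tt).
rewrite -subr_lt0 e; rewrite pmulr_llt0 ?subr_gt0//.
have := meets_avg_gt0 h sp.
have : avg (mint (fun t => fc (U t))) c <= avg (mint (fun t => fc (U t))) s.
  apply: avg_nondecr; [exact: continuous_mint (cF hU.1)|exact: mint_fc_nondecr hU.1| |].
    exact: le_trans tc.
  exact: le_trans ts.
by move: (avg _ c) (avg _ s) => A B; lra.
Qed.

Lemma meets_le b U s t : meets b U s -> 0 <= t <= s -> U s <= U t <= 1.
Proof.
move=> h /andP[t0 ts]; have [hU s0 q] := h; apply/andP; split.
  by move: ts; rewrite le_eqVlt => /predU1P[->//|ts]; exact: ltW (meets_decr h t0 ts (lexx s)).
rewrite -(sol0 hU); move: t0; rewrite le_eqVlt => /predU1P[<-//|t0].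
exact: ltW (meets_decr h (lexx 0) t0 ts).
Qed.

Lemma Pop_compare U V s : continuous U -> continuous V -> 0 <= s -> (forall t, 0 <= t -> U t <= V t) ->
  Pop k (fun t => fc (U t)) s <= Pop k (fun t => fc (V t)) s.
Proof.
move=> cU cV s0 h; rewrite -subr_ge0 -PopB; [|exact: cF..].
apply: Pop_ge0 => [//||//|t /andP[t0 _]]; first by apply: contB; exact: cF.
by rewrite subr_ge0 nfc// h.
Qed.

Lemma sol_le b1 b2 U1 U2 t : solution b1 U1 -> solution b2 U2 -> b2 < b1 -> 0 <= t -> U1 t <= U2 t.
Proof.
move=> h1 h2 b12; rewrite le_eqVlt => /predU1P[<-|t0]; first by rewrite (sol0 h1) (sol0 h2).
exact: ltW (sol_compare cfc nfc h1 h2 b12 t0).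
Qed.

Lemma meets_first b U L : solution b U -> 0 < b -> 0 <= L ->
  4 * b * (1 - k) <= Pop k (fun t => fc (U t)) L -> exists2 s, 0 < s <= L & meets b U s.
Proof.
move=> hU b0 L0 h; pose d t := 4 * b * (1 - k) - Pop k (fun t => fc (U t)) t.
have cd : continuous d by apply: contB; [exact: cont_cst|exact: continuous_Pop (cF hU.1)].
have d0 : 0 < d 0.
  by rewrite /d /Pop mint0 avg0 mint0 mulr0 subrr subr0 !mulr_gt0.
have dL : d L <= 0 by rewrite subr_le0.
have [s [hs ds _]] := first_zero cd d0 L0 dL; exists s => //; split => //.
  by have /andP[/ltW] := hs.
by move/eqP: ds; rewrite subr_eq0 eq_sym => /eqP.
Qed.

Definition admissible b := 0 <= b /\ exists U s, meets b U s /\ 0 <= U s.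

Lemma admissible0 : admissible 0.
Proof.
have [U hU] := sol_exists cfc nfc fc01 0; split => //; exists U, 0; split; last by rewrite (sol0 hU).
by split => //; rewrite /Pop mint0 avg0 mint0 mulr0 subrr mulr0 mul0r.
Qed.

(** A smaller parameter gives a larger solution [V] and a smaller threshold, so the condition is met
    at some [t <= s]; there [V t >= U t >= U s]. *)
Lemma admissible_down b b' : admissible b -> 0 <= b' -> b' < b -> admissible b'.
Proof.
move=> [b0 [U [s [h Us]]]]; have [hU s0 q] := h; rewrite le_eqVlt => /predU1P[<- _|b'0 bb].
  exact: admissible0.
have [V hV] := sol_exists cfc nfc fc01 b'.
have [t /andP[t0 ts] ht] : exists2 t, 0 < t <= s & meets b' V t.
  apply: meets_first => //; apply: (@le_trans _ _ (4 * b * (1 - k))).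
    by rewrite ler_pM2r// ler_pM2l// ltW.
  by rewrite -q; apply: (Pop_compare hU.1 hV.1 s0) => t t0; exact: sol_le hU hV bb t0.
split; first exact: ltW.
exists V, t; split => //; apply: le_trans (sol_le hU hV bb (ltW t0)).
have hts : 0 <= t <= s by rewrite (ltW t0).
by have /andP[h1 _] := meets_le h hts; exact: le_trans Us h1.
Qed.

Lemma mint_fc_le U s : continuous U -> 0 <= s -> 0 <= mint (fun t => fc (U t)) s <= s / 4.
Proof.
move=> cU s0; have cc (c : R) : continuous (fun _ : R => c) by exact: cont_cst.
apply/andP; split.
  by have := mint_le (cc 0) (cF cU) s0; rewrite mint_cst !mul0r; apply => t _; exact: fc_ge0.
have := mint_le (cF cU) (cc 1) s0; rewrite mint_cst mul1r; apply => t _.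
by have /andP[] := fc01 (U t).
Qed.

(** The condition cannot be met early: since [fc <= 1], [Pop] is at most [(1 + |k|) * s / 4], while
    it has to reach [4 * b * (1 - k)]. *)
Lemma meets_long b U s : meets b U s -> 16 * (1 - k) / (1 + `|k|) * b <= s.
Proof.
move=> [hU s0 q]; have := mint_sub_avg s (cF hU.1).
have := mint_fc_le hU.1 s0; have := normr_ge0 k.
have : 0 <= avg (mint (fun t => fc (U t))) s.
  rewrite -[leLHS](avg_cst 0 s); apply: avg_le => [||//|t /andP[t0 _]]; [exact: cont_cst|exact: continuous_mint (cF hU.1)|].
  by have /andP[] := mint_fc_le hU.1 t0.
have cp4 : continuous (fun t => prim (fun t => fc (U t)) t / 4).
  by apply: contM; [exact: continuous_prim (cF hU.1)|exact: cont_cst].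
have : 0 <= avg (fun t => prim (fun t => fc (U t)) t / 4) s.
  rewrite -[leLHS](avg_cst 0 s); apply: avg_le => [|//|//|t /andP[t0 _]]; first exact: cont_cst.
  by rewrite divr_ge0// prim_ge0// ?(cF hU.1)//; exact: cF hU.1.
move: q; rewrite /Pop.
move: (avg (fun t => _) s) (avg _ s) (mint _ s) => A B M q A0 B0 n0 /andP[M0 Ms] e.
have k1' : 0 < 1 + `|k| by lra.
have -> : 16 * (1 - k) / (1 + `|k|) * b = 16 * (1 - k) * b / (1 + `|k|) by ring.
rewrite ler_pdivrMr//.
have kB : - k * B <= `|k| * (s / 4).
  apply: (@le_trans _ _ (`|k| * B)); first by rewrite ler_wpM2r//; have := ler_norm (- k); rewrite normrN.
  by rewrite ler_wpM2l//; lra.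
have : 4 * b * (1 - k) <= (1 + `|k|) * (s / 4) by rewrite -q mulrDl mul1r; move: kB; rewrite mulNr; lra.
by move: (`|k|) => K; lra.
Qed.

(** For large [b] the solution is negative before the condition can be met. At [t = c * b], not
    beyond the meeting point by [meets_long], [U t <= 1 - b * t + t^2 / 16 <= 1 - b * t / 2]; the
    cap [c <= 8] gives the last inequality. *)
Lemma admissible_bound : exists2 B, 0 <= B & forall b, admissible b -> b <= B.
Proof.
pose c := Num.min (16 * (1 - k) / (1 + `|k|)) 8.
have n0 := normr_ge0 k; have c0 : 0 < c by rewrite lt_min !divr_gt0 ?mulr_gt0//=; lra.
have c8 : c <= 8 by rewrite /c ge_min lexx orbT.
(* Above this value [b >= 1] and [c * b > 2], hence [b * (c * b) > 2]. *)
exists (1 + 2 / c); first by rewrite addr_ge0// divr_ge0// ltW.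
move=> b [b0 [U [s [h Us]]]]; rewrite leNgt; apply/negP => bB.
have t0 : 0 <= c * b by rewrite mulr_ge0// ltW.
have ts : c * b <= s.
  by apply: le_trans (meets_long h); rewrite ler_wpM2r// /c ge_min lexx.
have [hU s0 q] := h.
have hts : 0 <= c * b <= s by rewrite t0 ts.
have /andP[Ut _] := meets_le h hts.
have /andP[_ Ub] := sol_bounds cfc fc01 hU t0.
have b1 : 1 <= b by have := divr_gt0 (ltr0n R 2) c0; lra.
have cb : 2 < c * b.
  have : 2 / c < b by lra.
  by rewrite ltr_pdivrMr// mulrC.
have : 2 < b * (c * b) by apply: lt_le_trans cb _; rewrite ler_peMl//; lra.
have : c * b / 16 * (c * b) <= b * (c * b) / 2.
  have : c * b / 16 <= b / 2 by nra.
  by move=> hh; have := ler_wpM2r t0 hh; lra.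
have := le_trans Us (le_trans Ut Ub).
by move: (c * b / 16 * (c * b)) (b * (c * b)) => A D; lra.
Qed.

(** The right side of [meets_avg], multiplied by [s], grows at least linearly in [s], because the
    nonlinearity has a fixed positive mass near 0. The left side, multiplied by [s], stays bounded,
    because [U] can only fall from 1 to 0. *)
Lemma meets_short B : 0 <= B -> exists L, forall b U s, 0 <= b -> b <= B -> meets b U s -> 0 <= U s -> s <= L.
Proof.
(* Up to [e] the solution has lost at most [1 / 2], so [c] bounds the nonlinearity from below
   there. *)
move=> B0; pose e := (2 * (B + 1))^-1; pose c := fc 2^-1.
have e0 : 0 < e by rewrite invr_gt0; lra.
have c0 : 0 < c by apply: ppow_gt0; rewrite lt_min ltr01 andbT invr_gt0.
exists (e + 16 * (1 - k) / (c * e)) => b U s b0 bB h Us; have [hU s0 q] := h.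
have [se|es] := leP s e; first by apply: le_trans se _; rewrite lerDl divr_ge0 ?mulr_ge0// ltW.
have sp : 0 < s by exact: lt_trans es.
have cFU := cF hU.1; have cp := continuous_prim cFU.
have cc (x : R) : continuous (fun _ : R => x) by exact: cont_cst.
have cp4 : continuous (fun t => prim (fun t => fc (U t)) t / 4) by apply: contM.
have Fe t : 0 <= t <= e -> c <= fc (U t).
  move=> /andP[t0 te]; apply: nfc; have /andP[lo _] := sol_bounds cfc fc01 hU t0.
  apply: le_trans lo; have : b * t <= (B + 1) * e by apply: ler_pM => //; lra.
  by rewrite /e invfM mulrCA mulfV ?mulr1; lra.
have pe : c * e <= prim (fun t => fc (U t)) e.
  by rewrite -prim_cst; apply: prim_le => //; exact: ltW.
have pt t : e <= t -> c * e <= prim (fun t => fc (U t)) t.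
  by move=> et; apply: le_trans pe _; apply: prim_nondecr => //; exact: ltW.
have low : c * e / 4 * (s - e) <= prim (fun t => prim (fun t => fc (U t)) t / 4) s.
  have := @derive_ge0_le R (fun x => prim (fun t => prim (fun t => fc (U t)) t / 4) x - c * e / 4 * x)
    (fun x => prim (fun t => fc (U t)) x / 4 - c * e / 4) e s (ltW es).
  move=> H; have : prim (fun t => prim (fun t => fc (U t)) t / 4) e - c * e / 4 * e <=
      prim (fun t => prim (fun t => fc (U t)) t / 4) s - c * e / 4 * s.
    apply: H => [x|x /andP[ex _]]; last by rewrite -mulrBl divr_ge0// subr_ge0 pt.
    by have := is_deriveBR (is_derive_prim x cp4) (is_deriveZR (c * e / 4) (is_derive_idR x)); rewrite mulr1.
  have : 0 <= prim (fun t => prim (fun t => fc (U t)) t / 4) e.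
    apply: prim_ge0 => [//||t /andP[t0 _]]; first exact: ltW.
    by rewrite divr_ge0// prim_ge0.
  by rewrite mulrBr; move: (prim _ e) (prim _ s) => x y; lra.
have [x /andP[x0 xs] me] := sol_mean hU (lexx 0) s0.
have ax : avg (mint (fun t => fc (U t))) x <= avg (mint (fun t => fc (U t))) s.
  by apply: avg_nondecr => //; [exact: continuous_mint|exact: mint_fc_nondecr hU.1].
have eq := meets_avg h; rewrite -mul_avg -eq in low.
(* The fall of [U] is at most 1, and its slope is everywhere at most the slope
   [- b + avg (mint F) s / 4] at the end. *)
have up : s * (4 * b - avg (mint (fun t => fc (U t))) s) <= 4.
  have : - 1 <= (- b + avg (mint (fun t => fc (U t))) x / 4) * (s - 0) by rewrite -me (sol0 hU); lra.
  rewrite subr0; have : (- b + avg (mint (fun t => fc (U t))) x / 4) * s <= (- b + avg (mint (fun t => fc (U t))) s / 4) * s.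
    by rewrite ler_wpM2r//; move: ax; move: (avg _ x) (avg _ s) => *; lra.
  by move: (avg _ x) (avg _ s) => A B' *; lra.
have : c * e / 4 * (s - e) <= (1 - k) * 4.
  by apply: le_trans low _; rewrite mulrCA ler_pM2l.
have ce : 0 < c * e by rewrite mulr_gt0.
move=> hh; rewrite -lerBlDl ler_pdivlMr// mulrC; lra.
Qed.

Lemma sol_Pop_cvg (U_ : nat -> R -> R) U : (forall n, continuous (U_ n)) -> continuous U ->
  (forall s, 0 <= s -> U_ n s @[n --> \oo] --> U s) ->
  forall s, 0 <= s -> Pop k (fun t => fc (U_ n t)) s @[n --> \oo] --> Pop k (fun t => fc (U t)) s.
Proof.
move=> cU_ cU lim s s0.
apply: (@Pop_cvg _ k (fun n t => fc (U_ n t)) (fun t => fc (U t)) 1 s); last by rewrite s0 lexx.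
- by move=> n; exact: cF.
- exact: cF.
- by move=> n t _; rewrite ger0_norm ?fc_ge0//; have /andP[] := fc01 (U_ n t).
- by move=> t _; rewrite ger0_norm ?fc_ge0//; have /andP[] := fc01 (U t).
- by move=> t /andP[t0 _]; apply: continuous_cvg; [exact: cfc|exact: lim].
Qed.

Let Pop_fc_nondecr U s t : continuous U -> 0 <= s -> s <= t ->
  Pop k (fun t => fc (U t)) s <= Pop k (fun t => fc (U t)) t.
Proof. by move=> cU s0 st; apply: (Pop_nondecr k1 (cF cU) _ s0 st) => u _; exact: fc_ge0. Qed.

(** Along parameters increasing to [b] the solutions decrease and the meeting points increase,
    bounded by [meets_short]. Solution and meeting point vary together; monotonicity allows one of
    them to be frozen, so that pointwise limits suffice. The boundary condition is obtained as two
    inequalities. *)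
Lemma admissible_limit b : 0 < b -> (forall c, 0 <= c -> c < b -> admissible c) -> admissible b.
Proof.
move=> b0 adm; split; first exact: ltW.
pose b_ n := b * (1 - n.+2%:R^-1).
have bn0 n : 0 <= b_ n /\ b_ n < b.
  have [h1 h2] := @n2_bounds R n; rewrite /b_; move: (n.+2%:R^-1) h1 h2 => q h1 h2.
  by split; [rewrite mulr_ge0 ?(ltW b0)//; lra|rewrite gtr_pMr//; lra].
have bnlt m n : (m < n)%N -> b_ m < b_ n.
  move=> mn; rewrite /b_ ltr_pM2l// ltrD2l ltrN2 ltf_pV2 ?posrE//.
  by rewrite ltr_nat !ltnS.
have blim : b_ n @[n --> \oo] --> b.
  have h : b * (1 - n.+2%:R^-1) @[n --> \oo] --> b * (1 - 0).
    by apply: cvgM; [exact: cvg_cst|apply: cvgB; [exact: cvg_cst|exact: cvg_n2]].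
  by move: h; rewrite subr0 mulr1; apply.
have /choice[Us hUs] n : exists Us : (R -> R) * R, meets (b_ n) Us.1 Us.2 /\ 0 <= Us.1 Us.2.
  have [h1 h2] := bn0 n; have [_ [U [s h]]] := adm _ h1 h2.
  by exists (U, s).
pose U_ n := (Us n).1; pose s_ n := (Us n).2.
have hm n : meets (b_ n) (U_ n) (s_ n) by have [] := hUs n.
have hp n : 0 <= U_ n (s_ n) by have [] := hUs n.
have hs n : solution (b_ n) (U_ n) by have [] := hm n.
have cU n : continuous (U_ n) by have [] := hs n.
have sn0 n : 0 <= s_ n by have [] := hm n.
have mq n : Pop k (fun t => fc (U_ n t)) (s_ n) = 4 * b_ n * (1 - k) by have [] := hm n.
have Ule n t : 0 <= t -> U_ n.+1 t <= U_ n t by move=> t0; exact: sol_le (hs n.+1) (hs n) (bnlt _ _ (ltnSn n)) t0.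
have cv t : 0 <= t -> cvgn (fun n => U_ n t).
  move=> t0; apply: nonincreasing_is_cvgn; first by apply/nonincreasing_seqP => n; exact: Ule.
  exists (1 - b * t) => _ [n _ <-]; have /andP[lo _] := sol_bounds cfc fc01 (hs n) t0.
  by apply: le_trans lo; rewrite lerD2l lerN2 ler_wpM2r// ltW//; have [] := bn0 n.
have [U hU lim] := sol_limit cfc fc01 hs blim cv.
have [L hL] := meets_short (ltW b0).
have sL n : s_ n <= L.
  have [h1 h2] := bn0 n; exact: (hL _ _ _ h1 (ltW h2) (hm n) (hp n)).
(* An earlier meeting point for the larger parameter would make its threshold at most that of the
   smaller one, by monotonicity of [Pop] in [s] and in the solution. *)
have snd : nondecreasing_seq s_.
  apply/nondecreasing_seqP => n; rewrite leNgt; apply/negP => lt.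
  have h1 := Pop_fc_nondecr (cU n.+1) (sn0 n.+1) (ltW lt).
  have h2 := Pop_compare (cU n.+1) (cU n) (sn0 n) (Ule n).
  have h3 := le_trans h1 h2; rewrite !mq ler_pM2r// ler_pM2l// in h3.
  by have := bnlt _ _ (ltnSn n); rewrite ltNge h3.
have sub : has_ubound (range s_) by exists L => _ [n _ <-]; exact: sL.
have slim := nondecreasing_cvgn snd sub.
pose s := sup (range s_); rewrite -/s in slim.
have sns n : s_ n <= s by apply: ub_le_sup => //; exists n.
have s0 : 0 <= s by exact: le_trans (sn0 0%N) (sns 0%N).
have Plim := sol_Pop_cvg cU hU.1 lim.
have clim : 4 * b_ n * (1 - k) @[n --> \oo] --> 4 * b * (1 - k).
  by apply: cvgM; [apply: cvgM => //; exact: cvg_cst|exact: cvg_cst].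
have Un n : 0 <= U (s_ n).
  apply: (cvg_ge (lim _ (sn0 n))); exists n => // m nm.
  have hts : 0 <= s_ n <= s_ m by rewrite sn0 snd.
  by have /andP[h _] := meets_le (hm m) hts; exact: le_trans (hp m) h.
have Pn n : Pop k (fun t => fc (U t)) (s_ n) <= 4 * b * (1 - k).
  rewrite -subr_ge0; apply: (cvg_ge (cvgB clim (Plim _ (sn0 n)))); exists n => // m nm.
  by rewrite [leRHS]/= subr_ge0 -mq; apply: Pop_fc_nondecr => //; exact: snd.
have Us0 : 0 <= U s.
  by apply: (@cvg_ge _ (fun n => U (s_ n))); [apply: continuous_cvg; [exact: hU.1|exact: slim]|exact: nearW].
have Ps : Pop k (fun t => fc (U t)) s <= 4 * b * (1 - k).
  apply: (@cvg_le _ (fun n => Pop k (fun t => fc (U t)) (s_ n))); last exact: nearW.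
  by apply: continuous_cvg; [exact: (@continuous_Pop _ k _ (cF hU.1) s)|exact: slim].
have Ps' : 4 * b * (1 - k) <= Pop k (fun t => fc (U t)) s.
  rewrite -subr_ge0; apply: (cvg_ge (cvgB (Plim _ s0) clim)); apply: nearW => m.
  by rewrite [leRHS]/= subr_ge0 -mq; exact: Pop_fc_nondecr.
exists U, s; split => //; split => //.
by apply/le_anti; rewrite Ps Ps'.
Qed.

Let minlip x y : `|Num.min x 1 - Num.min y 1| <= `|x - y|.
Proof.
have h1 := ler_norm (x - y); have := ler_norm (- (x - y)); rewrite normrN => h2.
by case: (leP x 1); case: (leP y 1) => ? ?; rewrite ler_norml; apply/andP; split; lra.
Qed.

(** Strict growth of [Pop] beyond [s] leaves room at [L > s], so by continuity in the parameter a
    slightly larger [b] still meets its condition before [L]. The meeting point is not before [s],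
    and between [s] and [L] the solution has no time to reach 0. *)
Lemma admissible_extend b U s : 0 <= b -> meets b U s -> 0 < U s -> exists2 c, b < c & admissible c.
Proof.
move=> b0 h Us; have [hU s0 q] := h.
have b1 : 0 < b + 1 by lra.
(* At slope at least [- (b + 1)] the solution loses at most [U s / 4] over a length [e]. *)
pose e := U s / (4 * (b + 1)); have e0 : 0 < e by rewrite divr_gt0// mulr_gt0.
have ee : (b + 1) * e = U s / 4 by rewrite /e; field; rewrite gt_eqF.
have be : b * e <= U s / 4 by rewrite -ee ler_pM2r//; lra.
pose L := s + e; have L0 : 0 <= L by rewrite addr_ge0// ltW.
have sL : s < L by rewrite /L ltrDl.
pose m := Num.min (U s / 2) 1.
have m0 : 0 < m by rewrite lt_min divr_gt0//= ltr01.
have Um t : 0 <= t <= L -> m <= Num.min (U t) 1.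
  move=> /andP[t0 tL]; rewrite le_min [m <= 1]ge_min lexx orbT andbT.
  rewrite ge_min; apply/orP; left; have [ts|/ltW st] := leP t s.
    by have /andP[h1 _] := meets_le h (introT andP (conj t0 ts)); apply: le_trans h1; lra.
  apply: le_trans (sol_decay cfc fc01 hU s0 st).
  have : b * (t - s) <= b * e by rewrite ler_wpM2l// lerBlDl.
  by move: be Us; move: (b * (t - s)) (b * e) => x y; lra.
pose b_ n := b + n.+2%:R^-1.
have bn n : b < b_ n /\ b_ n <= b + 1.
  by have [h1 h2] := @n2_bounds R n; rewrite /b_; move: (n.+2%:R^-1) h1 h2 => y h1 h2; split; lra.
have bnlt n : b_ n.+1 < b_ n by rewrite /b_ ltrD2l ltf_pV2 ?posrE// ltr_nat.
have blim : b_ n @[n --> \oo] --> b.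
  have h' : b + n.+2%:R^-1 @[n --> \oo] --> b + 0 by apply: cvgD; [exact: cvg_cst|exact: cvg_n2].
  by move: h'; rewrite addr0; apply.
have /choice[V_ hV] n := sol_exists cfc nfc fc01 (b_ n).
have cV n : continuous (V_ n) by have [] := hV n.
have VU n t : 0 <= t -> V_ n t <= U t by move=> t0; exact: sol_le (hV n) hU (bn n).1 t0.
have cv t : 0 <= t -> cvgn (fun n => V_ n t).
  move=> t0; apply: nondecreasing_is_cvgn.
    by apply/nondecreasing_seqP => n; exact: sol_le (hV n) (hV n.+1) (bnlt n) t0.
  by exists (U t) => _ [n _ <-]; exact: VU.
have [V hVl lim] := sol_limit cfc fc01 hV blim cv.
have m1 : m <= 1 by rewrite ge_min lexx orbT.
have [C C1 lip] := ppow_lipschitz p0 m0 m1.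
(* The limit of the solutions for [b_ n] solves the problem for [b]. It equals [U] because [U] stays
   above a positive constant on [[0, L]], where the Lipschitz bound is available. *)
have VUe : forall t, 0 <= t <= L -> V t = U t.
  apply: (ivp_unique cfc C1 L0 (sol_ivp L hVl) (sol_ivp L hU)) => t ht.
  apply: le_trans (lip _ _ _ _) _; [by rewrite Um// ge_min lexx orbT|by rewrite ge_min lexx orbT|].
  by apply: ler_wpM2l; [lra|exact: minlip].
have PL : 4 * b * (1 - k) < Pop k (fun t => fc (V t)) L.
  rewrite (Pop_ext k (cF hVl.1) (cF hU.1) L0); last by move=> t ht; rewrite VUe.
  rewrite -q; apply: Pop_strict => //; [exact: cF hU.1|by rewrite (sol0 hU) fc1].
have Plim := sol_Pop_cvg cV hVl.1 lim L0.
have clim : 4 * b_ n * (1 - k) @[n --> \oo] --> 4 * b * (1 - k).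
  by apply: cvgM; [apply: cvgM => //; exact: cvg_cst|exact: cvg_cst].
have dlim : Pop k (fun t => fc (V_ n t)) L - 4 * b_ n * (1 - k) @[n --> \oo] -->
    Pop k (fun t => fc (V t)) L - 4 * b * (1 - k) by apply: cvgB.
have slim : V_ n s @[n --> \oo] --> U s.
  by rewrite -(VUe s) ?s0 ?(ltW sL)//; exact: lim.
have d0 : 0 < Pop k (fun t => fc (V t)) L - 4 * b * (1 - k) by rewrite subr_gt0.
have Us2 : 0 < U s / 2 by rewrite divr_gt0.
have [n [hn1 hn2]] : exists n, 4 * b_ n * (1 - k) <= Pop k (fun t => fc (V_ n t)) L /\ U s / 2 <= V_ n s.
  move/cvgrPdist_lt : dlim => /(_ _ d0) D; move/cvgrPdist_lt : slim => /(_ _ Us2) E.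
  have [N _ hN] := filterI D E; exists N; have [hd he] := hN N (leqnn N); split.
    move: hd; move: (Pop _ _ L) (Pop _ _ L) (4 * b * (1 - k)) (4 * b_ N * (1 - k)) => A A' x x'.
    by rewrite ltr_norml => /andP[_]; lra.
  by move: he; rewrite ltr_norml => /andP[_]; lra.
have [bbn bn1] := bn n.
have bnp : 0 < b_ n by exact: le_lt_trans bbn.
have [t /andP[t0 tL] ht] := meets_first (hV n) bnp L0 hn1.
have [_ _ tq] := ht.
have st : s <= t.
  rewrite leNgt; apply/negP => ts.
  have := Pop_compare (cV n) hU.1 (ltW t0) (VU n).
  have := Pop_fc_nondecr hU.1 (ltW t0) (ltW ts); rewrite q tq => h1 h2.
  have := le_trans h2 h1; rewrite ler_pM2r// ler_pM2l//.
  by rewrite leNgt bbn.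
exists (b_ n) => //; split; first exact: ltW.
exists (V_ n), t; split => //.
apply: le_trans (sol_decay cfc fc01 (hV n) s0 st).
have : b_ n * (t - s) <= (b + 1) * e.
  by apply: ler_pM => //; [exact: ltW|rewrite subr_ge0|rewrite lerBlDl].
rewrite ee; move: hn2; move: (b_ n * (t - s)) (V_ n s) => x y; lra.
Qed.

Theorem shooting : exists b L U, [/\ 0 < L, profile p k 1 b L U &
  forall t t', 0 <= t -> t < t' -> t' <= L -> U t' < U t].
Proof.
have [B B0 hB] := admissible_bound.
have hs : has_sup [set b | admissible b] by split; [exists 0; exact: admissible0|exists B => b; exact: hB].
pose b := sup [set b | admissible b].
have ub c : admissible c -> c <= b by move=> hc; apply: ub_le_sup => //; exact: hs.2.
have b0 : 0 <= b by apply: ub; exact: admissible0.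
have hb : admissible b.
  move: (b0); rewrite le_eqVlt => /predU1P[e|bp]; first by rewrite -e; exact: admissible0.
  apply: admissible_limit => // c c0 cb.
  have bc : 0 < b - c by rewrite subr_gt0.
  have [d hd] := sup_adherent bc hs; rewrite -/b opprB addrC subrK => cd.
  exact: admissible_down hd c0 cd.
have [_ [U [s [h Us]]]] := hb; have [hU s0 q] := h.
have U0 : U s = 0.
  apply/eqP; apply: contraT => Un; have Up : 0 < U s by rewrite lt0r Un Us.
  have [c bc hc] := admissible_extend b0 h Up.
  by have := ub c hc; rewrite leNgt bc.
have sp : 0 < s.
  rewrite lt0r s0 andbT; apply/eqP => se; move: U0; rewrite se (sol0 hU).
  by move/eqP; rewrite oner_eq0.
have fE t : 0 <= t <= s -> fc (U t) = ppow p (U t).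
  by move=> ht; have /andP[_ h1] := meets_le h ht; rewrite /fc min_l.
have cp : continuous (fun t => ppow p (U t)) by exact: cont_comp hU.1 (continuous_ppow p0).
exists b, s, U; split => //; last by move=> t t'; exact: meets_decr h.
split => //.
- split; first exact: hU.1.
  move=> t /andP[t0 ts]; rewrite hU.2//; congr (_ + _).
  apply: Kop_ext => [||//|u /andP[u0 ut]]; [exact: cF hU.1|exact: cp|].
  by apply: fE; rewrite u0 (le_trans ut).
- by move=> t t0 ts; rewrite -U0; exact: (meets_decr h t0 ts (lexx s)).
- rewrite -q; apply: Pop_ext => [||//|u hu]; [exact: cp|exact: cF hU.1|].
  by rewrite fE.
Qed.
End Shooting.

(** * Existence, uniqueness and monotonicity of the radial solution *)

Theorem theorem1p3 (R : realType) (r p sigma : R)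
    (hr : 0 < r) (hp : 0 < p) (hp1 : p != 1) (hsigma : -1 < sigma) :
  exists u : R * R -> R,
    [/\ positive_radial_solution r r^-1 sigma p u,
        radially_decreasing r u &
        forall v : R * R -> R, positive_radial_solution r r^-1 sigma p v ->
          forall x, cdisc r x -> v x = u x].
Proof.
have k1 := bcoef_lt1 hsigma; have S0 : 0 < r ^+ 2 by rewrite exprn_gt0.
have [b [L [U [L0 hU decr]]]] := shooting hp k1.
have [m [c [m0 hV]]] := profile_rescale hp hp1 L0 S0 hU.
set V := fun s => m * U (L / r ^+ 2 * s) in hV.
have [Vp VE] := usol_of_profile hr hp hsigma hV.
have cV : continuous V by have [[]] := hV.
have inS x : cdisc r x -> 0 <= sqn x <= r ^+ 2 by move/(cdisc_sqn hr) => h; rewrite sqn_ge0.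
exists (fun x => usol r sigma (fun t => ppow p (V t)) (sqn x)); split.
- exact: solution_of_profile.
- move=> x y xD yD xy; have : enorm x ^+ 2 < enorm y ^+ 2 by rewrite ltr_pXn2r ?nnegrE ?sqrtr_ge0.
  rewrite /enorm !sqr_sqrtr ?sqn_ge0// -!/(sqn _) => sxy.
  have /andP[x0 xS] := inS x xD; have /andP[y0 yS] := inS y yD.
  have l0 : 0 < L / r ^+ 2 by rewrite divr_gt0.
  rewrite -!VE ?x0 ?y0// /V ltr_pM2l//; apply: decr.
  + by rewrite mulr_ge0// ltW.
  + by rewrite ltr_pM2l.
  + by rewrite mulrAC ler_pdivrMr// ler_pM2l.
- move=> v hv x xD; have [f [cf vE fp fE]] := profile_of_solution hr hp hsigma hv.
  have hf := profile_of_usol hr hp hsigma cf fp fE.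
  have f0 : 0 < f 0 by apply: fp; rewrite lexx.
  rewrite vE// -VE ?inS//.
  exact: (profile_unique_fixed hp k1 hp1 S0 f0 m0 hf hV (inS x xD)).
Qed.
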